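(* Let $T$ be an $m$-linear strongly singular integral operator with generalized kernel on the RD-space $\mathcal X$ ($m$-GSSIO), with associated parameters $p_0,q,r_1,\dots,r_m,l_1,\dots,l_m$, and let $1/p_0+1/p_0'=1$. Assume $q>1$ and $p_0'\ge\max\{r_1,\dots,r_m,l_1,\dots,l_m\}$. Then $T$ can be extended to a bounded operator from $L^\infty(\mathcal X)\times\cdots\times L^\infty(\mathcal X)$ ($m$ factors) into $BMO(\mathcal X)$.
   Context: Space. $(\mathcal X,d)$ is a metric space with balls $B(x,r)=\{y:d(x,y)<r\}$ and a regular Borel measure $\mu$ with $0<\mu(B(x,r))<\infty$ for all $x\in\mathcal X$, $r>0$. It is an RD-space: $\mu$ is doubling, $\mu(B(x,2r))\le C_1\mu(B(x,r))$ for all $x,r$, and reverse doubling: there are $\kappa>0$, $C_2\in(0,1]$ with $C_2\lambda^\kappa\mu(B(x,r))\le\mu(B(x,\lambda r))$ for all $x$, $0<r<2\,\mathrm{diam}(\mathcal X)$, $1\le\lambda<2\,\mathrm{diam}(\mathcal X)/r$. Standing assumptions: $\mu(\mathcal X)=\infty$; there are $n\ge\kappa$ and $C_3\ge1$ (one may take $n=\log_2C_1$, $C_3=C_1$) with $C_2\lambda^\kappa\mu(B(x,r))\le\mu(B(x,\lambda r))\le C_3\lambda^n\mu(B(x,r))$ for all $x$, $r>0$, $\lambda\ge1$; and there is a positive nondecreasing function $\psi$ on $[0,\infty)$ with $\mu(B(x,r))\sim\psi(r)$ uniformly in $x\in\mathcal X$, $r>0$. The numbers $\kappa,n$ are fixed.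 Strongly singular generalized kernel. Let $\Omega_m=\mathcal X^{m+1}\setminus\{(y_0,\dots,y_m):y_0=\cdots=y_m\}$. A locally integrable $K:\Omega_m\to\mathbb C$ is a strongly singular generalized kernel if for some $\varepsilon>0$, $0<\alpha\le1$, a fixed $1<p_0<\infty$, and a constant $C$, for all $x\neq x'$ in $\mathcal X$ and all $k\in\mathbb N_+$, $$\Big(\int_{2^kd(x,x')^t\le\rho(\vec y,\vec x)\le2^{k+1}d(x,x')^t}|K(x,y_1,\dots,y_m)-K(x',y_1,\dots,y_m)|^{p_0}\,d\mu(y_1)\cdots d\mu(y_m)\Big)^{1/p_0}\le C\,d(x,x')^{\varepsilon-t(\frac{\beta m}{p_0'}+\frac{\varepsilon}{\alpha})}\,2^{-k(\frac{nm}{p_0'}+\frac{\varepsilon}{\alpha})},$$ where $\vec y=(y_1,\dots,y_m)$, $\vec x=(x,\dots,x)$, $\rho(\vec y,\vec x)=\max_{1\le j\le m}d(y_j,x)$, $1/p_0+1/p_0'=1$, and $t=1,\beta=n$ if $d(x,x')\ge1$, while $t=\alpha,\beta=\kappa$ if $d(x,x')<1$. $m$-GSSIO. For $\eta\in(0,1]$, $C_b^\eta(\mathcal X)$ is the space of functions with bounded support and $\sup_{x\ne y}|f(x)-f(y)|/d(x,y)^\eta<\infty$ (with its usual inductive limit topology), and $(C_b^\eta(\mathcal X))'$ is its dual. An $m$-linear operator $T:C_b^\eta(\mathcal X)\times\cdots\times C_b^\eta(\mathcal X)\to(C_b^\eta(\mathcal X))'$ (for some $\eta$) such that $T(f_1,\dots,f_m)(x)=\int_{\mathcal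 X^m}K(x,y_1,\dots,y_m)\prod_jf_j(y_j)\,d\mu(y_1)\cdots d\mu(y_m)$ for $f_j\in C_b^\eta(\mathcal X)$ and $x\notin\bigcap_j\mathrm{supp}f_j$ is an $m$-GSSIO if: (i) $K$ is a strongly singular generalized kernel (with parameters $\varepsilon,\alpha,p_0$); (ii) for some given $1\le r_1,\dots,r_m<\infty$ with $1/r=\sum_j1/r_j$, $T$ is bounded from $L^{r_1}(\mathcal X)\times\cdots\times L^{r_m}(\mathcal X)$ to $L^{r,\infty}(\mathcal X)$; (iii) for some given $1\le l_1,\dots,l_m<\infty$ with $1/l=\sum_j1/l_j$, $T$ is bounded from $L^{l_1}(\mathcal X)\times\cdots\times L^{l_m}(\mathcal X)$ to $L^{q,\infty}(\mathcal X)$, where $0<l/q\le\alpha\kappa/n$. In (ii), (iii), $T$ also denotes the corresponding bounded extension. BMO. $BMO(\mathcal X)$ is the space of $f\in L^1_{loc}(\mathcal X)$ with $\|f\|_{BMO(\mathcal X)}=\sup_B\frac1{\mu(B)}\int_B|f-f_B|\,d\mu<\infty$, where $f_B=\frac1{\mu(B)}\int_Bf\,d\mu$ and the supremum is over all balls $B\subset\mathcal X$. Boundedness means $\|T(\vec f)\|_{BMO(\mathcal X)}\le C\prod_{j=1}^m\|f_j\|_{L^\infty(\mathcal X)}$. *)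

(* Defs.v *)
From HB Require Import structures.
From mathcomp Require Import all_boot all_order all_algebra complex.
From mathcomp Require Import all_classical all_reals all_analysis.
Set Implicit Arguments.
Unset Strict Implicit.
Unset Printing Implicit Defensive.
Import Order.TTheory GRing.Theory Num.Theory.
Import numFieldNormedType.Exports.
Local Open Scope classical_set_scope.
Local Open Scope ring_scope.

(* A metric space measured by its Borel sigma-algebra. *)
HB.mixin Record isBorelMetric (R : realType) (d : measure_display) X
    & Metric R X & Measurable d X := {
  borelE : (@measurable d X : set (set X)) = <<s @open X >>
}.

#[short(type="borelMetricType")]
HB.structure Definition BorelMetric (R : realType) (d : measure_display) :=
  { X of isBorelMetric R d X & Metric R X & Measurable d X }.

(* The product measure on n.-tuple T, whose product sigma-algebra is the
   library's: the iterated \x, transported along (x, t) |-> x :: t. *)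
Section cons_measure.
Context (R : realType) (d : measure_display) (T : measurableType d).
Variables (mu : {sigma_finite_measure set T -> \bar R}) (n : nat)
  (nu : {sigma_finite_measure set (n.-tuple T) -> \bar R}).

Definition tcons (p : T * n.-tuple T) : n.+1.-tuple T := [tuple of p.1 :: p.2].

Lemma measurable_tcons : measurable_fun setT tcons.
Proof. exact: (@measurable_cons _ _ (T * n.-tuple T)%type T fst n snd). Qed.

Definition cons_measure : set (n.+1.-tuple T) -> \bar R :=
  pushforward (mu \x nu)%E tcons.

Let cons_measure0 : cons_measure set0 = 0%E.
Proof. by rewrite /cons_measure /pushforward preimage_set0 measure0. Qed.

Let cons_measure_ge0 A : (0 <= cons_measure A)%E.
Proof. by rewrite /cons_measure /pushforward measure_ge0. Qed.

Let cons_measure_sigma_additive : semi_sigma_additive cons_measure.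
Proof.
move=> F mF tF mUF; rewrite /cons_measure /pushforward preimage_bigcup.
apply: measure_semi_sigma_additive.
- by move=> k; rewrite -[X in measurable X]setTI; exact: measurable_tcons.
- apply/trivIsetP => /= i j _ _ ij; rewrite -preimage_setI.
  by move/trivIsetP : tF => /(_ _ _ _ _ ij) ->//; rewrite preimage_set0.
- rewrite -preimage_bigcup -[X in measurable X]setTI.
  exact: measurable_tcons.
Qed.

HB.instance Definition _ := isMeasure.Build _ _ _ cons_measure
  cons_measure0 cons_measure_ge0 cons_measure_sigma_additive.

Let cons_measure_sigma_finite : sigma_finite setT cons_measure.
Proof.
have [F TF Foo] : sigma_finite setT (mu \x nu)%E.
  have /sigma_finiteP[F [TF ndF Foo]] := sigma_finiteT mu.
  have /sigma_finiteP[G [TG ndG Goo]] := sigma_finiteT nu.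
  exists (fun k => F k `*` G k).
    rewrite -setXTT TF TG predeqE => -[x y]; split.
      move=> [/= [i _ Fix] [j _ Gjy]]; exists (maxn i j) => //; split.
      - by move: x Fix; exact/subsetPset/ndF/leq_maxl.
      - by move: y Gjy; exact/subsetPset/ndG/leq_maxr.
    by move=> [k _ []/= ? ?]; split; exists k.
  move=> k; have [? ?] := Foo k; have [? ?] := Goo k.
  split; first exact: measurableX.
  by rewrite product_measure1E// lte_mul_pinfty// ge0_fin_numE.
pose uncons (t : n.+1.-tuple T) := (thead t, [tuple of behead t]).
have consK : cancel tcons uncons.
  by move=> [x t]; congr pair; apply/val_inj.
have munc : measurable_fun setT uncons.
  apply/measurable_fun_pairP; split => /=.
    exact: measurable_tnth.
  exact: measurable_behead.
exists (fun k => uncons @^-1` F k).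
  by rewrite -preimage_bigcup -TF preimage_setT.
move=> k; have [mF Flt] := Foo k; split.
  by rewrite -[X in measurable X]setTI; exact: munc.
rewrite /cons_measure /pushforward -comp_preimage (_ : uncons \o tcons = id)//.
by apply/funext => p; exact: consK.
Qed.

HB.instance Definition _ := Measure_isSigmaFinite.Build _ _ _ cons_measure
  cons_measure_sigma_finite.
End cons_measure.

Fixpoint power_measure (R : realType) (d : measure_display)
    (T : measurableType d) (mu : {sigma_finite_measure set T -> \bar R})
    (n : nat) : {sigma_finite_measure set (n.-tuple T) -> \bar R} :=
  match n with
  | 0%N => dirac ([tuple] : 0.-tuple T)
  | n'.+1 => cons_measure mu (power_measure mu n')
  end.

Section complex_integration.
Context (R : realType) (d : measure_display) (T : measurableType d).
Variable mu : {measure set T -> \bar R}.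
Implicit Types (D : set T) (f g : T -> R[i]).

(* The modulus as a real number (`|z| has type R[i]). *)
Definition cabs (z : R[i]) : R := complex.Re `|z|.

Definition cmeasurable D f :=
  measurable_fun D (@complex.Re R \o f) /\
  measurable_fun D (@complex.Im R \o f).

Definition cintegrable D f :=
  mu.-integrable D (EFin \o (@complex.Re R \o f)) /\
  mu.-integrable D (EFin \o (@complex.Im R \o f)).

Definition cintegral D f : R[i] :=
  Complex (\int[mu]_(x in D) complex.Re (f x))
          (\int[mu]_(x in D) complex.Im (f x)).

Definition ae_equal f g := {ae mu, forall x, f x = g x}.

Definition Lpnorm (p : \bar R) f : \bar R :=
  Lnorm mu p (EFin \o (cabs \o f)).

Definition Lp (p : \bar R) : set (T -> R[i]) :=
  [set f | cmeasurable setT f /\ (Lpnorm p f < +oo)%E].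

Definition weakLpnorm (p : R) f : \bar R :=
  ereal_sup [set (t%:E * mu [set x | (t < cabs (f x))%R] `^ p^-1)%E
            | t in [set t : R | 0 < t]].
End complex_integration.

(* S is additive and homogeneous in each variable on the product of the spaces
   dom i, up to the equality eqv of its values (scalar functions on Y). *)
Definition multilinear_on (R : realType) (X Y : Type) (m : nat)
    (dom : 'I_m -> set (X -> R[i])) (eqv : (Y -> R[i]) -> (Y -> R[i]) -> Prop)
    (S : ('I_m -> X -> R[i]) -> Y -> R[i]) :=
  forall (f : 'I_m -> X -> R[i]) (i : 'I_m) (a : R[i]) (g : X -> R[i]),
    (forall j, dom j (f j)) -> dom i g ->
    eqv (S (dfwith f i (fun x => a * f i x + g x)))
        (fun y => a * S f y + S (dfwith f i g) y).

Section RD_space.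
Context (R : realType) (d : measure_display) (X : borelMetricType R d).
Variable mu : {measure set X -> \bar R}.

Definition diam : \bar R :=
  ereal_sup [set (mdist p.1 p.2)%:E | p in [set: X * X]].

(* Inner regularity by closed sets: implied by inner regularity by compact
   sets, since X is Hausdorff. *)
Definition regular_measure :=
  forall A : set X, measurable A ->
    mu A = ereal_inf [set mu U | U in [set U | open U /\ A `<=` U]] /\
    mu A = ereal_sup [set mu F | F in [set F | closed F /\ F `<=` A]].

Record RD_space (C1 C2 C3 kappa n : R) : Prop := {
  RD_regular : regular_measure ;
  RD_ball : forall (x : X) (r : R), 0 < r -> (0 < mu (ball x r) < +oo)%E ;
  RD_doubling : forall (x : X) (r : R), 0 < r ->
    (mu (ball x (2 * r)) <= C1%:E * mu (ball x r))%E ;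
  RD_kappa : 0 < kappa ;
  RD_C2 : 0 < C2 <= 1 ;
  RD_reverse_doubling : forall (x : X) (r lambda : R),
    0 < r -> (r%:E < 2%:E * diam)%E ->
    1 <= lambda -> ((lambda * r)%:E < 2%:E * diam)%E ->
    ((C2 * lambda `^ kappa)%:E * mu (ball x r) <= mu (ball x (lambda * r)))%E ;
  RD_infinite : mu [set: X] = +oo%E ;
  RD_n : kappa <= n ;
  RD_C3 : 1 <= C3 ;
  RD_growth : forall (x : X) (r lambda : R), 0 < r -> 1 <= lambda ->
    ((C2 * lambda `^ kappa)%:E * mu (ball x r) <= mu (ball x (lambda * r)))%E /\
    (mu (ball x (lambda * r)) <= (C3 * lambda `^ n)%:E * mu (ball x r))%E ;
  (* psi 0 is only required to be nonnegative: RD_growth forces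
     mu (ball x r) --> 0 as r --> 0, which a nondecreasing psi comparable to it
     with psi 0 > 0 would contradict. *)
  RD_psi : exists psi : R -> R,
    [/\ forall r s : R, 0 <= r -> r <= s -> psi r <= psi s,
        0 <= psi 0, forall r : R, 0 < r -> 0 < psi r &
        exists2 c : R, 0 < c & forall (x : X) (r : R), 0 < r ->
          ((c^-1 * psi r)%:E <= mu (ball x r))%E /\
          (mu (ball x r) <= (c * psi r)%:E)%E]
}.
End RD_space.

Section test_functions.
Context (R : realType) (d : measure_display) (X : borelMetricType R d).
Variable mu : {measure set X -> \bar R}.
Implicit Types (eta : R) (f : X -> R[i]) (L : (X -> R[i]) -> R[i]).

Definition supp f : set X := closure [set x | f x != 0].

Definition supported_in_ball f (x : X) (r : R) :=
  [set y | f y != 0] `<=` ball x r.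

Definition holder_seminorm eta f : \bar R :=
  ereal_sup [set v : \bar R | exists x y : X, x <> y /\
    v = (cabs (f x - f y) / mdist x y `^ eta)%:E].

Definition Cb eta : set (X -> R[i]) :=
  [set f | (exists x r, supported_in_ball f x r) /\
           (holder_seminorm eta f < +oo)%E].

(* Continuity for the inductive limit topology, i.e. continuity of the
   restriction of L to each normed space of functions of Cb eta supported in a
   fixed ball (on which, X being unbounded, holder_seminorm is a norm). *)
Definition Cb_dual eta : set ((X -> R[i]) -> R[i]) :=
  [set L | (forall (a : R[i]) phi phi', Cb eta phi -> Cb eta phi' ->
              L (fun x => a * phi x + phi' x) = a * L phi + L phi') /\
           (forall (x : X) r, exists M : R, forall phi, Cb eta phi ->
              supported_in_ball phi x r ->
              ((cabs (L phi))%:E <= M%:E * holder_seminorm eta phi)%E)].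

(* The distribution L is given by the function g on the open set U. *)
Definition represented_on eta (U : set X) L (g : X -> R[i]) :=
  forall phi, Cb eta phi -> supp phi `<=` U ->
    cintegrable mu setT (fun x => g x * phi x) /\
    L phi = cintegral mu setT (fun x => g x * phi x).

End test_functions.

Section BMO.
Context (R : realType) (d : measure_display) (X : borelMetricType R d).
Variable mu : {measure set X -> \bar R}.
Implicit Types (f : X -> R[i]) (B : set X).

Definition mean B f : R[i] := ((fine (mu B))^-1)%:C%C * cintegral mu B f.

Definition L1loc : set (X -> R[i]) :=
  [set f | forall (x : X) (r : R), 0 < r -> cintegrable mu (ball x r) f].

Definition BMOnorm f : \bar R :=
  ereal_sup [set v : \bar R | exists (x : X) (r : R), 0 < r /\
    v = (((fine (mu (ball x r)))^-1)%:E *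
         \int[mu]_(y in ball x r) (cabs (f y - mean (ball x r) f))%:E)%E].

Definition BMO : set (X -> R[i]) :=
  [set f | L1loc f /\ (BMOnorm f < +oo)%E].

(* BMOnorm vanishes on constants; this is equality of elements of BMO. *)
Definition BMO_equal f g := BMOnorm (fun x => f x - g x) = 0%E.
End BMO.

Section GSSIO.
Context (R : realType) (d : measure_display) (X : borelMetricType R d).
Variables (mu : {sigma_finite_measure set X -> \bar R}) (kappa n : R).
Variable m : nat.

(* The kernel K(x, y_1, .., y_m), with junk values on the diagonal. *)
Implicit Types (eta : R) (K : m.+1.-tuple X -> R[i]) (f : 'I_m -> X -> R[i])
  (T : ('I_m -> X -> R[i]) -> (X -> R[i]) -> R[i])
  (S : ('I_m -> X -> R[i]) -> X -> R[i]).

Definition Omega : set (m.+1.-tuple X) :=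
  [set z | exists i, tnth z i <> tnth z ord0].

Definition locally_integrable_kernel K :=
  cmeasurable Omega K /\
  forall z, Omega z -> exists2 r : R, 0 < r &
    cintegrable (power_measure mu m.+1)
      (Omega `&` [set w | forall i, ball (tnth z i) r (tnth w i)]) K.

Definition rho (y : m.-tuple X) (x : X) : R :=
  \big[Num.max/0]_(i < m) mdist (tnth y i) x.

Record strongly_singular_kernel K (eps alpha p0 p0' : R) : Prop := {
  ssk_eps : 0 < eps ;
  ssk_alpha : 0 < alpha <= 1 ;
  ssk_p0 : 1 < p0 ;
  ssk_p0' : p0^-1 + p0'^-1 = 1 ;
  ssk_loc : locally_integrable_kernel K ;
  ssk_bound : exists C : R, forall (x x' : X) (k : nat), x <> x' -> (0 < k)%N ->
    let D := mdist x x' in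
    let t := if 1 <= D then 1 else alpha in
    let beta := if 1 <= D then n else kappa in
    let A := [set y : m.-tuple X |
                2 ^+ k * D `^ t <= rho y x <= 2 ^+ k.+1 * D `^ t] in
    ((\int[power_measure mu m]_(y in A)
        (cabs (K [tuple of x :: y] - K [tuple of x' :: y]) `^ p0)%:E) `^ p0^-1
     <= (C * D `^ (eps - t * (beta * m%:R / p0' + eps / alpha))
           * 2 `^ (- (k%:R * (n * m%:R / p0' + eps / alpha))))%:E)%E
}.

Definition kernel_integrand K f (x : X) (y : m.-tuple X) : R[i] :=
  K [tuple of x :: y] * \prod_(i < m) f i (tnth y i).

(* T(f)(x) is the kernel integral for x outside the intersection of the
   supports: the integral makes sense at almost every such x and gives the
   distribution T(f) on this open set. *)
Definition has_kernel eta T K :=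
  forall f, (forall i, Cb eta (f i)) ->
    let U := ~` \bigcap_(i in [set: 'I_m]) supp (f i) in
    {ae mu, forall x, U x ->
      cintegrable (power_measure mu m) setT (kernel_integrand K f x)} /\
    represented_on mu eta U (T f) (fun x =>
      cintegral (power_measure mu m) setT (kernel_integrand K f x)).

(* S is a bounded extension of T from L^{p_1} x .. x L^{p_m} to L^{s, oo}. *)
Definition weak_extension eta T (p : 'I_m -> R) (s : R) S :=
  [/\ forall f, (forall i, Lp mu (p i)%:E (f i)) -> cmeasurable setT (S f),
      multilinear_on (fun i => Lp mu (p i)%:E) (ae_equal mu) S,
      exists C : R, forall f, (forall i, Lp mu (p i)%:E (f i)) ->
        (weakLpnorm mu s (S f) <=
          (C * \prod_(i < m) fine (Lpnorm mu (p i)%:E (f i)))%:E)%E &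
      forall f, (forall i, Cb eta (f i)) ->
        represented_on mu eta setT (T f) (S f)].

Record GSSIO eta T K (eps alpha p0 p0' : R) (rs : 'I_m -> R) (r : R)
    (ls : 'I_m -> R) (l q : R) : Prop := {
  GSSIO_eta : 0 < eta <= 1 ;
  GSSIO_dual : forall f, (forall i, Cb eta (f i)) -> Cb_dual eta (T f) ;
  GSSIO_multilinear : multilinear_on (fun=> Cb eta)
    (fun L L' => forall phi, Cb eta phi -> L phi = L' phi) T ;
  GSSIO_kernel : has_kernel eta T K ;
  GSSIO_ssk : strongly_singular_kernel K eps alpha p0 p0' ;
  GSSIO_rs : forall i, 1 <= rs i ;
  GSSIO_r : r^-1 = \sum_(i < m) (rs i)^-1 ;
  GSSIO_weak_r : exists S, weak_extension eta T rs r S ;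
  GSSIO_ls : forall i, 1 <= ls i ;
  GSSIO_l : l^-1 = \sum_(i < m) (ls i)^-1 ;
  GSSIO_q : 0 < l / q <= alpha * kappa / n ;
  GSSIO_weak_q : exists S, weak_extension eta T ls q S
}.

Definition agrees_with_weak_extension eta T (p : 'I_m -> R) (s : R) S :=
  forall S', weak_extension eta T p s S' ->
    forall f, (forall i, Lp mu +oo%E (f i)) ->
      (forall i, Lp mu (p i)%:E (f i)) -> ae_equal mu (S f) (S' f).

(* S is a bounded extension of T from L^oo x .. x L^oo to BMO: besides agreeing
   with T on Cb x .. x Cb, it agrees with the extensions to the products of
   the L^{r_i} and of the L^{l_i}, which are denoted T as well. *)
Definition BMO_extension eta T (rs : 'I_m -> R) (r : R) (ls : 'I_m -> R) (q : R)
    S :=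
  [/\ forall f, (forall i, Lp mu +oo%E (f i)) -> BMO mu (S f),
      multilinear_on (fun=> Lp mu +oo%E) (BMO_equal mu) S,
      exists C : R, forall f, (forall i, Lp mu +oo%E (f i)) ->
        (BMOnorm mu (S f) <=
          (C * \prod_(i < m) fine (Lpnorm mu +oo%E (f i)))%:E)%E,
      forall f, (forall i, Cb eta (f i)) ->
        represented_on mu eta setT (T f) (S f) &
      agrees_with_weak_extension eta T rs r S /\
      agrees_with_weak_extension eta T ls q S].
End GSSIO.

(* Main.v *)
(* Let S_q and S_r be the extensions of T in (iii) and (ii); they agree on bounded
   functions of bounded support. Let g_1, .., g_m be such functions, |g_i| <= M_i,
   P the product of the M_i, B a ball of radius a, and Q the concentric ball of
   radius 5 a^alpha if a <= 1, 5 a otherwise. By the kernel condition,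
   S_q(g) - S_q(g 1_Q) is constant on B up to O(P). If a <= 1, then mu(Q)^(1/l) is
   O(mu(B)^(1/q)), because l / q <= alpha kappa / n and all unit balls have
   comparable measures; as q > 1, the weak bound of S_q then bounds the mean of
   |S_q(g 1_Q)| over B, hence the mean oscillation of S_q(g). If a is large, the weak
   bound of S_r (where r < 1 is possible) only shows that |S_q(g) - c| = O(P) on most
   of B for some c; a stopping argument in the style of John and Stromberg, stopped
   at the radius 1, where the first case takes over, turns this into a bound of the
   mean oscillation. Finally, for bounded f_i the kernel condition makes
   S_q(f 1_{B(x0, N)}) converge as N tends to infinity, modulo constants and
   uniformly on balls off null sets; the limit is the required extension. *)

(* Two obstacles shape the proof. First, the kernel formula is given only for Hölder functions and
   off the intersection of their supports, whereas g 1_Q need not even be continuous. It is carried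
   over to bounded functions of bounded support by Lipschitz approximation: the weak bounds make the
   extensions of T continuous in measure, dominated convergence handles the kernel integrals, and a
   limit in measure must coincide with an almost everywhere limit. Second, at large radii the weak
   bound of S_q is of little use, since mu(Q)^(1/l) and mu(B)^(1/q) may scale differently. The bound
   of S_r scales correctly as long as Q is comparable to B, but controls a distribution function and
   no mean. The stopping argument trades a bound M of the mean oscillations for C + M / 2, so some
   finite M must be known beforehand. For radii between 1 and a given bound, S_q supplies such an M;
   it depends on that bound, but disappears when the argument is iterated. *)
Require Import Defs.
From HB Require Import structures.
From mathcomp Require Import all_boot all_order all_algebra complex.
From mathcomp Require Import all_classical all_reals all_analysis.
From mathcomp Require Import measurable_realfun ess_sup_inf ring lra.
Set Implicit Arguments.
Unset Strict Implicit.
Unset Printing Implicit Defensive.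
Import Order.TTheory GRing.Theory Num.Theory.
Import numFieldNormedType.Exports.
Local Open Scope classical_set_scope.
Local Open Scope ring_scope.

(** * Complex-valued functions *)

Section cabs_theory.
Context {R : realType}.
Implicit Types z w : R[i].

Lemma cabs_normE z : `|z| = (cabs z)%:C%C.
Proof. by rewrite /cabs normc_def. Qed.

Lemma cabsE z :
  cabs z = Num.sqrt (complex.Re z ^+ 2 + complex.Im z ^+ 2).
Proof. by rewrite /cabs normc_def. Qed.

Lemma cabs_ge0 z : 0 <= cabs z.
Proof. by rewrite cabsE sqrtr_ge0. Qed.

Lemma cabs0 : cabs (0 : R[i]) = 0.
Proof. by rewrite /cabs normr0. Qed.

Lemma cabs0_eq0 z : cabs z = 0 -> z = 0.
Proof. by move=> z0; apply/eqP; rewrite -normr_eq0 cabs_normE z0. Qed.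

Lemma cabsN z : cabs (- z) = cabs z.
Proof. by rewrite /cabs normrN. Qed.

Lemma cabsM z w : cabs (z * w) = cabs z * cabs w.
Proof.
by apply: complexI; rewrite rmorphM /= -!cabs_normE normrM.
Qed.

Lemma ler_cabsD z w : cabs (z + w) <= cabs z + cabs w.
Proof. by rewrite -lecR rmorphD /= -!cabs_normE ler_normD. Qed.

Lemma cabsB z w : cabs (z - w) = cabs (w - z).
Proof. by rewrite -cabsN opprB. Qed.

Lemma ler_cabsB z w : cabs (z - w) <= cabs z + cabs w.
Proof. by rewrite -[cabs w]cabsN ler_cabsD. Qed.

Lemma ler_cabs_dist v z w : cabs (z - w) <= cabs (z - v) + cabs (v - w).
Proof. by apply: le_trans (ler_cabsD _ _); rewrite addrA subrK. Qed.

Lemma cabs_real (x : R) : cabs x%:C%C = `|x|.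
Proof. by rewrite cabsE /= expr0n addr0 sqrtr_sqr. Qed.

Lemma cabs_prod (I : Type) (s : seq I) (P : pred I) (F : I -> R[i]) :
  cabs (\prod_(i <- s | P i) F i) = \prod_(i <- s | P i) cabs (F i).
Proof.
apply: (big_morph _ cabsM).
by rewrite -[1]/(1%:C%C) cabs_real normr1.
Qed.

Lemma ler_Re_cabs z : `|complex.Re z| <= cabs z.
Proof. by rewrite cabsE -sqrtr_sqr ler_wsqrtr// lerDl sqr_ge0. Qed.

Lemma ler_Im_cabs z : `|complex.Im z| <= cabs z.
Proof. by rewrite cabsE -sqrtr_sqr ler_wsqrtr// lerDr sqr_ge0. Qed.

Lemma cabs_ler_ReIm z : cabs z <= `|complex.Re z| + `|complex.Im z|.
Proof.
case: z => a b; rewrite cabsE /= -[leRHS]ger0_norm ?addr_ge0// -sqrtr_sqr.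
apply: ler_wsqrtr; rewrite sqrrD !real_normK ?num_real//.
by rewrite addrAC lerDl mulrn_wge0// mulr_ge0.
Qed.

Lemma cReD z w : complex.Re (z + w) = complex.Re z + complex.Re w.
Proof. by case: z; case: w. Qed.

Lemma cImD z w : complex.Im (z + w) = complex.Im z + complex.Im w.
Proof. by case: z; case: w. Qed.

Lemma cReN z : complex.Re (- z) = - complex.Re z.
Proof. by case: z. Qed.

Lemma cImN z : complex.Im (- z) = - complex.Im z.
Proof. by case: z. Qed.

Lemma cReM z w : complex.Re (z * w) =
  complex.Re z * complex.Re w - complex.Im z * complex.Im w.
Proof. by case: z; case: w. Qed.

Lemma cImM z w : complex.Im (z * w) =
  complex.Re z * complex.Im w + complex.Im z * complex.Re w.
Proof. by case: z; case: w. Qed.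

Lemma complex_eq z w :
  complex.Re z = complex.Re w -> complex.Im z = complex.Im w -> z = w.
Proof. by case: z w => [a b] [c d] /= -> ->. Qed.

End cabs_theory.

Section cmeasurable_theory.
Context {R : realType} {d : measure_display} {T : measurableType d}.
Implicit Types (D : set T) (f g : T -> R[i]).

Lemma cmeasurableD D f g : cmeasurable D f -> cmeasurable D g ->
  cmeasurable D (fun x => f x + g x).
Proof.
move=> [f1 f2] [g1 g2]; split.
- rewrite (_ : _ \o _ = (@complex.Re R \o f) \+ (@complex.Re R \o g)).
    exact: measurable_funD.
  by apply/funext => x /=; rewrite cReD.
- rewrite (_ : _ \o _ = (@complex.Im R \o f) \+ (@complex.Im R \o g)).
    exact: measurable_funD.
  by apply/funext => x /=; rewrite cImD.
Qed.

Lemma cmeasurableM D f g : cmeasurable D f -> cmeasurable D g ->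
  cmeasurable D (fun x => f x * g x).
Proof.
move=> [f1 f2] [g1 g2]; split.
- rewrite (_ : _ \o _ = ((@complex.Re R \o f) \* (@complex.Re R \o g)) \-
    ((@complex.Im R \o f) \* (@complex.Im R \o g))).
    by apply: measurable_funB; exact: measurable_funM.
  by apply/funext => x /=; rewrite cReM.
- rewrite (_ : _ \o _ = ((@complex.Re R \o f) \* (@complex.Im R \o g)) \+
    ((@complex.Im R \o f) \* (@complex.Re R \o g))).
    by apply: measurable_funD; exact: measurable_funM.
  by apply/funext => x /=; rewrite cImM.
Qed.

Lemma cmeasurable_cst D (c : R[i]) : cmeasurable D (cst c).
Proof. by split; exact: measurable_cst. Qed.

Lemma cmeasurable_real D (u : T -> R) :
  measurable_fun D u -> cmeasurable D (fun x => (u x)%:C%C).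
Proof. by move=> mu; split => //; exact: measurable_cst. Qed.

Lemma cmeasurableB D f g : cmeasurable D f -> cmeasurable D g ->
  cmeasurable D (fun x => f x - g x).
Proof.
move=> mf mg; have := cmeasurableD mf (cmeasurableM (cmeasurable_cst D (-1)) mg).
by congr cmeasurable; apply/funext => x; rewrite /cst mulN1r.
Qed.

Lemma cmeasurableBc D f (c : R[i]) : cmeasurable D f -> cmeasurable D (fun x => f x - c).
Proof. by move=> mf; apply: cmeasurableB => //; exact: cmeasurable_cst. Qed.

Lemma cmeasurable_prod D (I : Type) (s : seq I) (F : I -> T -> R[i]) :
  (forall i, cmeasurable D (F i)) ->
  cmeasurable D (fun x => \prod_(i <- s) F i x).
Proof.
move=> mF; elim: s => [|i s IH].
  under [X in cmeasurable _ X]eq_fun do rewrite big_nil.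
  exact: cmeasurable_cst.
under [X in cmeasurable _ X]eq_fun do rewrite big_cons.
exact: cmeasurableM.
Qed.

Lemma measurable_cabs D f : cmeasurable D f -> measurable_fun D (fun x => cabs (f x)).
Proof.
move=> [f1 f2].
rewrite (_ : (fun _ => _) = Num.sqrt \o (fun x => complex.Re (f x) ^+ 2 + complex.Im (f x) ^+ 2)); last first.
  by apply/funext => x; rewrite cabsE.
apply: measurableT_comp.
  by apply: continuous_measurable_fun; exact: sqrt_continuous.
by apply: measurable_funD; apply: measurable_funX.
Qed.

Lemma cmeasurableS D D' f : measurable D' -> D `<=` D' -> cmeasurable D' f -> cmeasurable D f.
Proof. by move=> mD DD' [f1 f2]; split; apply: measurable_funS f1 || apply: measurable_funS f2. Qed.

Lemma cmeasurable_indic D (A : set T) : measurable A ->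
  cmeasurable D (fun x => ((\1_A x : R))%:C%C).
Proof. by move=> mA; apply: cmeasurable_real; exact: measurable_indic. Qed.

Lemma measurable_cabs_gt f (t : R) : cmeasurable setT f ->
  measurable [set x | t < cabs (f x)].
Proof.
move=> mf; rewrite -[X in measurable X]setTI.
have := measurable_cabs mf measurableT (measurable_itv `]t, +oo[).
by congr measurable; congr (_ `&` _); apply/seteqP; split => x /=; rewrite in_itv/= andbT.
Qed.

Variable mu : {measure set T -> \bar R}.

Lemma integrable_cabs D f : measurable D -> cintegrable mu D f ->
  mu.-integrable D (fun x => (cabs (f x))%:E).
Proof.
move=> mD [f1 f2].
have h := integrableD mD (integrable_abse f1) (integrable_abse f2).
have mf : cmeasurable D f.
  by split; apply/measurable_EFinP; [case/integrableP: f1|case/integrableP: f2].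
apply: le_integrable h => //.
  exact/measurable_EFinP/measurable_cabs.
move=> x Dx /=; rewrite lee_fin ger0_norm ?cabs_ge0//.
by rewrite (le_trans (cabs_ler_ReIm _))// ler_norm.
Qed.

Lemma cintegrable_cmeasurable D f : cintegrable mu D f -> cmeasurable D f.
Proof.
move=> [f1 f2].
by split; apply/measurable_EFinP; [case/integrableP: f1|case/integrableP: f2].
Qed.

Lemma le_cintegrable D f (u : T -> R) : measurable D -> cmeasurable D f ->
  mu.-integrable D (EFin \o u) -> (forall x, D x -> cabs (f x) <= u x) ->
  cintegrable mu D f.
Proof.
move=> mD [f1 f2] iu fu; split; apply: le_integrable iu => //.
- exact/measurable_EFinP.
- move=> x Dx /=; rewrite lee_fin.
  rewrite (le_trans (ler_Re_cabs _))// (le_trans (fu _ Dx))//.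
  by rewrite ler_norm.
- exact/measurable_EFinP.
- move=> x Dx /=; rewrite lee_fin.
  rewrite (le_trans (ler_Im_cabs _))// (le_trans (fu _ Dx))//.
  by rewrite ler_norm.
Qed.

Lemma cintegrableP D f : measurable D -> cmeasurable D f ->
  (\int[mu]_(x in D) (cabs (f x))%:E < +oo)%E -> cintegrable mu D f.
Proof.
move=> mD mf foo; apply: (@le_cintegrable _ _ (fun x => cabs (f x))) => //.
apply/integrableP; split; first exact/measurable_EFinP/measurable_cabs.
by under eq_integral do rewrite /= ger0_norm ?cabs_ge0//.
Qed.

Lemma cintegrableD D f g : measurable D -> cintegrable mu D f -> cintegrable mu D g ->
  cintegrable mu D (fun x => f x + g x).
Proof.
move=> mD [f1 f2] [g1 g2]; split.
- apply: eq_integrable (integrableD mD f1 g1) => // x _ /=.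
  by rewrite cReD.
- apply: eq_integrable (integrableD mD f2 g2) => // x _ /=.
  by rewrite cImD.
Qed.

Lemma cintegralD D f g : measurable D -> cintegrable mu D f -> cintegrable mu D g ->
  cintegral mu D (fun x => f x + g x) = cintegral mu D f + cintegral mu D g.
Proof.
move=> mD [f1 f2] [g1 g2]; apply: complex_eq; rewrite /= -RintegralD//.
  by apply: eq_Rintegral => x _ /=; rewrite cReD.
by apply: eq_Rintegral => x _ /=; rewrite cImD.
Qed.

Lemma cintegrableZ D f (c : R[i]) : measurable D -> cintegrable mu D f ->
  cintegrable mu D (fun x => c * f x).
Proof.
move=> mD fi; apply: (@le_cintegrable _ _ (fun x => cabs c * cabs (f x))) => //.
- by apply: cmeasurableM; [exact: cmeasurable_cst|exact: (cintegrable_cmeasurable fi)].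
- exact: (integrableZl mD (cabs c) (integrable_cabs mD fi)).
- by move=> x _; rewrite cabsM.
Qed.

Lemma cintegralZ D f (c : R[i]) : measurable D -> cintegrable mu D f ->
  cintegral mu D (fun x => c * f x) = c * cintegral mu D f.
Proof.
move=> mD [f1 f2].
have ia a : mu.-integrable D (EFin \o (fun x => a * complex.Re (f x))).
  exact: (integrableZl mD a f1).
have ib a : mu.-integrable D (EFin \o (fun x => a * complex.Im (f x))).
  exact: (integrableZl mD a f2).
apply: complex_eq; rewrite ?cReM ?cImM /=.
- under eq_Rintegral do rewrite cReM.
  by rewrite RintegralB// !RintegralZl.
- under eq_Rintegral do rewrite cImM.
  by rewrite RintegralD// !RintegralZl.
Qed.

Lemma cintegrableB D f g : measurable D -> cintegrable mu D f -> cintegrable mu D g ->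
  cintegrable mu D (fun x => f x - g x).
Proof.
move=> mD fi gi; have := cintegrableD mD fi (cintegrableZ (-1) mD gi).
by congr cintegrable; apply/funext => x; rewrite mulN1r.
Qed.

Lemma cintegralB D f g : measurable D -> cintegrable mu D f -> cintegrable mu D g ->
  cintegral mu D (fun x => f x - g x) = cintegral mu D f - cintegral mu D g.
Proof.
move=> mD fi gi; rewrite -[in RHS]mulN1r -cintegralZ// -cintegralD//.
  by congr cintegral; apply/funext => x; rewrite mulN1r.
exact: cintegrableZ.
Qed.

(* The constant 2 spares the rotation argument. *)
Lemma cabs_cintegral_le D f (c : R) : measurable D -> cmeasurable D f ->
  (\int[mu]_(x in D) (cabs (f x))%:E <= c%:E)%E ->
  cabs (cintegral mu D f) <= 2 * c.
Proof.
move=> mD mf fc; have [f1 f2] : cintegrable mu D f.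
  by apply: cintegrableP => //; rewrite (le_lt_trans fc)// ltry.
rewrite (le_trans (cabs_ler_ReIm _))//= mulr_natl mulr2n lerD//.
- rewrite -lee_fin EFin_normr_Rintegral//.
  have m1 : measurable_fun D (fun x => (complex.Re (f x))%:E).
    by case/integrableP: f1.
  apply: le_trans (le_abse_integral mu mD m1) (le_trans _ fc).
  apply: ge0_le_integral => //=.
  + by apply/measurable_EFinP/measurableT_comp => //; exact: mf.1.
  + exact/measurable_EFinP/measurable_cabs.
  + by move=> x _; rewrite lee_fin ler_Re_cabs.
- rewrite -lee_fin EFin_normr_Rintegral//.
  have m2 : measurable_fun D (fun x => (complex.Im (f x))%:E).
    by case/integrableP: f2.
  apply: le_trans (le_abse_integral mu mD m2) (le_trans _ fc).
  apply: ge0_le_integral => //=.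
  + by apply/measurable_EFinP/measurableT_comp => //; exact: mf.2.
  + exact/measurable_EFinP/measurable_cabs.
  + by move=> x _; rewrite lee_fin ler_Im_cabs.
Qed.

End cmeasurable_theory.

Section complex_limits.
Context {R : realType}.
Implicit Types (u v : nat -> R[i]) (a b c : R[i]).

(** Convergence in the complex plane, expressed by a real sequence so that limits are taken in
    [R]. *)
Definition ccvg u a := cabs (u k - a) @[k --> \oo] --> (0 : R).

Lemma ccvg_cst a : ccvg (fun=> a) a.
Proof. by rewrite /ccvg subrr cabs0; exact: cvg_cst. Qed.

Lemma ccvg_le u a (w : nat -> R) : w k @[k --> \oo] --> (0 : R) ->
  (forall k, cabs (u k - a) <= w k) -> ccvg u a.
Proof.
move=> w0 uw; apply: (@squeeze_cvgr _ _ _ _ (cst 0) w) => //; last exact: cvg_cst.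
by apply: nearW => k; rewrite cabs_ge0 uw.
Qed.

Lemma ccvg_unique u a b : ccvg u a -> ccvg u b -> a = b.
Proof.
move=> ua ub; apply/subr0_eq/cabs0_eq0/eqP; rewrite eq_le cabs_ge0 andbT.
have : (cabs (u k - a) + cabs (u k - b)) @[k --> \oo] --> (0 + 0 : R).
  exact: cvgD.
rewrite addr0 => h; apply: (@cvgr_to_ge _ _ _ _ _ _ _ h).
by apply: nearW => k; rewrite (le_trans (ler_cabs_dist (u k) _ _))// cabsB.
Qed.

Lemma ccvgD u v a b : ccvg u a -> ccvg v b -> ccvg (fun k => u k + v k) (a + b).
Proof.
move=> ua vb; apply: (@ccvg_le _ _ (fun k => cabs (u k - a) + cabs (v k - b))) => [|k].
  by rewrite -[0]addr0; exact: cvgD.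
by rewrite (_ : _ - _ = (u k - a) + (v k - b)) ?ler_cabsD//; ring.
Qed.

Lemma ccvgZ u a c : ccvg u a -> ccvg (fun k => c * u k) (c * a).
Proof.
move=> ua; apply: (@ccvg_le _ _ (fun k => cabs c * cabs (u k - a))) => [|k].
  by rewrite -(mulr0 (cabs c)); exact: cvgMr.
by rewrite -mulrBr cabsM.
Qed.

Lemma ccvgN u a : ccvg u a -> ccvg (fun k => - u k) (- a).
Proof.
move=> /(ccvgZ (-1)); rewrite mulN1r; congr ccvg.
by apply/funext => k; rewrite mulN1r.
Qed.

Lemma ccvgM u v a b : ccvg u a -> ccvg v b -> ccvg (fun k => u k * v k) (a * b).
Proof.
move=> ua vb.
apply: (@ccvg_le _ _ (fun k => cabs (u k - a) * cabs (v k - b) +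
    cabs a * cabs (v k - b) + cabs b * cabs (u k - a))) => [|k].
  rewrite (_ : 0 = 0 * 0 + cabs a * 0 + cabs b * 0); last by rewrite !mulr0 !addr0.
  by apply: cvgD; [apply: cvgD; [exact: cvgM|exact: cvgMr]|exact: cvgMr].
rewrite -!cabsM (_ : _ - _ = (u k - a) * (v k - b) + a * (v k - b) + b * (u k - a)); last by ring.
by rewrite (le_trans (ler_cabsD _ _))// lerD2r ler_cabsD.
Qed.

Lemma ccvg_prod (I : Type) (s : seq I) (u : I -> nat -> R[i]) (a : I -> R[i]) :
  (forall i, ccvg (u i) (a i)) ->
  ccvg (fun k => \prod_(i <- s) u i k) (\prod_(i <- s) a i).
Proof.
move=> ua; elim: s => [|i s IH].
  by rewrite big_nil; under [X in ccvg X _]eq_fun do rewrite big_nil; exact: ccvg_cst.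
rewrite big_cons; under [X in ccvg X _]eq_fun do rewrite big_cons.
exact: ccvgM.
Qed.

(** The condition [k <= s k] already forces [s] to tend to infinity; index maps obtained by [choice]
    satisfy it without being known to increase. *)
Lemma ccvg_sub u a (s : nat -> nat) : (forall k, (k <= s k)%N) ->
  ccvg u a -> ccvg (u \o s) a.
Proof.
move=> sk ua; apply: (@cvg_comp _ _ _ s (fun n => cabs (u n - a)) _ \oo) ua.
move=> P [n _ Pn]; exists n => // k nk; apply: Pn => /=.
exact: leq_trans nk (sk k).
Qed.

Lemma ccvg_eventually_cst u a : (\forall k \near \oo, u k = a) -> ccvg u a.
Proof.
move=> h; apply/cvgrPdist_lt => e e0; apply: filterS h => k ->.
by rewrite subrr cabs0 subrr normr0.
Qed.

Lemma ccvg_Re u a : ccvg u a -> complex.Re (u k) @[k --> \oo] --> complex.Re a.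
Proof.
move=> /cvgrPdist_lt ua; apply/cvgrPdist_lt => e e0; near=> k.
rewrite distrC -cReN -cReD (le_lt_trans (ler_Re_cabs _))//.
have : `|0 - cabs (u k - a)| < e by near: k; exact: ua.
by rewrite sub0r normrN ger0_norm ?cabs_ge0.
Unshelve. all: by end_near. Qed.

Lemma ccvg_Im u a : ccvg u a -> complex.Im (u k) @[k --> \oo] --> complex.Im a.
Proof.
move=> /cvgrPdist_lt ua; apply/cvgrPdist_lt => e e0; near=> k.
rewrite distrC -cImN -cImD (le_lt_trans (ler_Im_cabs _))//.
have : `|0 - cabs (u k - a)| < e by near: k; exact: ua.
by rewrite sub0r normrN ger0_norm ?cabs_ge0.
Unshelve. all: by end_near. Qed.

Lemma ccvg_ReIm u a : complex.Re (u k) @[k --> \oo] --> complex.Re a ->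
  complex.Im (u k) @[k --> \oo] --> complex.Im a -> ccvg u a.
Proof.
move=> u1 u2; apply: (@ccvg_le _ _ (fun k => `|complex.Re (u k) - complex.Re a| +
    `|complex.Im (u k) - complex.Im a|)) => [|k].
  have n1 : `|complex.Re (u k) - complex.Re a| @[k --> \oo] --> (0 : R).
    by rewrite -(normr0 R) -(subrr (complex.Re a)); apply: cvg_norm; apply: cvgB => //; exact: cvg_cst.
  have n2 : `|complex.Im (u k) - complex.Im a| @[k --> \oo] --> (0 : R).
    by rewrite -(normr0 R) -(subrr (complex.Im a)); apply: cvg_norm; apply: cvgB => //; exact: cvg_cst.
  by rewrite -[0]addr0; exact: cvgD.
by rewrite (le_trans (cabs_ler_ReIm _))// cReD cImD cReN cImN.
Qed.

Lemma ccvg_le_bound u a (c : R) : ccvg u a ->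
  (forall k, cabs (u k) <= c) -> cabs a <= c.
Proof.
move=> ua uc.
have h : (cabs (u k - a) + c) @[k --> \oo] --> c.
  by rewrite -[X in _ --> X]add0r; apply: cvgD => //; exact: cvg_cst.
apply: (@cvgr_to_ge _ _ _ _ _ _ _ h); apply: nearW => k.
have := ler_cabsD (a - u k) (u k); rewrite subrK cabsB => /le_trans; apply.
by rewrite lerD2l.
Qed.

End complex_limits.

Lemma small_invn {R : archiRealFieldType} (e : R) : 0 < e -> exists k : nat, k.+1%:R^-1 <= e.
Proof.
move=> e0; exists (Num.truncn e^-1); rewrite -[leRHS]invrK lef_pV2 ?posrE ?invr_gt0//.
by rewrite ltW// truncnS_gt.
Qed.

(** * Almost everywhere limits and convergence in measure *)

Section in_measure.
Context {R : realType} {d : measure_display} {T : measurableType d}.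
Variable mu : {measure set T -> \bar R}.
Implicit Types (D : set T) (f g : T -> R[i]) (F : nat -> T -> R[i]).

Lemma ae_measure_eq0 (A : set T) (P : T -> Prop) : measurable A ->
  {ae mu, forall x, P x} -> (forall x, A x -> ~ P x) -> mu A = 0%E.
Proof.
move=> mA aeP AP; apply/negligibleP => //.
by apply: negligibleS aeP => x Ax /= Px; exact: (AP x).
Qed.

Lemma ae_le_measure (A B : set T) : measurable A -> measurable B ->
  {ae mu, forall x, A x -> B x} -> (mu A <= mu B)%E.
Proof.
move=> mA mB AB; have mD : measurable (A `\` B) by exact: measurableD.
have D0 : mu (A `\` B) = 0%E.
  by apply: ae_measure_eq0 mD AB _ => x [Ax nBx] /(_ Ax).
have -> : mu A = mu ((A `&` B) `|` (A `\` B)) by rewrite setUIDK.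
apply: le_trans (measureU2 _ _ _) _ => //; first exact: measurableI.
rewrite [X in (_ + X)%E]D0 adde0 le_measure ?inE//; first exact: measurableI.
Qed.

Lemma measure_eq0_ae (A : set T) : measurable A -> mu A = 0%E ->
  {ae mu, forall x, ~ A x}.
Proof. by move=> mA A0; exists A; split => // x /= /contrapT. Qed.

Lemma ae_eq_measure (A B : set T) : measurable A -> measurable B ->
  {ae mu, forall x, A x <-> B x} -> mu A = mu B.
Proof.
move=> mA mB AB; apply/eqP; rewrite eq_le !ae_le_measure//.
- by apply: filterS AB => x [].
- by apply: filterS AB => x [].
Qed.

Lemma ae_eq_level f g (D : set T) (t : R) : cmeasurable setT f -> cmeasurable setT g ->
  measurable D -> ae_equal mu f g ->
  mu (D `&` [set x | t < cabs (f x)]) = mu (D `&` [set x | t < cabs (g x)]).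
Proof.
move=> mf mg mD fg; apply: ae_eq_measure.
- by apply: measurableI => //; exact: measurable_cabs_gt.
- by apply: measurableI => //; exact: measurable_cabs_gt.
- by apply: filterS fg => x /= ->.
Qed.

Lemma level0_ae f : cmeasurable setT f ->
  (forall t : R, 0 < t -> mu [set x | t < cabs (f x)] = 0%E) ->
  {ae mu, forall x, f x = 0}.
Proof.
move=> mf f0.
have : {ae mu, forall x, forall n : nat, ~ (n.+1%:R^-1 < cabs (f x))}.
  apply: ae_foralln => n; apply: measure_eq0_ae; last exact: f0.
  exact: measurable_cabs_gt.
apply: filterS => x fx; apply: cabs0_eq0; apply/eqP; rewrite eq_le cabs_ge0 andbT.
apply/ler_addgt0Pl => e e0; rewrite addr0.
have [n ne] := small_invn e0.
by have /negP := fx n; rewrite -leNgt => /le_trans; exact.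
Qed.

Lemma ae_level_eq0 f : cmeasurable setT f ->
  (forall t : R, 0 < t -> mu [set x | t < cabs (f x)] = 0%E) ->
  mu [set x | 0 < cabs (f x)] = 0%E.
Proof.
move=> mf /(level0_ae mf) f0; apply: ae_measure_eq0 f0 _.
  exact: measurable_cabs_gt.
by move=> x /= + fx; rewrite fx cabs0 ltxx.
Qed.

(** Borel-Cantelli: the measures of the exceptional sets have a finite sum, so almost every point
    lies in finitely many of them, and from then on the error at that point is at most [2 ^- k]. *)
Lemma borel_cantelli_ae f F : cmeasurable setT f ->
  (forall k, cmeasurable setT (F k)) ->
  (forall k, mu [set x | 2 ^- k < cabs (F k x - f x)]%R <= (2 ^- k)%:E)%E ->
  {ae mu, forall x, ccvg (F ^~ x) (f x)}.
Proof.
move=> mf mF Ff.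
pose E k := [set x | 2 ^- k < cabs (F k x - f x)].
have mE k : measurable (E k) by apply: measurable_cabs_gt; exact: cmeasurableB.
have geo n : (\sum_(0 <= k < n) (2 ^- k : R) <= 2)%R.
  suff -> : \sum_(0 <= k < n) (2 ^- k : R) = 2 - 2 * 2 ^- n.
    by rewrite lerBlDr lerDl mulr_ge0// invr_ge0 exprn_ge0.
  elim: n => [|n IH]; first by rewrite big_nil expr0 invr1 mulr1 subrr.
  by rewrite big_nat_recr//= IH exprS invfM; field; rewrite expf_neq0.
have sE : (\sum_(0 <= k <oo) mu (E k) < +oo)%E.
  apply: (@le_lt_trans _ _ 2%:E); last exact: ltry.
  apply: lime_le; first exact: is_cvg_nneseries.
  apply: nearW => n; apply: (@le_trans _ _ (\sum_(0 <= k < n) (2 ^- k)%:E)%E).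
    by apply: lee_sum => k _; exact: Ff.
  by rewrite sumEFin lee_fin geo.
have L0 := lim_sup_set_cvg0 mE sE.
have mL : measurable (lim_sup_set E) by apply: bigcap_measurable => // n _; exact: bigcup_measurable.
apply: filterS (measure_eq0_ae mL L0) => x.
move=> nL; have [n hn] : exists n, forall k, (n <= k)%N -> ~ E k x.
  apply: contrapT => H; apply: nL => n _ /=.
  apply: contrapT => H'; apply: H; exists n => k nk Ekx; apply: H'.
  by exists k.
apply: (@squeeze_cvgr _ _ _ _ (cst 0) (fun k => 2 ^- k)).
- near=> k; rewrite cabs_ge0 /= leNgt; apply/negP; apply: hn.
  by near: k; exists n.
- exact: cvg_cst.
- under eq_fun do rewrite -exprVn.
  by apply: cvg_expr; rewrite ger0_norm// invf_lt1// ltr1n.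
Unshelve. all: by end_near. Qed.

Lemma cvge0_near (u : nat -> \bar R) (e : R) : 0 < e ->
  u k @[k --> \oo] --> 0%E -> \forall k \near \oo, (u k <= e%:E)%E.
Proof.
move=> e0 /fine_cvgP[fu /cvgrPdist_le/(_ _ e0) ue].
near=> k; have uk : u k \is a fin_num by near: k.
rewrite -(fineK uk) lee_fin (le_trans (ler_norm _))// -normrN -[X in `|X|]add0r.
by near: k.
Unshelve. all: by end_near. Qed.

Definition cvg_in_measure F f :=
  forall t : R, 0 < t -> mu [set x | t < cabs (F k x - f x)] @[k --> \oo] --> 0%E.

(** The subsequence of F. Riesz: at step [k] an index is taken for which the exceptional set at
    height [2 ^- k] has measure at most [2 ^- k]. *)
Lemma in_measure_subseq f F : cmeasurable setT f ->
  (forall k, cmeasurable setT (F k)) -> cvg_in_measure F f ->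
  exists2 s : nat -> nat, (forall k, (k <= s k)%N) &
  {ae mu, forall x, ccvg (fun k => F (s k) x) (f x)}.
Proof.
move=> mf mF Ff.
have H k : exists n, (k <= n)%N /\
    (mu [set x | 2 ^- k < cabs (F n x - f x)]%R <= (2 ^- k)%:E)%E.
  have k0 : (0 : R) < 2 ^- k by rewrite invr_gt0 exprn_gt0.
  have [n _ Hn] := cvge0_near k0 (Ff _ k0).
  exists (maxn k n); split; first exact: leq_maxl.
  by apply: Hn; exact: leq_maxr.
have [s Hs] := choice H; exists s => [k|]; first by have [] := Hs k.
by apply: borel_cantelli_ae => // k; have [] := Hs k.
Qed.

(** Weak bounds yield limits in measure, kernel integrals yield pointwise limits on a ball [D]; this
    identifies the two. *)
Lemma in_measure_ae_unique f g F D : cmeasurable setT f ->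
  (forall k, cmeasurable setT (F k)) -> cvg_in_measure F f ->
  {ae mu, forall x, D x -> ccvg (F ^~ x) (g x)} ->
  {ae mu, forall x, D x -> f x = g x}.
Proof.
move=> mf mF Ff Fg; have [s sk Fs] := in_measure_subseq mf mF Ff.
apply: filterS2 Fg Fs => x Hg Hf Dx; apply: ccvg_unique Hf _.
exact: ccvg_sub sk (Hg Dx).
Qed.

Lemma in_measure_unique f g F : cmeasurable setT f -> cmeasurable setT g ->
  (forall k, cmeasurable setT (F k)) -> cvg_in_measure F f ->
  cvg_in_measure F g -> ae_equal mu f g.
Proof.
move=> mf mg mF Ff Fg; have [s sk Fs] := in_measure_subseq mf mF Ff.
have : {ae mu, forall x, setT x -> g x = f x}.
  apply: (@in_measure_ae_unique _ _ (F \o s)) => //=.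
  - move=> t t0; apply: (@cvg_comp _ _ _ s
      (fun n => mu [set x | t < cabs (F n x - g x)]) _ \oo) (Fg t t0).
    move=> P [n _ Pn]; exists n => // k nk; apply: Pn => /=.
    exact: leq_trans nk (sk k).
  - by apply: filterS Fs => x.
by apply: filterS => x /(_ I).
Qed.

Lemma cvg_in_measure_ae_eq F G f : (forall k, cmeasurable setT (F k)) ->
  (forall k, cmeasurable setT (G k)) -> cmeasurable setT f ->
  (forall k, ae_equal mu (F k) (G k)) ->
  cvg_in_measure F f -> cvg_in_measure G f.
Proof.
move=> mF mG mf FG Ff t t0.
rewrite (_ : (fun k => _) = fun k => mu [set x | t < cabs (F k x - f x)]); first exact: Ff.
apply/funext => k; have := @ae_eq_level (fun x => G k x - f x) (fun x => F k x - f x) setT t.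
rewrite !setTI; apply => //; try exact: cmeasurableB.
by apply: filterS (FG k) => x ->.
Qed.

End in_measure.

(** * Lipschitz approximation *)

Section borel_metric.
Context {R : realType} {d : measure_display} {X : borelMetricType R d}.
Implicit Types (x y z : X) (r s : R) (phi : X -> R).

Lemma in_ballE x r y : ball x r y = (mdist x y < r) :> Prop.
Proof. by rewrite ballEmdist. Qed.

Lemma ball_openX x r : open (ball x r).
Proof.
rewrite openE => y; rewrite in_ballE => xy; rewrite /interior -nbhs_ballE.
exists (r - mdist x y); rewrite /= ?subr_gt0// => z; rewrite !in_ballE => yz.
by rewrite (le_lt_trans (metric_triangle x y z))// -ltrBrDl.
Qed.

Lemma open_measurableX (U : set X) : open U -> measurable U.
Proof. by move=> oU; rewrite borelE; apply: sub_sigma_algebra. Qed.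

Lemma measurable_ballX x r : measurable (ball x r).
Proof. by apply: open_measurableX; exact: ball_openX. Qed.

Lemma openX_ball (U : set X) x : open U -> U x -> exists2 r, 0 < r & ball x r `<=` U.
Proof.
rewrite openE => oU Ux; have := oU _ Ux; rewrite /interior -nbhs_ballE.
by move=> [r /= r0 xr]; exists r.
Qed.

Lemma continuous_measurableX phi : continuous phi -> measurable_fun setT phi.
Proof.
move=> cphi; apply: (measurability _ (@RGenOInfty.measurableE R)).
move=> _ [_ [a ->] <-]; rewrite setTI; apply: open_measurableX.
by move/continuousP : cphi; apply; exact: interval_open.
Qed.

Lemma holder_measurable phi (C eta : R) : 0 < eta ->
  (forall x y, `|phi x - phi y| <= C * mdist x y `^ eta) -> measurable_fun setT phi.
Proof.
move=> eta0 H; apply: continuous_measurableX => x.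
apply/cvgrPdist_lt => e e0.
(* [C] may be nonpositive, and [e / C'] has to be positive. *)
pose C' := Num.max C 1; have C'0 : 0 < C' by rewrite lt_max ltr01 orbT.
pose del := (e / C') `^ eta^-1.
have eC : 0 < e / C' by rewrite divr_gt0.
have del0 : 0 < del by rewrite powR_gt0.
apply/nbhs_ballP; exists del => //= y; rewrite in_ballE => xy.
rewrite (le_lt_trans (H x y))//.
have [->|xy0] := eqVneq (mdist x y) 0.
  by rewrite powR0 ?mulr0// gt_eqF.
apply: (@le_lt_trans _ _ (C' * mdist x y `^ eta)).
  by rewrite ler_wpM2r ?powR_ge0// le_max lexx.
rewrite mulrC -ltr_pdivlMr//.
apply: (@lt_le_trans _ _ (del `^ eta)).
  by rewrite gt0_ltr_powR// nnegrE ?mdist_ge0// ltW.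
by rewrite -powRrM mulVf ?gt_eqF// powRr1// ltW.
Qed.

Lemma lipschitz_measurable phi (L : R) :
  (forall x y, `|phi x - phi y| <= L * mdist x y) -> measurable_fun setT phi.
Proof.
move=> H; apply: (@holder_measurable _ L 1) => // x y.
by rewrite powRr1 ?mdist_ge0.
Qed.

Lemma mdist_lip x y z : `|mdist x y - mdist x z| <= mdist y z.
Proof.
have := metric_triangle x y z; have := metric_triangle x z y.
by rewrite (metric_sym z y) ler_norml => ? ?; apply/andP; split; lra.
Qed.

(** A class independent of [eta], closed under sums and products, whose members lie in [Cb eta] for
    every [eta] in (0, 1]; it supplies the test functions. *)
Definition lipb x0 phi := exists L M r,
  [/\ forall x y, `|phi x - phi y| <= L * mdist x y,
     forall x, `|phi x| <= M &
     forall x, r <= mdist x0 x -> phi x = 0].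

Lemma lipb_measurable x0 phi : lipb x0 phi -> measurable_fun setT phi.
Proof. by move=> [L [M [r [H _ _]]]]; exact: lipschitz_measurable H. Qed.

Lemma lipb0 x0 : lipb x0 (cst 0).
Proof.
exists 0, 0, 0; split => //= [x y|x]; last by rewrite normr0.
by rewrite subrr normr0 mul0r.
Qed.

Lemma lipbD x0 phi psi : lipb x0 phi -> lipb x0 psi -> lipb x0 (phi \+ psi).
Proof.
move=> [L [M [r [H1 H2 H3]]]] [L' [M' [r' [H1' H2' H3']]]].
exists (L + L'), (M + M'), (Num.max r r'); split => /=.
- move=> x y; rewrite mulrDl (_ : _ - _ = (phi x - phi y) + (psi x - psi y)); last by ring.
  by rewrite (le_trans (ler_normD _ _))// lerD.
- by move=> x; rewrite (le_trans (ler_normD _ _))// lerD.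
- by move=> x; rewrite ge_max => /andP[/H3 -> /H3' ->]; rewrite addr0.
Qed.

Lemma lipbZ x0 phi (c : R) : lipb x0 phi -> lipb x0 (fun x => c * phi x).
Proof.
move=> [L [M [r [H1 H2 H3]]]]; exists (`|c| * L), (`|c| * M), r; split => /=.
- by move=> x y; rewrite -mulrBr normrM -mulrA ler_wpM2l.
- by move=> x; rewrite normrM ler_wpM2l.
- by move=> x /H3 ->; rewrite mulr0.
Qed.

Lemma lipbM x0 phi psi : lipb x0 phi -> lipb x0 psi -> lipb x0 (phi \* psi).
Proof.
move=> [L [M [r [H1 H2 H3]]]] [L' [M' [r' [H1' H2' H3']]]].
exists (L * M' + M * L'), (M * M'), r; split => /=.
- move=> x y.
  rewrite (_ : _ - _ = (phi x - phi y) * psi x + phi y * (psi x - psi y)); last by ring.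
  rewrite (le_trans (ler_normD _ _))// !normrM mulrDl lerD//.
    by rewrite -mulrA [M' * _]mulrC mulrA ler_pM.
  by rewrite -mulrA ler_pM.
- by move=> x; rewrite normrM ler_pM.
- by move=> x /H3 ->; rewrite mul0r.
Qed.

Definition clamp (M t : R) := Num.min M (Num.max (- M) t).

Lemma clamp_lip (M a b : R) : `|clamp M a - clamp M b| <= `|a - b|.
Proof.
rewrite /clamp /Num.min /Num.max.
have := ler_norm (a - b); have := ler_norm (b - a); rewrite (distrC b a).
by rewrite ler_norml; case: ifP; case: ifP; case: ifP; case: ifP;
  rewrite ?ltxx; lra.
Qed.

Lemma clamp_le (M a : R) : 0 <= M -> `|clamp M a| <= M.
Proof.
move=> M0; rewrite /clamp ler_norml ge_min lexx/= andbT le_min le_max lexx/= andbT.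
by rewrite (le_trans _ M0)// oppr_le0.
Qed.

Lemma clamp_id (M a : R) : `|a| <= M -> clamp M a = a.
Proof.
rewrite ler_norml => /andP[Ma aM]; rewrite /clamp max_r// min_r//.
Qed.

Lemma lipb_clamp x0 phi (M : R) : 0 <= M -> lipb x0 phi ->
  lipb x0 (fun x => clamp M (phi x)).
Proof.
move=> M0 [L [M' [r [H1 H2 H3]]]]; exists L, M, r; split => //=.
- by move=> x y; rewrite (le_trans (clamp_lip _ _ _)).
- by move=> x; exact: clamp_le.
- by move=> x /H3 ->; rewrite clamp_id// normr0.
Qed.

Definition cutoff x1 (a b : R) x := Num.max 0 (Num.min 1 ((b - mdist x1 x) / (b - a))).

Lemma lipb_cutoff x0 x1 (a b : R) : a < b -> lipb x0 (cutoff x1 a b).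
Proof.
move=> ab; have ba0 : 0 < b - a by rewrite subr_gt0.
exists (b - a)^-1, 1, (mdist x0 x1 + b); split.
- move=> x y; pose u z := (b - mdist x1 z) / (b - a).
  apply: (@le_trans _ _ (`|u x - u y|)).
    rewrite /cutoff -/(u x) -/(u y) /Num.min /Num.max.
    have := ler_norm (u x - u y); have := ler_norm (u y - u x).
    rewrite (distrC (u y)).
    by rewrite ler_norml; case: ifP; case: ifP; case: ifP; case: ifP; rewrite ?ltxx; lra.
  have i0 : 0 <= (b - a)^-1 by rewrite invr_ge0 ltW.
  rewrite /u -mulrBl normrM mulrC (ger0_norm i0) ler_wpM2l//.
  rewrite (_ : _ - _ - _ = mdist x1 y - mdist x1 x); last by ring.
  by rewrite distrC mdist_lip.
- by move=> x; rewrite /cutoff ger0_norm ?le_max ?lexx// ge_max ler01 ge_min lexx.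
- move=> x xb; rewrite /cutoff max_l// ge_min orbC.
  rewrite pmulr_lle0 ?invr_gt0// subr_le0.
  by have := metric_triangle x0 x1 x; move: xb; lra.
Qed.

Lemma cutoff_ge0 x1 (a b : R) x : 0 <= cutoff x1 a b x.
Proof. by rewrite /cutoff le_max lexx. Qed.

Lemma cutoff_le1 x1 (a b : R) x : cutoff x1 a b x <= 1.
Proof. by rewrite /cutoff ge_max ler01 ge_min lexx. Qed.

Lemma cutoff1 x1 (a b : R) x : a < b -> mdist x1 x <= a -> cutoff x1 a b x = 1.
Proof.
move=> ab xa; rewrite /cutoff min_l ?max_r//.
by rewrite ler_pdivlMr ?subr_gt0// mul1r lerD2l lerN2.
Qed.

Lemma cutoff0 x1 (a b : R) x : a < b -> b <= mdist x1 x -> cutoff x1 a b x = 0.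
Proof.
move=> ab xb; rewrite /cutoff max_l// ge_min orbC.
by rewrite pmulr_lle0 ?invr_gt0 ?subr_gt0// subr_le0 xb.
Qed.

(** The distance to the complement of [V]. When [V] is the whole space it is only the default value
    of [inf] on the empty set, which is why a point outside [V] is asked for. *)
Definition codist (V : set X) x := inf [set mdist x y | y in ~` V].

Lemma codist_lip (V : set X) : ~` V !=set0 ->
  forall x y, `|codist V x - codist V y| <= mdist x y.
Proof.
move=> V0.
have lb x : has_lbound [set mdist x y | y in ~` V].
  by exists 0 => _ [y _ <-]; exact: mdist_ge0.
have ne x : [set mdist x y | y in ~` V] !=set0.
  by case: V0 => y Vy; exists (mdist x y); exists y.
have H x y : codist V x <= codist V y + mdist x y.
  rewrite -lerBlDr; apply: lb_le_inf => // _ [z Vz <-].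
  rewrite lerBlDr (le_trans _ (_ : mdist x z <= _))//.
    by apply: ge_inf => //; exists z.
  by rewrite addrC metric_triangle.
move=> x y; have := H x y; have := H y x; rewrite (metric_sym y x) ler_norml.
by move=> ? ?; apply/andP; split; lra.
Qed.

Lemma codist0 (V : set X) x : ~ V x -> codist V x = 0.
Proof.
move=> Vx; apply/eqP; rewrite eq_le; apply/andP; split.
  rewrite -(mdistxx x); apply: ge_inf; last by exists x.
  by exists 0 => _ [y _ <-]; exact: mdist_ge0.
by apply: lb_le_inf; [exists (mdist x x); exists x|move=> _ [y _ <-]; exact: mdist_ge0].
Qed.

Lemma codist_gt0 (V : set X) x : ~` V !=set0 -> open V -> V x -> 0 < codist V x.
Proof.
move=> [y0 Vy0] oV Vx; have [r r0 xr] := openX_ball oV Vx.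
apply: (lt_le_trans r0); apply: lb_le_inf; first by exists (mdist x y0); exists y0.
move=> _ [y Vy <-]; rewrite leNgt; apply/negP => xy; apply: Vy.
by apply: xr; rewrite in_ballE.
Qed.

Lemma codist_ge0 (V : set X) x : ~` V !=set0 -> 0 <= codist V x.
Proof.
move=> [y0 Vy0]; apply: lb_le_inf; first by exists (mdist x y0); exists y0.
by move=> _ [y _ <-]; exact: mdist_ge0.
Qed.

Variable mu : {measure set X -> \bar R}.
Hypothesis mu_ball : forall x r, (mu (ball x r) < +oo)%E.
Hypothesis mu_infinite : mu setT = +oo%E.
Hypothesis mu_regular : regular_measure mu.

Lemma unbounded_space x0 r : exists y, r <= mdist x0 y.
Proof.
apply: contrapT => H; have := mu_ball x0 r.
rewrite (_ : ball x0 r = setT) ?mu_infinite//.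
apply/seteqP; split => // y _; rewrite in_ballE ltNge; apply/negP => yr.
by apply: H; exists y.
Qed.

(** Outer regularity puts [A] in an open [V] with V minus A small. The distance to the complement of
    [V], scaled by [k.+1] and cut at 1, differs from the indicator of [V] only in a layer [W k]
    along the boundary, and these layers decrease to the empty set. *)
Lemma approx_indic x0 (A : set X) (N e : R) : measurable A -> A `<=` ball x0 N ->
  0 < e -> exists2 phi, lipb x0 phi & (mu [set x | \1_A x != phi x] <= e%:E)%E.
Proof.
move=> mA AN e0; have e20 : 0 < e / 2 by rewrite divr_gt0.
have Afin : mu A \is a fin_num.
  rewrite ge0_fin_numE// (le_lt_trans _ (mu_ball x0 N))// le_measure ?inE//.
  exact: measurable_ballX.
have [A1 _] := mu_regular mA.
have Ifin : ereal_inf [set mu U | U in [set U | open U /\ A `<=` U]] \is a fin_num.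
  by rewrite -A1.
have [_ [U [oU AU] <-]] := lb_ereal_inf_adherent e20 Ifin.
rewrite -A1 => muU.
pose V := U `&` ball x0 N.
have oV : open V by apply: openI => //; exact: ball_openX.
have mV : measurable V by exact: open_measurableX.
have mU := open_measurableX oU.
have AV : A `<=` V by move=> x Ax; split; [exact: AU|exact: AN].
(* [V] lies in a ball, while a space of infinite measure whose balls have finite measure is
   unbounded. *)
have V0 : ~` V !=set0.
  have [y Ny] := unbounded_space x0 N; exists y => -[_]; rewrite in_ballE.
  by rewrite ltNge Ny.
have VA : (mu (V `\` A) <= (e / 2)%:E)%E.
  apply: (@le_trans _ _ (mu (U `\` A))).
    rewrite le_measure ?inE//; try exact: measurableD.
    by move=> x [[Ux _] Ax].
  have Uoo : (mu U < +oo)%E by apply: (lt_trans muU); rewrite -(fineK Afin) -EFinD ltry.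
  by rewrite measureD// setIidr// leeBlDr// addeC ltW.
pose W k := [set x | V x /\ codist V x < k.+1%:R^-1].
have cV := codist_lip V0.
have mc : measurable_fun setT (codist V).
  by apply: (@lipschitz_measurable _ 1) => x y; rewrite mul1r.
have mW k : measurable (W k).
  rewrite (_ : W k = V `&` (codist V @^-1` `]-oo, k.+1%:R^-1[)); last first.
    by apply/seteqP; split => x /=; rewrite in_itv.
  apply: measurableI => //; rewrite -[X in measurable X]setTI; exact: mc.
have W0 : \bigcap_k W k = set0.
  rewrite -subset0 => x Wx; have [Vx _] := Wx 0%N I.
  have c0 := codist_gt0 V0 oV Vx.
  have [_] := Wx (Num.truncn (codist V x)^-1) I.
  by rewrite ltNge => /negP; apply; rewrite invf_ple ?posrE// ltW// truncnS_gt.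
have muW : mu (W k) @[k --> \oo] --> 0%E.
  rewrite -(measure0 mu) -W0; apply: nonincreasing_cvg_mu => //.
  - apply: le_lt_trans (mu_ball x0 N); rewrite le_measure ?inE//; first exact: measurable_ballX.
    by move=> x [[_]].
  - by rewrite W0.
  - move=> n k nk; apply/subsetPset => x [Vx xk]; split => //.
    by rewrite (lt_le_trans xk)// lef_pV2 ?posrE// ler_nat ltnS.
have [k _ /(_ k (leqnn k)) muk] := cvge0_near e20 muW.
pose phi x := Num.min 1 (k.+1%:R * codist V x).
have cge0 x := codist_ge0 x V0.
have phil : lipb x0 phi.
  exists k.+1%:R, 1, N; split.
  - move=> x y; apply: (@le_trans _ _ `|k.+1%:R * codist V x - k.+1%:R * codist V y|).
      rewrite /phi /Num.min; set a := _ * codist V x; set b := _ * codist V y.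
      have := ler_norm (a - b); have := ler_norm (b - a); rewrite (distrC b).
      by rewrite ler_norml; case: ifP; case: ifP; lra.
    by rewrite -mulrBr normrM ger0_norm// ler_wpM2l.
  - by move=> x; rewrite /phi ger0_norm ?ge_min ?lexx// le_min ler01 mulr_ge0.
  - move=> x Nx; rewrite /phi codist0 ?mulr0 ?min_r//.
    by move=> [_]; rewrite in_ballE ltNge Nx.
exists phi => //.
have sub : [set x | \1_A x != phi x] `<=` (V `\` A) `|` W k.
  move=> x /= Hx; have [Vx|nVx] := pselect (V x); last first.
    exfalso; move/eqP : Hx; apply; rewrite /phi codist0// mulr0 min_r//.
    by rewrite indicE memNset// => /AV.
  have [Ax|nAx] := pselect (A x); last by left.
  right; split => //; rewrite ltNge; apply/negP => kc.
  move/eqP : Hx; apply; rewrite indicE mem_set//= /phi min_l//.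
  by rewrite mulrC -ler_pdivrMr// div1r.
have mS : measurable [set x | \1_A x != phi x].
  rewrite (_ : [set x | _] = ((fun x => \1_A x - phi x) @^-1` [set~ 0])); last first.
    apply/seteqP; split => x /= h.
      by move/eqP; rewrite subr_eq0; exact/negP.
    by apply/eqP => hx; apply: h; rewrite hx subrr.
  have mf : measurable_fun setT (fun x => \1_A x - phi x).
    by apply: measurable_funB; [exact: measurable_indic|exact: lipb_measurable phil].
  by rewrite -[X in measurable X]setTI; apply: mf => //; exact: measurableC.
apply: (@le_trans _ _ (mu ((V `\` A) `|` W k))).
  rewrite le_measure ?inE//; apply: measurableU => //; exact: measurableD.
apply: (le_trans (measureU2 _ _ _)) => //; first exact: measurableD.
by rewrite [e]splitr EFinD; exact: leeD.
Qed.

Let mltb (f phi : X -> R) (e : R) : measurable_fun setT f -> measurable_fun setT phi ->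
  measurable [set x | e < `|f x - phi x|].
Proof.
move=> mf mphi; rewrite -[X in measurable X]setTI.
have mg : measurable_fun setT (fun x => `|f x - phi x|).
  by apply: measurableT_comp => //; exact: measurable_funB.
have := mg measurableT _ (measurable_itv `]e, +oo[).
by congr measurable; congr (_ `&` _); apply/seteqP; split => x /=; rewrite in_itv/= andbT.
Qed.

(** Induction on the number of layers of height [e]. Subtracting [e] times the indicator of the set
    where [e <= f] removes one layer, and in the last layer 0 is within the tolerance. The tolerance
    does not accumulate, because an indicator is matched exactly off a small set; each step spends
    half of the measure [t]. *)
Let approx_layers x0 (N e : R) (K : nat) (f : X -> R) (t : R) : 0 < e -> 0 < t ->
  measurable_fun setT f -> (forall x, 0 <= f x <= K.+1%:R * e) ->
  (forall x, N <= mdist x0 x -> f x = 0) ->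
  exists2 phi, lipb x0 phi & (mu [set x | e < `|f x - phi x|]%R <= t%:E)%E.
Proof.
move=> e0; elim: K f t => [|K IH] f t t0 mf fK fN.
  exists (cst 0); first exact: lipb0.
  rewrite (_ : [set x | _] = set0) ?measure0 ?lee_fin ?ltW//.
  rewrite -subset0 => x /=; rewrite subr0.
  by case/andP: (fK x) => f0; rewrite mul1r ger0_norm// leNgt => /negP.
have t20 : 0 < t / 2 by rewrite divr_gt0.
pose A := [set x | e <= f x].
have mA : measurable A.
  rewrite -[A]setTI; have := mf measurableT _ (measurable_itv `[e, +oo[).
  by congr measurable; congr (_ `&` _); apply/seteqP; split => x /=; rewrite in_itv/= andbT.
have AN : A `<=` ball x0 N.
  move=> x Ax; rewrite in_ballE ltNge; apply/negP => /fN fx0; move: Ax.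
  by rewrite /A/= fx0 leNgt e0.
have [phi phil Aphi] := approx_indic mA AN t20.
have mg : measurable_fun setT (fun x => f x - e * \1_A x).
  apply: measurable_funB => //; apply: measurable_funM => //.
have [psi psil gpsi] : exists2 psi, lipb x0 psi &
    (mu [set x | e < `|(f x - e * \1_A x) - psi x|]%R <= (t / 2)%:E)%E.
  apply: IH => //.
  - move=> x; case/andP: (fK x) => f0 fxK; rewrite indicE.
    have [xA|xA] := boolP (x \in A).
      move: (xA); rewrite inE /A/= mulr1 subr_ge0 => -> /=.
      by rewrite lerBlDr (le_trans fxK)// -[X in _ + X]mul1r -mulrDl -natr1.
    rewrite mulr0 subr0 f0 /= (@le_trans _ _ e)//.
      rewrite ltW// ltNge; apply/negP => /= Hx; move/negP : xA; apply.
      by rewrite inE.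
    by rewrite ler_peMl ?(ltW e0) ?ler1n.
  - move=> x /[dup] xN /fN ->; rewrite indicE memNset ?mulr0 ?subr0//.
    by move=> /AN; rewrite in_ballE ltNge xN.
have mphi := lipb_measurable phil; have mpsi := lipb_measurable psil.
exists (fun x => e * phi x + psi x); first by apply: lipbD => //; exact: lipbZ.
have m1 : measurable [set x | \1_A x != phi x].
  rewrite (_ : [set x | _] = [set x | 0 < `|\1_A x - phi x|]).
    by apply: mltb => //; exact: measurable_indic.
  by apply/seteqP; split => x /=; rewrite normr_gt0 subr_eq0.
have m2 := mltb e mg mpsi.
apply: (@le_trans _ _ (mu ([set x | \1_A x != phi x] `|` [set x | e < `|(f x - e * \1_A x) - psi x|]))).
  rewrite le_measure ?inE//.
  - apply: mltb => //; apply: measurable_funD => //; exact: measurable_funM.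
  - exact: measurableU.
  - move=> x /= Hx; have [E|] := eqVneq (\1_A x) (phi x); last by left.
    by right; rewrite E -addrA -opprD.
apply: (le_trans (measureU2 _ m1 m2)).
by rewrite [t]splitr EFinD; exact: leeD.
Qed.

Lemma approx_real x0 (N e : R) (f : X -> R) (M : R) : 0 < e ->
  measurable_fun setT f -> (forall x, `|f x| <= M) ->
  (forall x, N <= mdist x0 x -> f x = 0) ->
  exists phi, [/\ lipb x0 phi, forall x, `|phi x| <= M &
    (mu [set x | e < `|f x - phi x|]%R <= e%:E)%E].
Proof.
move=> e0 mf fM fN; have e20 : 0 < e / 2 by rewrite divr_gt0.
pose K := Num.truncn (M / (e / 2)).
have MK : M <= K.+1%:R * (e / 2).
  by rewrite -ler_pdivrMr// ltW// truncnS_gt.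
pose fp x := Num.max (f x) 0; pose fm x := Num.max (- f x) 0.
have pm x : f x = fp x - fm x.
  by rewrite /fp /fm; case: (leP (f x) 0) => h; case: (leP (- f x) 0) => h'; lra.
have M0 : 0 <= M by apply: (le_trans _ (fM x0)).
have [phi phil Hphi] : exists2 phi, lipb x0 phi & (mu [set x | (e / 2) < `|fp x - phi x|]%R <= (e / 2)%:E)%E.
  apply: (@approx_layers _ N _ K) => //.
  - exact: measurable_maxr.
  - move=> x; rewrite /fp le_max lexx orbT/= (le_trans _ MK)// ge_max M0 andbT.
    by rewrite (le_trans (ler_norm _)).
  - by move=> x /fN; rewrite /fp => ->; rewrite maxxx.
have [psi psil Hpsi] : exists2 phi, lipb x0 phi & (mu [set x | (e / 2) < `|fm x - phi x|]%R <= (e / 2)%:E)%E.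
  apply: (@approx_layers _ N _ K) => //.
  - by apply: measurable_maxr => //; exact: measurable_funN.
  - move=> x; rewrite /fm le_max lexx orbT/= (le_trans _ MK)// ge_max M0 andbT.
    by rewrite (le_trans (ler_norm _))// normrN.
  - by move=> x /fN; rewrite /fm => ->; rewrite oppr0 maxxx.
have mphi := lipb_measurable phil; have mpsi := lipb_measurable psil.
have mfp : measurable_fun setT fp by exact: measurable_maxr.
have mfm : measurable_fun setT fm by apply: measurable_maxr => //; exact: measurable_funN.
(* The clamp restores the bound [M]. It fixes the values of [f] and is 1-Lipschitz, so the error
   does not grow. *)
have dl : lipb x0 (fun x => clamp M (phi x + (- 1) * psi x)).
  apply: (lipb_clamp M0); apply: lipbD => //; exact: lipbZ.
exists (fun x => clamp M (phi x + (- 1) * psi x)); split => //.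
  by move=> x; exact: clamp_le.
apply: (@le_trans _ _ (mu ([set x | (e / 2) < `|fp x - phi x|] `|` [set x | (e / 2) < `|fm x - psi x|]))).
  rewrite le_measure ?inE//.
  - apply: mltb => //; exact: lipb_measurable dl.
  - by apply: measurableU; exact: mltb.
  - move=> x /= Hx; apply: contrapT => /not_orP[/negP h1 /negP h2].
    move: Hx; rewrite -[f x](clamp_id (fM x)) => /lt_le_trans/(_ (clamp_lip _ _ _)).
    rewrite pm; apply/negP; rewrite -leNgt.
    rewrite (_ : _ - _ = (fp x - phi x) - (fm x - psi x)); last by ring.
    by rewrite (le_trans (ler_normB _ _))// [leRHS]splitr lerD// leNgt.
apply: (le_trans (measureU2 _ (mltb _ mfp mphi) (mltb _ mfm mpsi))).
by rewrite [in leRHS](splitr e) EFinD; exact: leeD.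
Qed.

Definition clipb x0 (f : X -> R[i]) :=
  lipb x0 (fun x => complex.Re (f x)) /\ lipb x0 (fun x => complex.Im (f x)).

Lemma clipb_cmeasurable x0 f : clipb x0 f -> cmeasurable setT f.
Proof. by move=> [f1 f2]; split; [exact: lipb_measurable f1|exact: lipb_measurable f2]. Qed.

Lemma clipbM x0 f phi : clipb x0 f -> lipb x0 phi ->
  clipb x0 (fun x => (phi x)%:C%C * f x).
Proof.
move=> [f1 f2] lphi; split.
- rewrite (_ : (fun x => _) = phi \* (fun x => complex.Re (f x))); first exact: lipbM.
  by apply/funext => x; rewrite cReM /= mul0r subr0.
- rewrite (_ : (fun x => _) = phi \* (fun x => complex.Im (f x))); first exact: lipbM.
  by apply/funext => x; rewrite cImM /= mul0r addr0.
Qed.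

Lemma clipb_real x0 phi : lipb x0 phi -> clipb x0 (fun x => (phi x)%:C%C).
Proof. by move=> h; split => //; exact: lipb0. Qed.

(** The Hölder quotient is controlled by the Lipschitz bound at distances up to 1 and by the
    supremum beyond. *)
Lemma clipb_Cb x0 f eta : 0 < eta <= 1 -> clipb x0 f -> Cb eta f.
Proof.
move=> /andP[eta0 eta1] [[L [M [r [H1 H2 H3]]]] [L' [M' [r' [H1' H2' H3']]]]]; split.
  exists x0, (Num.max r r') => y /= fy; rewrite in_ballE ltNge ge_max.
  apply/negP => /andP[/H3 h /H3' h']; move/eqP : fy; apply.
  exact: complex_eq.
pose A := `|L| + `|L'|; pose B := 2 * (M + M').
apply: (@le_lt_trans _ _ (A + B)%:E); last exact: ltry.
apply: ge_ereal_sup => _ [x [y [xy ->]]].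
have D0 : 0 < mdist x y by rewrite mdist_gt0; exact/eqP.
rewrite lee_fin ler_pdivrMr ?powR_gt0//.
have A0 : 0 <= A by rewrite addr_ge0.
have M0 : 0 <= M by rewrite (le_trans _ (H2 x)).
have M'0 : 0 <= M' by rewrite (le_trans _ (H2' x)).
have B0 : 0 <= B by rewrite mulr_ge0// addr_ge0.
apply: (le_trans (cabs_ler_ReIm _)); rewrite !(cReD, cImD, cReN, cImN) mulrDl.
have [D1|D1] := leP (mdist x y) 1.
- have AD : 0 <= B * mdist x y `^ eta by rewrite mulr_ge0 ?powR_ge0.
  rewrite (@le_trans _ _ (A * mdist x y))//.
    rewrite mulrDl lerD//.
      by rewrite (le_trans (H1 x y))// ler_wpM2r ?mdist_ge0// ler_norm.
    by rewrite (le_trans (H1' x y))// ler_wpM2r ?mdist_ge0// ler_norm.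
  suff : A * mdist x y <= A * mdist x y `^ eta by lra.
  by rewrite ler_wpM2l// ger1_powR// D0.
- have AD : 0 <= A * mdist x y `^ eta by rewrite mulr_ge0 ?powR_ge0.
  rewrite (@le_trans _ _ B)//.
    have := ler_normB (complex.Re (f x)) (complex.Re (f y)).
    have := ler_normB (complex.Im (f x)) (complex.Im (f y)).
    have := H2 x; have := H2 y; have := H2' x; have := H2' y; rewrite /B; lra.
  suff : B <= B * mdist x y `^ eta by lra.
  by rewrite ler_peMr// -[leLHS](powRr0 (mdist x y)) ler_powR// ltW.
Qed.

Lemma approx_clipb x0 (N : R) (f : X -> R[i]) (M : R) :
  cmeasurable setT f -> (forall x, cabs (f x) <= M) ->
  (forall x, N <= mdist x0 x -> f x = 0) ->
  exists F : nat -> X -> R[i], [/\ forall k, clipb x0 (F k),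
    forall k x, cabs (F k x) <= 2 * M &
    {ae mu, forall x, ccvg (F ^~ x) (f x)}].
Proof.
move=> mf fM fN.
have H (k : nat) : exists phi : X -> R[i], [/\ clipb x0 phi, forall x, cabs (phi x) <= 2 * M &
    (mu [set x | 2 ^- k < cabs (phi x - f x)]%R <= (2 ^- k)%:E)%E].
  (* Half of [2 ^- k] for the real part and half for the imaginary part, in height and in measure
     alike. *)
  pose e : R := 2 ^- k.+1; have e0 : 0 < e by rewrite invr_gt0 exprn_gt0.
  have [phi [phil phiM Hphi]] := @approx_real x0 N e (fun x => complex.Re (f x)) M e0 mf.1
    (fun x => le_trans (ler_Re_cabs _) (fM x))
    (fun x xN => congr1 (@complex.Re R) (fN x xN)).
  have [psi [psil psiM Hpsi]] := @approx_real x0 N e (fun x => complex.Im (f x)) M e0 mf.2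
    (fun x => le_trans (ler_Im_cabs _) (fM x))
    (fun x xN => congr1 (@complex.Im R) (fN x xN)).
  pose g x := Complex (phi x) (psi x).
  have gl : clipb x0 g by [].
  exists g; split => //.
    move=> x; apply: (le_trans (cabs_ler_ReIm _)); rewrite mulr_natl mulr2n.
    by apply: lerD; [exact: phiM|exact: psiM].
  have m1 := mltb e mf.1 (lipb_measurable phil).
  have m2 := mltb e mf.2 (lipb_measurable psil).
  apply: (@le_trans _ _ (mu ([set x | e < `|complex.Re (f x) - phi x|] `|`
     [set x | e < `|complex.Im (f x) - psi x|]))).
    rewrite le_measure ?inE//.
    - apply: measurable_cabs_gt; apply: cmeasurableB => //; exact: clipb_cmeasurable gl.
    - exact: measurableU.
    - move=> x /= Hx; apply: contrapT => /not_orP[/negP h1 /negP h2].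
      move: Hx; apply/negP; rewrite -leNgt cabsB (le_trans (cabs_ler_ReIm _))//.
      rewrite !(cReD, cImD, cReN, cImN) (_ : 2 ^- k = e + e); last first.
        by rewrite /e exprS invfM; field; rewrite expf_neq0.
      by rewrite lerD// leNgt.
  apply: (le_trans (measureU2 _ m1 m2)).
  rewrite (_ : 2 ^- k = e + e); last by rewrite /e exprS invfM; field; rewrite expf_neq0.
  by rewrite EFinD; exact: leeD.
have [F HF] := choice H; exists F; split.
- by move=> k; have [] := HF k.
- by move=> k; have [] := HF k.
- apply: borel_cantelli_ae => // k; last by have [] := HF k.
  by have [h _ _] := HF k; exact: clipb_cmeasurable h.
Qed.

End borel_metric.

(** * Dominated convergence and uniqueness of the function representing a distribution *)

Section complex_dominated_convergence.
Context {R : realType} {d : measure_display} {T : measurableType d}.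
Variable mu : {measure set T -> \bar R}.
Implicit Types (f g : T -> R[i]) (F : nat -> T -> R[i]).

Let Rintegral_cvg (u : nat -> T -> R) (v g : T -> R) :
  (forall k, measurable_fun setT (u k)) -> measurable_fun setT v ->
  mu.-integrable setT (EFin \o g) -> (forall k x, `|u k x| <= g x) ->
  {ae mu, forall x, u k x @[k --> \oo] --> v x} ->
  mu.-integrable setT (EFin \o v) /\
  (\int[mu]_x u k x)%R @[k --> \oo] --> (\int[mu]_x v x)%R.
Proof.
move=> mu_ mv ig ug uv.
have [||||iv _ cv] := @dominated_convergence _ _ _ mu setT measurableT
  (fun k => EFin \o u k) (EFin \o v) (EFin \o g) _ _ _ ig.
- by move=> k; exact/measurable_EFinP.
- exact/measurable_EFinP.
- apply: filterS uv => x h _; apply: cvg_EFin h; exact: nearW.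
- by apply: aeW => x k _ /=; rewrite lee_fin.
split => //; rewrite /Rintegral; apply: fine_cvg.
rewrite fineK; first exact: cv.
exact: integrable_fin_num.
Qed.

Lemma complex_dominated_convergence F f (u : T -> R) :
  (forall k, cmeasurable setT (F k)) -> cmeasurable setT f ->
  mu.-integrable setT (EFin \o u) -> (forall k x, cabs (F k x) <= u x) ->
  {ae mu, forall x, ccvg (F ^~ x) (f x)} ->
  cintegrable mu setT f /\
  ccvg (fun k => cintegral mu setT (F k)) (cintegral mu setT f).
Proof.
move=> mF mf iu Fu Ff.
have [|||i1 c1] := @Rintegral_cvg (fun k x => complex.Re (F k x)) (fun x => complex.Re (f x)) u _ mf.1 iu.
- by move=> k; exact: (mF k).1.
- by move=> k x; exact: le_trans (ler_Re_cabs _) (Fu k x).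
- by apply: filterS Ff => x; exact: ccvg_Re.
have [|||i2 c2] := @Rintegral_cvg (fun k x => complex.Im (F k x)) (fun x => complex.Im (f x)) u _ mf.2 iu.
- by move=> k; exact: (mF k).2.
- by move=> k x; exact: le_trans (ler_Im_cabs _) (Fu k x).
- by apply: filterS Ff => x; exact: ccvg_Im.
split => //; exact: ccvg_ReIm.
Qed.

End complex_dominated_convergence.

Section uniqueness.
Context {R : realType} {d : measure_display} {X : borelMetricType R d}.
Variable mu : {measure set X -> \bar R}.
Hypothesis mu_ball : forall (x : X) r, (mu (ball x r) < +oo)%E.
Hypothesis mu_infinite : mu setT = +oo%E.
Hypothesis mu_regular : regular_measure mu.
Variable eta : R.
Hypothesis eta01 : 0 < eta <= 1.

Lemma supp_cutoff (x1 : X) (a b c : R) (phi : X -> R[i]) : a < b -> b < c ->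
  supp (fun x => (cutoff x1 a b x)%:C%C * phi x) `<=` ball x1 c.
Proof.
move=> ab bc.
have cl : closed (~` [set y | b < mdist x1 y]).
  apply: open_closedC; rewrite openE => y /= by_.
  rewrite /interior -nbhs_ballE; exists (mdist x1 y - b); rewrite /= ?subr_gt0// => z.
  rewrite in_ballE => yz /=; have := metric_triangle x1 z y.
  by rewrite (metric_sym z y); lra.
apply: subset_trans (_ : ~` [set y | b < mdist x1 y] `<=` _); last first.
  by move=> y /= /negP; rewrite -leNgt in_ballE => /le_lt_trans; exact.
rewrite [X in _ `<=` X](closure_id _).1//; apply: closure_subset => y /= h.
apply/negP; rewrite -leNgt leNgt; apply/negP => by_; move/eqP: h; apply.
by rewrite cutoff0 ?mul0r// ltW.
Qed.

(** The sign of the real part of [h] on [ball x1 a] is an almost everywhere limit of bounded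
    Lipschitz functions. Multiplied by the cutoff these are admissible tests, and in the limit the
    integral of the absolute value of the real part over the ball is 0. *)
Let test_zero_Re (x1 : X) (a b c : R) (h : X -> R[i]) : a < b -> b < c ->
  (forall phi, Cb eta phi -> supp phi `<=` ball x1 c ->
    cintegrable mu setT (fun x => h x * phi x) /\ cintegral mu setT (fun x => h x * phi x) = 0) ->
  {ae mu, forall x, ball x1 a x -> complex.Re (h x) = 0}.
Proof.
move=> ab bc hphi; pose chi x : R[i] := (cutoff x1 a b x)%:C%C.
pose H x := h x * chi x.
have lchi : lipb x1 (cutoff x1 a b) by exact: lipb_cutoff.
(* Testing with the cutoff itself shows that [H] is integrable, which provides the dominating
   function below. *)
have [iH _] : cintegrable mu setT H /\ cintegral mu setT H = 0.
  apply: hphi; first by apply: (clipb_Cb eta01); exact: clipb_real lchi.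
  rewrite (_ : chi = fun x => (cutoff x1 a b x)%:C%C * 1); first exact: supp_cutoff.
  by apply/funext => x; rewrite mulr1.
have mH := cintegrable_cmeasurable iH.
have mBa : measurable (ball x1 a) by exact: measurable_ballX.
pose sg x : R := Num.sg (complex.Re (H x)) * \1_(ball x1 a) x.
have msg : measurable_fun setT sg.
  apply: measurable_funM; last exact: measurable_indic.
  rewrite (_ : (fun x => _) = (fun x => \1_([set x | 0 < complex.Re (H x)]) x - \1_([set x | complex.Re (H x) < 0]) x)).
    apply: measurable_funB; apply: measurable_indic.
      rewrite -[X in measurable X]setTI; have := mH.1 measurableT _ (measurable_itv `]0, +oo[).
      by congr measurable; congr (_ `&` _); apply/seteqP; split => x /=; rewrite in_itv/= andbT.
    rewrite -[X in measurable X]setTI; have := mH.1 measurableT _ (measurable_itv `]-oo, 0[).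
    by congr measurable; congr (_ `&` _); apply/seteqP; split => x /=; rewrite in_itv/=.
  apply/funext => x; rewrite !indicE.
  case: (sgrP (complex.Re (H x))) => h0; rewrite ?h0.
  - by rewrite !memNset ?subrr//= h0 ltxx.
  - by rewrite mem_set// memNset ?subr0//= => /(lt_trans h0); rewrite ltxx.
  - by rewrite memNset ?mem_set ?sub0r//= => /(lt_trans h0); rewrite ltxx.
have sg1 x : cabs ((sg x)%:C%C) <= 1.
  rewrite cabs_real normrM normr_sg indicE ger0_norm//.
  by rewrite mulr_ile1//; [case: eqP|case: (_ \in _)].
have sgN x : a <= mdist x1 x -> (sg x)%:C%C = 0 :> R[i].
  by move=> ax; rewrite /sg indicE memNset ?mulr0// in_ballE ltNge ax.
have [F [Fl F2 Fsg]] := approx_clipb mu_ball mu_infinite mu_regular (cmeasurable_real msg) sg1 sgN.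
have mF k : cmeasurable setT (F k) := clipb_cmeasurable (Fl k).
have iu : mu.-integrable setT (EFin \o (fun x => 2 * 1 * cabs (H x))).
  exact: (integrableZl measurableT (2 * 1) (integrable_cabs measurableT iH)).
have [||||iG cv] := @complex_dominated_convergence _ _ _ mu (fun k x => H x * F k x)
  (fun x => H x * (sg x)%:C%C) (fun x => 2 * 1 * cabs (H x)) _ _ iu.
- by move=> k; exact: cmeasurableM.
- by apply: cmeasurableM => //; exact: cmeasurable_real.
- by move=> k x; rewrite cabsM mulrC ler_wpM2r ?cabs_ge0.
- by apply: filterS Fsg => x; exact: ccvgZ.
have HF0 k : cintegral mu setT (fun x => H x * F k x) = 0.
  have [_ <-] := hphi _ (clipb_Cb eta01 (clipbM (Fl k) lchi)) (@supp_cutoff x1 a b c (F k) ab bc).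
  by congr cintegral; apply/funext => x; rewrite /H /chi mulrA.
have I0 : cintegral mu setT (fun x => H x * (sg x)%:C%C) = 0.
  apply: (ccvg_unique cv); under [X in ccvg X]eq_fun do rewrite HF0; exact: ccvg_cst.
have E x : complex.Re (H x * (sg x)%:C%C) = `|complex.Re (H x)| * \1_(ball x1 a) x.
  by rewrite cReM /= mulr0 subr0 /sg mulrA [X in X * _]mulrC -normrEsg.
have J0 : (\int[mu]_x `|(complex.Re (H x) * \1_(ball x1 a) x)%:E|)%E = 0%E.
  have J1 : (\int[mu]_x (complex.Re (H x * (sg x)%:C%C))%:E)%E = 0%E.
    rewrite -[LHS]fineK; last exact: (integrable_fin_num measurableT iG.1).
    by congr EFin; have := congr1 (@complex.Re R) I0.
  rewrite -[RHS]J1; apply: eq_integral => x _.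
  by rewrite E /= normrM [X in _ * X]ger0_norm ?indicE.
have mRH : measurable_fun setT (fun x => (complex.Re (H x) * \1_(ball x1 a) x)%:E).
  apply/measurable_EFinP; apply: measurable_funM; [exact: mH.1|exact: measurable_indic].
have := (ae_eq_integral_abs mu measurableT mRH).1 J0.
apply: filterS => x /(_ I) /= [] + Bx; rewrite indicE mem_set// mulr1.
rewrite /H /chi cutoff1 ?mulr1//; first by move: Bx; rewrite in_ballE => /ltW.
Qed.

Lemma test_zero (x1 : X) (a c : R) (h : X -> R[i]) : a < c ->
  (forall phi, Cb eta phi -> supp phi `<=` ball x1 c ->
    cintegrable mu setT (fun x => h x * phi x) /\ cintegral mu setT (fun x => h x * phi x) = 0) ->
  {ae mu, forall x, ball x1 a x -> h x = 0}.
Proof.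
move=> ac hphi; pose b := (a + c) / 2.
have ab : a < b by rewrite midf_lt.
have bc : b < c by rewrite midf_lt.
have h1 := test_zero_Re ab bc hphi.
(* The real part of [- 'i * h] is the imaginary part of [h]. *)
have h2 : {ae mu, forall x, ball x1 a x -> complex.Re (- 'i%C * h x) = 0}.
  apply: (test_zero_Re ab bc) => phi Cphi sphi; have [i0 e0] := hphi _ Cphi sphi.
  rewrite (_ : (fun x => _) = (fun x => - 'i%C * (h x * phi x))); last first.
    by apply/funext => x; rewrite mulrA.
  split; first exact: cintegrableZ.
  by rewrite cintegralZ// e0 mulr0.
apply: filterS2 h1 h2 => x h1 h2 Bx; apply: complex_eq; first by rewrite h1.
by have := h2 Bx; rewrite mulNr cReN cReM /= mul0r mul1r sub0r opprK.
Qed.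

Lemma representation_unique (U : set X) (x1 : X) (a c : R) L g g' : a < c ->
  ball x1 c `<=` U -> represented_on mu eta U L g -> represented_on mu eta U L g' ->
  {ae mu, forall x, ball x1 a x -> g x = g' x}.
Proof.
move=> ac cU Lg Lg'.
have : {ae mu, forall x, ball x1 a x -> g x - g' x = 0}.
  apply: (test_zero ac) => phi Cphi sphi.
  have [i1 e1] := Lg _ Cphi (subset_trans sphi cU).
  have [i2 e2] := Lg' _ Cphi (subset_trans sphi cU).
  rewrite (_ : (fun x => _) = (fun x => g x * phi x - g' x * phi x)); last first.
    by apply/funext => x; rewrite mulrBl.
  by split; [exact: cintegrableB|rewrite cintegralB// -e1 -e2 subrr].
by apply: filterS => x h /h /subr0_eq.
Qed.

Lemma ae_all_balls (x0 : X) (P : X -> Prop) :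
  (forall N : nat, {ae mu, forall x, ball x0 N%:R x -> P x}) -> {ae mu, forall x, P x}.
Proof.
move=> H; have := ae_foralln H; apply: filterS => x /(_ (Num.truncn (mdist x0 x)).+1); apply.
by rewrite in_ballE truncnS_gt.
Qed.

Lemma representation_uniqueT (L : (X -> R[i]) -> R[i]) g g' :
  represented_on mu eta setT L g -> represented_on mu eta setT L g' -> ae_equal mu g g'.
Proof.
move=> Lg Lg'; have [x0|X0] := pselect (inhabited X); last first.
  by apply: aeW => x; exfalso; apply: X0; exists.
case: x0 => x0; apply: (@ae_all_balls x0) => N.
by apply: (@representation_unique setT x0 N%:R N.+1%:R _ _ _ _ _ Lg Lg') => //; rewrite ltr_nat.
Qed.

End uniqueness.

(** * Lebesgue spaces and weak extensions *)

Section Lp_theory.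
Context {R : realType} {d : measure_display} {T : measurableType d}.
Variable mu : {measure set T -> \bar R}.
Implicit Types (f g : T -> R[i]) (F : nat -> T -> R[i]) (p : R).

Lemma LpnormE p f :
  Lpnorm mu p%:E f = ((\int[mu]_x (cabs (f x) `^ p)%:E) `^ p^-1)%E.
Proof.
rewrite /Lpnorm Lnorm.unlock; congr (_ `^ _)%E; apply: eq_integral => x _ /=.
by rewrite ger0_norm// cabs_ge0.
Qed.

Lemma measurable_cabs_powR p f : cmeasurable setT f ->
  measurable_fun setT (fun x => (cabs (f x) `^ p)%:E).
Proof.
move=> mf; apply/measurable_EFinP.
by apply: (measurableT_comp (measurable_powR p)); exact: measurable_cabs.
Qed.

Lemma integrable_cabs_powR p f : cmeasurable setT f ->
  (\int[mu]_x (cabs (f x) `^ p)%:E < +oo)%E ->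
  mu.-integrable setT (EFin \o (fun x => cabs (f x) `^ p)).
Proof.
move=> mf foo; apply/integrableP; split; first exact: measurable_cabs_powR.
by under eq_integral do rewrite /= ger0_norm ?powR_ge0//.
Qed.

Lemma Lp_integrable p f : 0 < p -> Lp mu p%:E f ->
  mu.-integrable setT (EFin \o (fun x => cabs (f x) `^ p)).
Proof.
move=> p0 [mf]; rewrite LpnormE => foo; apply: integrable_cabs_powR => //.
by apply: lty_poweRy foo; rewrite invr_neq0// gt_eqF.
Qed.

Lemma Lpnorm_ge0 (q : \bar R) f : (0 <= Lpnorm mu q f)%E.
Proof. exact: Lnorm_ge0. Qed.

Lemma Lpnorm_fine (q : \bar R) f : Lp mu q f -> Lpnorm mu q f = (fine (Lpnorm mu q f))%:E.
Proof. by move=> [_ foo]; rewrite fineK// ge0_fin_numE// Lpnorm_ge0. Qed.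

Lemma fine_Lpnorm_ge0 (q : \bar R) f : 0 <= fine (Lpnorm mu q f).
Proof. by rewrite fine_ge0// Lpnorm_ge0. Qed.

Lemma Lpnorm_le p f g : 0 < p -> cmeasurable setT f -> cmeasurable setT g ->
  (forall x, cabs (f x) <= cabs (g x)) -> (Lpnorm mu p%:E f <= Lpnorm mu p%:E g)%E.
Proof.
move=> p0 mf mg fg; rewrite !LpnormE.
have ge0 (h : T -> R[i]) : (0 <= \int[mu]_x (cabs (h x) `^ p)%:E)%E.
  by apply: integral_ge0 => x _; rewrite lee_fin powR_ge0.
apply: gt0_ler_poweR; rewrite ?in_itv/= ?ge0 ?leey ?andbT//.
  by rewrite invr_ge0 ltW.
apply: ge0_le_integral => //.
- by move=> x _; rewrite lee_fin powR_ge0.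
- exact: measurable_cabs_powR.
- exact: measurable_cabs_powR.
- by move=> x _; rewrite lee_fin ge0_ler_powR// ?ltW// nnegrE cabs_ge0.
Qed.

Lemma Lpnorm_triangle p f g : 1 <= p -> cmeasurable setT f -> cmeasurable setT g ->
  (Lpnorm mu p%:E (fun x => f x + g x)%R <= Lpnorm mu p%:E f + Lpnorm mu p%:E g)%E.
Proof.
move=> p1 mf mg.
have mcf := measurable_cabs mf; have mcg := measurable_cabs mg.
apply: le_trans (minkowski_EFin mu mcf mcg p1).
have -> : 'N[mu]_p%:E[EFin \o ((fun x => cabs (f x)) \+ (fun x => cabs (g x)))%R]%E =
    Lpnorm mu p%:E (fun x => (cabs (f x) + cabs (g x))%:C%C).
  by apply: eq_Lnorm => x /=; rewrite cabs_real ger0_norm// addr_ge0 ?cabs_ge0.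
apply: Lpnorm_le; first exact: lt_le_trans p1.
- exact: cmeasurableD.
- by apply: cmeasurable_real; exact: measurable_funD.
- by move=> x; rewrite cabs_real ger0_norm ?addr_ge0 ?cabs_ge0// ler_cabsD.
Qed.

Lemma cvg_powR0 (u : nat -> R) p : 0 < p -> (forall k, 0 <= u k) ->
  u k @[k --> \oo] --> (0 : R) -> (u k) `^ p @[k --> \oo] --> (0 : R).
Proof.
move=> p0 u0 /cvgrPdist_lt uc; apply/cvgrPdist_lt => e e0.
have e1 : 0 < e `^ p^-1 by rewrite powR_gt0.
near=> k; rewrite sub0r normrN ger0_norm ?powR_ge0//.
rewrite -[ltRHS](powRr1 (ltW e0)) -(@mulVf _ p) ?gt_eqF// powRrM.
rewrite gt0_ltr_powR// ?nnegrE ?powR_ge0//.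
have : `|0 - u k| < e `^ p^-1 by near: k; exact: uc.
by rewrite sub0r normrN ger0_norm.
Unshelve. all: by end_near. Qed.

Lemma Lp_dominated p F f (u : T -> R) : 0 < p ->
  (forall k, cmeasurable setT (F k)) -> cmeasurable setT f ->
  mu.-integrable setT (EFin \o (fun x => u x `^ p)) ->
  (forall k x, cabs (F k x) <= u x) -> (forall x, cabs (f x) <= u x) ->
  {ae mu, forall x, ccvg (F ^~ x) (f x)} ->
  fine (Lpnorm mu p%:E (fun x => F k x - f x)) @[k --> \oo] --> (0 : R).
Proof.
move=> p0 mF mf iu Fu fu Ff.
have u0 x : 0 <= u x by rewrite (le_trans _ (fu x))// cabs_ge0.
have iu2 : mu.-integrable setT (EFin \o (fun x => 2 `^ p * u x `^ p)).
  exact: (integrableZl measurableT (2 `^ p) iu).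
have mFf k : cmeasurable setT (fun x => F k x - f x) by exact: cmeasurableB.
have bound k x : cabs (F k x - f x) `^ p <= 2 `^ p * u x `^ p.
  rewrite -powRM// ge0_ler_powR ?nnegrE ?cabs_ge0 ?mulr_ge0 ?(ltW p0)//.
  by rewrite (le_trans (ler_cabsB _ _))// mulr_natl mulr2n lerD.
have [||||_ _ cv] := @dominated_convergence _ _ _ mu setT measurableT
  (fun k x => (cabs (F k x - f x) `^ p)%:E) (cst 0%E) _ _ _ _ iu2.
- by move=> k; exact: measurable_cabs_powR.
- exact: measurable_cst.
- apply: filterS Ff => x h _; rewrite -[cst _ _]/(0%:E); apply: cvg_EFin; first exact: nearW.
  by apply: cvg_powR0 => // k; exact: cabs_ge0.
- by apply: aeW => x k _; rewrite gee0_abs ?lee_fin ?powR_ge0.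
rewrite integral_cst// mul0e in cv.
have cv' := fine_cvg cv.
under eq_fun do rewrite LpnormE fine_poweR.
apply: cvg_powR0 => //; first by rewrite invr_gt0.
  by move=> k; rewrite fine_ge0// integral_ge0// => x _; rewrite lee_fin powR_ge0.
exact: cv'.
Qed.

Lemma LpD p f g : 1 <= p -> Lp mu p%:E f -> Lp mu p%:E g -> Lp mu p%:E (fun x => f x + g x).
Proof.
move=> p1 [mf f1] [mg g1]; split; first exact: cmeasurableD.
by rewrite (le_lt_trans (Lpnorm_triangle p1 mf mg))// lte_add_pinfty.
Qed.

Lemma LpN (q : \bar R) f : Lp mu q f -> Lp mu q (fun x => - f x).
Proof.
move=> [mf f1]; split.
  by under [X in cmeasurable _ X]eq_fun do rewrite -mulN1r; apply: cmeasurableM => //; exact: cmeasurable_cst.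
rewrite (_ : Lpnorm mu q _ = Lpnorm mu q f)//.
by apply: eq_Lnorm => x /=; rewrite cabsN.
Qed.

Lemma LpB p f g : 1 <= p -> Lp mu p%:E f -> Lp mu p%:E g -> Lp mu p%:E (fun x => f x - g x).
Proof. by move=> p1 Lf Lg; apply: LpD => //; exact: LpN. Qed.

Lemma Lpnorm_bounded p f (M : R) (Q : set T) : 0 < p -> cmeasurable setT f ->
  measurable Q -> (mu Q < +oo)%E -> 0 <= M -> (forall x, cabs (f x) <= M) ->
  (forall x, ~ Q x -> f x = 0) ->
  Lp mu p%:E f /\ fine (Lpnorm mu p%:E f) <= M * (fine (mu Q)) `^ p^-1.
Proof.
move=> p0 mf mQ Qoo M0 fM fQ.
have Qf : mu Q = (fine (mu Q))%:E by rewrite fineK// ge0_fin_numE.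
have H : (Lpnorm mu p%:E f <= (M * (fine (mu Q)) `^ p^-1)%:E)%E.
  rewrite LpnormE.
  have -> : (M * fine (mu Q) `^ p^-1)%:E = ((M `^ p * fine (mu Q))%:E `^ p^-1)%E.
    rewrite poweR_EFin powRM ?powR_ge0 ?fine_ge0//.
    by rewrite -powRrM mulfV ?gt_eqF// powRr1.
  apply: gt0_ler_poweR; rewrite ?in_itv/= ?leey ?andbT//.
  - by rewrite invr_ge0 ltW.
  - by apply: integral_ge0 => x _; rewrite lee_fin powR_ge0.
  - by rewrite lee_fin mulr_ge0 ?powR_ge0 ?fine_ge0.
  apply: (@le_trans _ _ (\int[mu]_x (M `^ p * \1_Q x)%:E)%E).
    apply: ge0_le_integral => //.
    - by move=> x _; rewrite lee_fin powR_ge0.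
    - exact: measurable_cabs_powR.
    - by apply/measurable_EFinP; apply: measurable_funM => //; exact: measurable_indic.
    - move=> x _; rewrite lee_fin indicE; have [Qx|Qx] := boolP (x \in Q).
        by rewrite mulr1 ge0_ler_powR ?nnegrE ?cabs_ge0 ?(ltW p0).
      rewrite fQ; last by move: Qx; rewrite notin_setE.
      by rewrite cabs0 powR0 ?gt_eqF// mulr0.
  under eq_integral do rewrite EFinM.
  rewrite ge0_integralZl_EFin ?powR_ge0//; last first.
    by apply/measurable_EFinP; exact: measurable_indic.
  by rewrite integral_indic// setIT EFinM Qf.
split; first by split => //; rewrite (le_lt_trans H)// ltry.
by rewrite -lee_fin fineK// ge0_fin_numE ?Lpnorm_ge0// (le_lt_trans H)// ltry.
Qed.

End Lp_theory.

Lemma cvg_prod_fun (R : realType) (I : Type) (s : seq I) (u : I -> nat -> R) (a : I -> R) :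
  (forall i, u i k @[k --> \oo] --> a i) ->
  (\prod_(i <- s) u i k) @[k --> \oo] --> \prod_(i <- s) a i.
Proof.
move=> ua; elim: s => [|i s IH].
  by rewrite big_nil; under eq_fun do rewrite big_nil; exact: cvg_cst.
by rewrite big_cons; under eq_fun do rewrite big_cons; exact: cvgM.
Qed.

Section hybrid.
Context {A : Type} {m : nat}.
Implicit Types f g : 'I_m -> A.

(** For telescoping multilinear differences: [hybrid j] and [hybrid j.+1] differ only in slot
    [j]. *)
Definition hybrid j f g : 'I_m -> A := fun i => if (i < j)%N then g i else f i.

Lemma hybrid0 f g : hybrid 0 f g = f.
Proof. by []. Qed.

Lemma hybridm f g : hybrid m f g = g.
Proof. by apply/funext => i; rewrite /hybrid ltn_ord. Qed.

Lemma hybrid_at (j : 'I_m) f g : hybrid j f g j = f j.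
Proof. by rewrite /hybrid ltnn. Qed.

Lemma hybridS (j : 'I_m) f g : hybrid j.+1 f g = dfwith (hybrid j f g) j (g j).
Proof.
apply/funext => i; rewrite /hybrid ltnS leq_eqVlt.
case: dfwithP => [|k jk]; first by rewrite eqxx.
by rewrite -val_eqE/= in jk; rewrite eq_sym (negbTE jk).
Qed.

Lemma dfwith_all (P : 'I_m -> A -> Prop) f (j : 'I_m) (a : A) :
  (forall i, P i (f i)) -> P j a -> forall i, P i (dfwith f j a i : A).
Proof. by move=> Pf Pa i; case: dfwithP. Qed.

Lemma hybrid_all (P : 'I_m -> A -> Prop) j f g :
  (forall i, P i (f i)) -> (forall i, P i (g i)) -> forall i, P i (hybrid j f g i).
Proof. by move=> Pf Pg i; rewrite /hybrid; case: ifP. Qed.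

End hybrid.

Section weak_extension_theory.
Context {R : realType} {d : measure_display} {X : borelMetricType R d}.
Variable mu : {sigma_finite_measure set X -> \bar R}.
Context {m : nat}.
Variables (eta : R) (T : ('I_m -> X -> R[i]) -> (X -> R[i]) -> R[i]).
Implicit Types (S : ('I_m -> X -> R[i]) -> X -> R[i]) (p : 'I_m -> R) (s : R)
  (f g : 'I_m -> X -> R[i]).

Lemma weak_level p s S : 0 < s -> weak_extension mu eta T p s S ->
  exists2 C : R, 0 <= C & forall f, (forall i, Lp mu (p i)%:E (f i)) ->
  forall t, 0 < t -> (mu [set x | (t < cabs (S f x))%R] <=
    ((C * \prod_(i < m) fine (Lpnorm mu (p i)%:E (f i)) / t) `^ s)%:E)%E.
Proof.
move=> s0 [mS _ [C HC] _]; exists `|C| => // f Lf t t0.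
set P := \prod_(i < m) _; have P0 : 0 <= P by apply: prodr_ge0 => i _; exact: fine_Lpnorm_ge0.
set A := [set x | _]; pose B := `|C| * P / t.
have B0 : 0 <= B by rewrite divr_ge0 ?mulr_ge0// ltW.
have h : (t%:E * mu A `^ s^-1 <= (`|C| * P)%:E)%E.
  apply: (@le_trans _ _ (C * P)%:E); last by rewrite lee_fin ler_wpM2r// ler_norm.
  by apply: le_trans (HC f Lf); apply: ereal_sup_ubound; exists t.
have h2 : (mu A `^ s^-1 <= B%:E)%E.
  by rewrite -(@lee_pmul2l _ t%:E) ?lte_fin// -EFinM /B mulrC divfK ?gt_eqF.
rewrite -[leLHS]poweRe1// -(@mulVf _ s) ?gt_eqF// poweRrM -poweR_EFin.
by apply: gt0_ler_poweR; rewrite ?in_itv/= ?leey ?andbT ?lee_fin ?poweR_ge0 ?(ltW s0).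
Qed.

Section one_extension.
Variables (p : 'I_m -> R) (s : R) (S : ('I_m -> X -> R[i]) -> X -> R[i]).
Hypothesis s0 : 0 < s.
Hypothesis p1 : forall i, 1 <= p i.
Hypothesis HS : weak_extension mu eta T p s S.

Let p0 i : 0 < p i. Proof. exact: lt_le_trans (p1 i). Qed.
Let mS f : (forall i, Lp mu (p i)%:E (f i)) -> cmeasurable setT (S f).
Proof. by case: HS => + _ _ _; exact. Qed.

Lemma weak_extensionD f (i : 'I_m) (g : X -> R[i]) :
  (forall j, Lp mu (p j)%:E (f j)) -> Lp mu (p i)%:E g ->
  ae_equal mu (S (dfwith f i (fun x => f i x + g x)))
    (fun x => S f x + S (dfwith f i g) x).
Proof.
move=> Lf Lg; have [_ lin _ _] := HS; have := lin f i 1 g Lf Lg.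
rewrite (_ : (fun x => 1 * f i x + g x) = (fun x => f i x + g x)); last first.
  by apply/funext => x; rewrite mul1r.
by apply: filterS => x ->; rewrite mul1r.
Qed.

(** Telescoping over the slots: in the difference for slot [j], that slot carries [F k j - f j],
    whose norm tends to 0, while the norms in the other slots stay bounded. The weak bound then
    makes each of the [m] differences tend to 0 in measure. *)
Lemma weak_extension_cvg (F : nat -> 'I_m -> X -> R[i]) f :
  (forall i, Lp mu (p i)%:E (f i)) -> (forall k i, Lp mu (p i)%:E (F k i)) ->
  (forall i, fine (Lpnorm mu (p i)%:E (fun x => F k i x - f i x)) @[k --> \oo] --> (0 : R)) ->
  cvg_in_measure mu (fun k => S (F k)) (S f).
Proof.
move=> Lf LF Ff; have [C C0 level] := weak_level s0 HS.
pose N i (g : X -> R[i]) := fine (Lpnorm mu (p i)%:E g).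
pose e i k := N i (fun x => F k i x - f i x).
have e0 i k : 0 <= e i k by exact: fine_Lpnorm_ge0.
have LFf k i : Lp mu (p i)%:E (fun x => F k i x - f i x) by exact: LpB.
have NF i k : N i (F k i) <= N i (f i) + e i k.
  rewrite -lee_fin EFinD /N /e -!Lpnorm_fine//.
  rewrite (_ : F k i = fun x => f i x + (F k i x - f i x)); last first.
    by apply/funext => x; rewrite addrC subrK.
  rewrite (_ : (fun x => f i x + _ - _) = (fun x => F k i x - f i x)); last first.
    by apply/funext => x; rewrite [f i x + _]addrC subrK.
  apply: Lpnorm_triangle => //; first exact: (Lf i).1.
  exact: (LFf k i).1.
have step (j : 'I_m) : cvg_in_measure mu
    (fun k x => S (hybrid j.+1 f (F k)) x - S (hybrid j f (F k)) x) (cst 0).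
  move=> t t0.
  (* Bounds for the norms in the slots of the difference: the vanishing one in slot [j], elsewhere
     one valid for both [f i] and [F k i]. *)
  pose u i k := if i == j then e i k else N i (f i) + e i k.
  have uc : (C * (\prod_(i < m) u i k) / t) @[k --> \oo] --> (0 : R).
    rewrite -(mul0r t^-1); apply: cvgMl.
    rewrite -(mulr0 C); apply: cvgMr.
    pose a i := if i == j then 0 else N i (f i).
    rewrite (_ : 0 = \prod_(i < m) a i); last first.
      by rewrite (bigD1 j)//= {1}/a eqxx mul0r.
    apply: cvg_prod_fun => i; rewrite /u /a; case: eqP => _; first exact: Ff.
    by rewrite -[X in _ --> X]addr0; apply: cvgD; [exact: cvg_cst|exact: Ff].
  have u0 i k : 0 <= u i k.
    by rewrite /u; case: eqP => // _; rewrite addr_ge0//; exact: fine_Lpnorm_ge0.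
  have uc2 := cvg_powR0 s0 (fun k => divr_ge0 (mulr_ge0 C0 (prodr_ge0 _ (fun i _ => u0 i k))) (ltW t0)) uc.
  have Lh k i : Lp mu (p i)%:E (hybrid j f (F k) i).
    by move: i; exact: (@hybrid_all _ _ (fun i => Lp mu (p i)%:E)).
  have Lw k i : Lp mu (p i)%:E (dfwith (hybrid j f (F k)) j (fun x => F k j x - f j x) i).
    by move: i; apply: (@dfwith_all _ _ (fun i => Lp mu (p i)%:E)).
  have Lh' k i : Lp mu (p i)%:E (hybrid j.+1 f (F k) i).
    by move: i; exact: (@hybrid_all _ _ (fun i => Lp mu (p i)%:E)).
  apply: (@squeeze_cvge _ _ _ _ (cst 0%E) _ (fun k => ((C * \prod_(i < m) u i k / t) `^ s)%:E)).
  - apply: nearW => k; rewrite measure_ge0/=.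
    have E : ae_equal mu (fun x => S (hybrid j.+1 f (F k)) x - S (hybrid j f (F k)) x - 0)
        (S (dfwith (hybrid j f (F k)) j (fun x => F k j x - f j x))).
      have := weak_extensionD (i := j) (Lh k) (LFf k j).
      rewrite (_ : dfwith (hybrid j f (F k)) j (fun x => hybrid j f (F k) j x + _) =
        hybrid j.+1 f (F k)); last first.
        rewrite hybridS; congr dfwith; apply/funext => x.
        by rewrite hybrid_at addrC subrK.
      by apply: filterS => x ->; rewrite subr0 addrC addKr.
    have := ae_eq_level t _ (mS (Lw k)) measurableT E; rewrite !setTI => ->; last first.
      by apply: cmeasurableB; [apply: cmeasurableB; exact: mS|exact: cmeasurable_cst].
    apply: le_trans (level _ (Lw k) t t0) _; rewrite lee_fin ge0_ler_powR ?(ltW s0)//.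
    + by rewrite nnegrE divr_ge0 ?(ltW t0)// mulr_ge0// prodr_ge0// => i _; exact: fine_Lpnorm_ge0.
    + by rewrite nnegrE divr_ge0 ?(ltW t0)// mulr_ge0// prodr_ge0.
    + rewrite ler_wpM2r ?invr_ge0 ?(ltW t0)// ler_wpM2l// ler_prod// => i _.
      rewrite fine_Lpnorm_ge0/= /u; case: dfwithP => [|i' ji']; first by rewrite eqxx.
      rewrite eq_sym (negbTE ji') /hybrid; case: ifP => _; first exact: NF.
      by rewrite lerDl.
  - exact: cvg_cst.
  - by apply: cvg_EFin => //; exact: nearW.
have main j : (j <= m)%N -> cvg_in_measure mu (fun k => S (hybrid j f (F k))) (S f).
  elim: j => [_|j IH jm] t t0.
    rewrite (_ : (fun k => _) = cst 0%E); first exact: cvg_cst.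
    apply/funext => k; rewrite hybrid0 (_ : [set x | _] = set0) ?measure0//.
    by rewrite -subset0 => x /=; rewrite subrr cabs0 ltNge ltW.
  have t20 : 0 < t / 2 by rewrite divr_gt0.
  have h1 := IH (ltnW jm) _ t20; have h2 := step (Ordinal jm) _ t20.
  have h3 : (mu [set x | (t / 2 < cabs (S (hybrid j f (F k)) x - S f x))%R] +
    mu [set x | (t / 2 < cabs (S (hybrid j.+1 f (F k)) x - S (hybrid j f (F k)) x - 0))%R])%E
     @[k --> \oo] --> 0%E.
    by rewrite -[X in _ --> X]adde0; apply: cvgeD.
  have mh k j' : cmeasurable setT (S (hybrid j' f (F k))).
    by apply: mS; exact: (@hybrid_all _ _ (fun i => Lp mu (p i)%:E)).
  have mf := mS Lf.
  apply: (squeeze_cvge _ _ h3); last exact: cvg_cst.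
  apply: nearW => k; rewrite measure_ge0/=.
  have m1 : measurable [set x | t / 2 < cabs (S (hybrid j f (F k)) x - S f x)].
    by apply: measurable_cabs_gt; exact: cmeasurableB.
  have m2 : measurable [set x | t / 2 < cabs (S (hybrid j.+1 f (F k)) x - S (hybrid j f (F k)) x - 0)].
    apply: measurable_cabs_gt; apply: cmeasurableB; first exact: cmeasurableB.
    exact: cmeasurable_cst.
  apply: le_trans (measureU2 _ m1 m2).
  rewrite le_measure ?inE//; last first.
    move=> x /= Hx; apply: contrapT => /not_orP[/negP h4 /negP h5].
    move: Hx; apply/negP; rewrite -leNgt (splitr t).
    rewrite (le_trans (ler_cabs_dist (S (hybrid j f (F k)) x) _ _))// addrC lerD ?leNgt//.
    by rewrite -[X in cabs X]subr0.
  - exact: measurableU.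
  - by apply: measurable_cabs_gt; exact: cmeasurableB.
move=> t t0; have := main m (leqnn m) t t0.
by under eq_fun do rewrite hybridm.
Qed.

End one_extension.

End weak_extension_theory.

(** * Agreement of the weak extensions *)

Section agreement.
Context {R : realType} {d : measure_display} {X : borelMetricType R d}.
Variable mu : {sigma_finite_measure set X -> \bar R}.
Hypothesis mu_ball : forall (x : X) r, (mu (ball x r) < +oo)%E.
Hypothesis mu_infinite : mu setT = +oo%E.
Hypothesis mu_regular : regular_measure mu.
Variable eta : R.
Hypothesis eta01 : 0 < eta <= 1.
Context {m : nat}.
Variable T : ('I_m -> X -> R[i]) -> (X -> R[i]) -> R[i].
Variable x0 : X.

Definition trunc (k : R) (f : X -> R[i]) (x : X) : R[i] :=
  f x * ((\1_(ball x0 k) x * \1_([set y | cabs (f y) <= k]) x : R))%:C%C.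

Lemma trunc_in k f x : mdist x0 x < k -> cabs (f x) <= k -> trunc k f x = f x.
Proof.
move=> h1 h2; rewrite /trunc !indicE mem_set; last by rewrite in_ballE.
by rewrite mem_set// mulr1 mulr1.
Qed.

Lemma trunc_far k f x : k <= mdist x0 x -> trunc k f x = 0.
Proof.
by move=> h1; rewrite /trunc !indicE memNset ?mul0r ?mulr0// in_ballE ltNge h1.
Qed.

Lemma trunc_le k f x : cabs (trunc k f x) <= cabs (f x).
Proof.
rewrite /trunc cabsM cabs_real ler_piMr ?cabs_ge0// !indicE.
by case: (_ \in _); case: (_ \in _); rewrite ?mulr0 ?mulr1 ?normr0 ?normr1.
Qed.

Lemma trunc_bound k f x : 0 <= k -> cabs (trunc k f x) <= k.
Proof.
move=> k0; have [h|h] := leP (cabs (f x)) k; first by rewrite (le_trans (trunc_le _ _ _)).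
rewrite /trunc [X in _ * X%:C%C](_ : _ = 0) ?mulr0 ?cabs0//.
by rewrite [X in _ * X]indicE memNset ?mulr0//= leNgt h.
Qed.

Lemma trunc_cvg f x : ccvg (fun k : nat => trunc k%:R f x) (f x).
Proof.
apply: ccvg_eventually_cst.
pose N := (Num.truncn (Num.max (mdist x0 x) (cabs (f x)))).+1.
have : Num.max (mdist x0 x) (cabs (f x)) < N%:R by rewrite truncnS_gt.
rewrite gt_max => /andP[h1 h2]; exists N => // k /= Nk.
have Nk' : N%:R <= k%:R :> R by rewrite ler_nat.
by rewrite trunc_in// ?(lt_le_trans h1)// ltW// (lt_le_trans h2).
Qed.

Lemma cmeasurable_trunc k f : cmeasurable setT f -> cmeasurable setT (trunc k f).
Proof.
move=> mf; apply: cmeasurableM => //; apply: cmeasurable_real.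
apply: measurable_funM; apply: measurable_indic; first exact: measurable_ballX.
rewrite (_ : [set y | _] = ~` [set y | k < cabs (f y)]).
  by apply: measurableC; exact: measurable_cabs_gt.
by apply/seteqP; split => y /=; rewrite leNgt => /negP.
Qed.

(** Bounded functions of bounded support. They lie in [L^p] for all finite [p > 0], so that
    extensions with different exponents can be compared on them. *)
Definition bsf (f : X -> R[i]) := cmeasurable setT f /\
  exists M N : R, (forall x, cabs (f x) <= M) /\ (forall x, N <= mdist x0 x -> f x = 0).

Lemma bsf_trunc k f : 0 <= k -> cmeasurable setT f -> bsf (trunc k f).
Proof.
move=> k0 mf; split; first exact: cmeasurable_trunc.
exists k, k; split => x; first exact: trunc_bound.
exact: trunc_far.
Qed.

Lemma bsf_Lp p f : 0 < p -> bsf f -> Lp mu p%:E f.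
Proof.
move=> p0 [mf [M [N [fM fN]]]].
have M0 : 0 <= M by rewrite (le_trans _ (fM x0))// cabs_ge0.
have [] // := @Lpnorm_bounded _ _ _ mu p f M (ball x0 N) p0 mf (measurable_ballX _ _)
  (mu_ball _ _) M0 fM _.
by move=> x; rewrite in_ballE => /negP; rewrite -leNgt; exact: fN.
Qed.

Lemma integrable_cst_ball (p c N : R) : 0 < p ->
  mu.-integrable setT (EFin \o (fun x => (c * \1_(ball x0 N) x) `^ p)).
Proof.
move=> p0; have mB := measurable_ballX x0 N.
rewrite (_ : _ \o _ = (fun x => (c `^ p)%:E * (\1_(ball x0 N) x)%:E)%E).
  apply: integrableZl => //; apply/integrableP; split.
    by apply/measurable_EFinP; exact: measurable_indic.
  under eq_integral do rewrite /= ger0_norm//.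
  by rewrite integral_indic// setIT; exact: mu_ball.
apply/funext => x /=; rewrite -EFinM indicE; case: (_ \in _); rewrite ?mulr1//.
by rewrite !mulr0 powR0// gt_eqF.
Qed.

(** The supports given by [approx_clipb] may grow with [k]. The extra cutoff confines them to one
    ball, as dominated convergence in [L^p] requires. *)
Lemma approx_test f : bsf f -> exists (F : nat -> X -> R[i]) (M N : R),
  [/\ forall k, clipb x0 (F k), forall k x, cabs (F k x) <= M,
    forall x, cabs (f x) <= M,
    forall k x, N <= mdist x0 x -> F k x = 0 /\ f x = 0 &
    {ae mu, forall x, ccvg (F ^~ x) (f x)}].
Proof.
move=> [mf [M [N [fM fN]]]].
have M0 : 0 <= M by rewrite (le_trans _ (fM x0))// cabs_ge0.
have [F [Fl FM Ff]] := approx_clipb mu_ball mu_infinite mu_regular mf fM fN.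
have NN : N < N + 1 by rewrite ltrDl.
exists (fun k x => (cutoff x0 N (N + 1) x)%:C%C * F k x), (2 * M), (N + 1); split.
- by move=> k; apply: clipbM => //; exact: lipb_cutoff.
- move=> k x; rewrite cabsM (le_trans _ (FM k x))// ler_piMl ?cabs_ge0//.
  by rewrite cabs_real ger0_norm ?cutoff_ge0 ?cutoff_le1.
- by move=> x; rewrite (le_trans (fM x))// ler_peMl// ler1n.
- move=> k x xN; rewrite cutoff0// mul0r; split => //.
  by apply: fN; rewrite (le_trans _ xN)// ltW.
- apply: filterS Ff => x /(ccvgZ (cutoff x0 N (N + 1) x)%:C%C).
  have [xN|xN] := leP (mdist x0 x) N; first by rewrite cutoff1// mul1r.
  by rewrite fN ?mulr0// ltW.
Qed.

Lemma bsf_Lp_cvg (q : R) (F : nat -> X -> R[i]) f (M N : R) : 0 < q ->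
  (forall k, cmeasurable setT (F k)) -> cmeasurable setT f ->
  (forall k x, cabs (F k x) <= M) -> (forall x, cabs (f x) <= M) ->
  (forall k x, N <= mdist x0 x -> F k x = 0) -> (forall x, N <= mdist x0 x -> f x = 0) ->
  {ae mu, forall x, ccvg (F ^~ x) (f x)} ->
  fine (Lpnorm mu q%:E (fun x => F k x - f x)) @[k --> \oo] --> (0 : R).
Proof.
move=> q0 mF mf FM fM FN fN Ff.
apply: (@Lp_dominated _ _ _ mu q F f (fun x => M * \1_(ball x0 N) x)) => //.
- exact: integrable_cst_ball.
- move=> k x; rewrite indicE; have [xN|xN] := leP N (mdist x0 x).
    by rewrite FN// cabs0 memNset ?mulr0// in_ballE ltNge xN.
  by rewrite mem_set ?in_ballE// mulr1.
- move=> x; rewrite indicE; have [xN|xN] := leP N (mdist x0 x).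
    by rewrite fN// cabs0 memNset ?mulr0// in_ballE ltNge xN.
  by rewrite mem_set ?in_ballE// mulr1.
Qed.

Lemma clipb_bsf f : clipb x0 f -> bsf f.
Proof.
move=> fl; split; first exact: clipb_cmeasurable fl.
case: fl => [[_ [M [r [_ H2 H3]]]] [_ [M' [r' [_ H2' H3']]]]].
exists (M + M'), (Num.max r r'); split => x.
  by rewrite (le_trans (cabs_ler_ReIm _))// lerD.
by rewrite ge_max => /andP[/H3 h /H3' h']; exact: complex_eq.
Qed.

Section two_extensions.
Variables (p p' : 'I_m -> R) (s s' : R) (S S' : ('I_m -> X -> R[i]) -> X -> R[i]).
Hypotheses (s0 : 0 < s) (s'0 : 0 < s').
Hypotheses (p1 : forall i, 1 <= p i) (p'1 : forall i, 1 <= p' i).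
Hypothesis HS : weak_extension mu eta T p s S.
Hypothesis HS' : weak_extension mu eta T p' s' S'.

Let p0 i : 0 < p i. Proof. exact: lt_le_trans (p1 i). Qed.
Let p'0 i : 0 < p' i. Proof. exact: lt_le_trans (p'1 i). Qed.

(** On Lipschitz approximations of [f] both extensions represent the same distribution, hence agree
    almost everywhere; both are continuous in measure along these approximations. *)
Lemma extensions_agree_bsf (f : 'I_m -> X -> R[i]) : (forall i, bsf (f i)) ->
  ae_equal mu (S f) (S' f).
Proof.
move=> bf.
have /choice[Z HZ] : forall i, exists Z : (nat -> X -> R[i]) * R * R,
  [/\ forall k, clipb x0 (Z.1.1 k), forall k x, cabs (Z.1.1 k x) <= Z.1.2,
    forall x, cabs (f i x) <= Z.1.2,
    forall k x, Z.2 <= mdist x0 x -> Z.1.1 k x = 0 /\ f i x = 0 &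
    {ae mu, forall x, ccvg (Z.1.1 ^~ x) (f i x)}].
  by move=> i; have [F [M [N H]]] := approx_test (bf i); exists (F, M, N).
pose F k i := (Z i).1.1 k.
have bF k i : bsf (F k i) by apply: clipb_bsf; case: (HZ i) => + _ _ _ _; exact.
have cv (q : 'I_m -> R) : (forall i, 0 < q i) -> forall i,
    fine (Lpnorm mu (q i)%:E (fun x => F k i x - f i x)) @[k --> \oo] --> (0 : R).
  move=> q0 i; have [_ H2 H3 H4 H5] := HZ i.
  apply: (@bsf_Lp_cvg (q i) (fun k => F k i) (f i) (Z i).1.2 (Z i).2) => //.
  - by move=> k; have [] := bF k i.
  - by have [] := bf i.
  - by move=> k x /(H4 k) [].
  - by move=> x /(H4 0%N) [].
have mS f' : (forall i, bsf (f' i)) -> cmeasurable setT (S f').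
  by move=> bf'; case: HS => + _ _ _; apply => i; exact: bsf_Lp.
have mS' f' : (forall i, bsf (f' i)) -> cmeasurable setT (S' f').
  by move=> bf'; case: HS' => + _ _ _; apply => i; exact: bsf_Lp.
have c1 : cvg_in_measure mu (fun k => S (F k)) (S f).
  by apply: (weak_extension_cvg s0 p1 HS); [move=> i|move=> k i|exact: cv]; exact: bsf_Lp.
have c2 : cvg_in_measure mu (fun k => S' (F k)) (S' f).
  by apply: (weak_extension_cvg s'0 p'1 HS'); [move=> i|move=> k i|exact: cv]; exact: bsf_Lp.
have FF k : ae_equal mu (S (F k)) (S' (F k)).
  have CF i : Cb eta (F k i).
    by apply: (@clipb_Cb _ _ _ x0) => //; case: (HZ i) => + _ _ _ _; exact.
  case: HS => _ _ _ /(_ _ CF) r1; case: HS' => _ _ _ /(_ _ CF) r2.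
  exact: (representation_uniqueT mu_ball mu_infinite mu_regular eta01 r1 r2).
apply: (in_measure_unique (mS f bf) (mS' f bf) (fun k => mS' _ (bF k)) _ c2).
exact: (cvg_in_measure_ae_eq (fun k => mS _ (bF k)) (fun k => mS' _ (bF k)) (mS f bf) FF c1).
Qed.

Lemma trunc_cvg_measure (f : 'I_m -> X -> R[i]) : (forall i, Lp mu (p i)%:E (f i)) ->
  cvg_in_measure mu (fun k : nat => S (fun i => trunc k%:R (f i))) (S f).
Proof.
move=> Lf; apply: (weak_extension_cvg s0 p1 HS) => //.
  by move=> k i; apply: bsf_Lp => //; apply: bsf_trunc => //; case: (Lf i).
move=> i; apply: (@Lp_dominated _ _ _ mu (p i) (fun k : nat => trunc k%:R (f i)) (f i)
  (fun x => cabs (f i x))) => //.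
- by move=> k; apply: cmeasurable_trunc; case: (Lf i).
- by case: (Lf i).
- exact: Lp_integrable.
- by move=> k x; exact: trunc_le.
- by apply: aeW => x; exact: trunc_cvg.
Qed.

End two_extensions.

(** The truncations of [f] have bounded support and converge to [f] in both families of norms at
    once. *)
Lemma extensions_agree (p p' : 'I_m -> R) (s s' : R) S S' (f : 'I_m -> X -> R[i]) :
  0 < s -> 0 < s' -> (forall i, 1 <= p i) -> (forall i, 1 <= p' i) ->
  weak_extension mu eta T p s S -> weak_extension mu eta T p' s' S' ->
  (forall i, Lp mu (p i)%:E (f i)) -> (forall i, Lp mu (p' i)%:E (f i)) ->
  ae_equal mu (S f) (S' f).
Proof.
move=> s0 s'0 p1 p'1 HS HS' Lf Lf'.
have c1 := trunc_cvg_measure s0 p1 HS Lf; have c2 := trunc_cvg_measure s'0 p'1 HS' Lf'.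
have bf (k : nat) i : bsf (trunc k%:R (f i)) by apply: bsf_trunc => //; case: (Lf i).
have mS (k : nat) : cmeasurable setT (S (fun i => trunc k%:R (f i))).
  by case: HS => + _ _ _; apply => i; apply: bsf_Lp => //; exact: lt_le_trans (p1 i).
have mS' (k : nat) : cmeasurable setT (S' (fun i => trunc k%:R (f i))).
  by case: HS' => + _ _ _; apply => i; apply: bsf_Lp => //; exact: lt_le_trans (p'1 i).
have mSf : cmeasurable setT (S f) by case: HS => + _ _ _; exact.
have mSf' : cmeasurable setT (S' f) by case: HS' => + _ _ _; exact.
apply: (in_measure_unique mSf mSf' mS' _ c2).
apply: (cvg_in_measure_ae_eq mS mS' mSf _ c1) => k.
exact: (extensions_agree_bsf s0 s'0 p1 p'1 HS HS').
Qed.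

End agreement.

(** * Kernel representation *)

Section power_measure_theory.
Context {R : realType} {d : measure_display} {T : measurableType d}.
Variable mu : {sigma_finite_measure set T -> \bar R}.

Lemma measurable_cube n (A : 'I_n -> set T) : (forall i, measurable (A i)) ->
  measurable [set y : n.-tuple T | forall i, A i (tnth y i)].
Proof.
move=> mA; rewrite (_ : [set y | _] = \bigcap_(i in [set: 'I_n]) ((fun y => tnth y i) @^-1` A i)).
  apply: fin_bigcap_measurable => // i _.
  by rewrite -[X in measurable X]setTI; exact: measurable_tnth.
by apply/seteqP; split => y /= h i; [move=> _|]; exact: h.
Qed.

Lemma power_measure_cube n (A : set T) (v : R) : measurable A -> mu A = v%:E ->
  power_measure mu n [set y : n.-tuple T | forall i, A (tnth y i)] = (v ^+ n)%:E.
Proof.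
move=> mA Av; elim: n => [|n IH].
  rewrite expr0 /= diracE mem_set//=.
  by move=> [].
rewrite /= /cons_measure /pushforward.
rewrite (_ : _ @^-1` _ = A `*` [set y : n.-tuple T | forall i, A (tnth y i)]); last first.
  apply/seteqP; split => [[x y] /= h|[x y] /= [Ax Ay] i].
    split; first by have := h ord0; rewrite tnth0.
    by move=> i; have := h (lift ord0 i); rewrite tnthS.
  by case: (unliftP ord0 i) => [j ->|->]; rewrite ?tnth0 ?tnthS.
rewrite product_measure1E//; last exact: (@measurable_cube n (fun=> A)).
by rewrite [X in (_ * X)%E]IH [X in (X * _)%E]Av exprS.
Qed.

Lemma power_measure_null n (N : set T) (i : 'I_n) : measurable N -> mu N = 0%E ->
  power_measure mu n [set y : n.-tuple T | N (tnth y i)] = 0%E.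
Proof.
move=> mN N0; elim: n i => [[//]|n IH] i.
rewrite /= /cons_measure /pushforward.
have mNi j : measurable [set y : n.-tuple T | N (tnth y j)].
  by rewrite -[X in measurable X]setTI; exact: measurable_tnth.
case: (unliftP ord0 i) => [j ->|->]; last first.
  rewrite (_ : _ @^-1` _ = N `*` setT); last first.
    by apply/seteqP; split => [[x y]|[x y]] /=; rewrite tnth0 => // -[].
  by rewrite product_measure1E// [X in (X * _)%E]N0 mul0e.
rewrite (_ : _ @^-1` _ = setT `*` [set y : n.-tuple T | N (tnth y j)]); last first.
  by apply/seteqP; split => [[x y]|[x y]] /=; rewrite tnthS => // -[].
by rewrite product_measure1E// [X in (_ * X)%E]IH mule0.
Qed.

Lemma power_measure_ae n (P : 'I_n -> T -> Prop) :
  (forall i, {ae mu, forall x, P i x}) ->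
  {ae power_measure mu n, forall y : n.-tuple T, forall i, P i (tnth y i)}.
Proof.
move=> aeP; apply: filter_forall => i; have [N [mN N0 PN]] := aeP i.
exists [set y | N (tnth y i)]; split.
- by rewrite -[X in measurable X]setTI; exact: measurable_tnth.
- exact: power_measure_null.
- by move=> y /= nP; apply: PN.
Qed.

Lemma cmeasurable_tnth n (f : T -> R[i]) (i : 'I_n) : cmeasurable setT f ->
  cmeasurable setT (fun y : n.-tuple T => f (tnth y i)).
Proof.
by move=> [f1 f2]; split; [apply: (measurableT_comp f1)|apply: (measurableT_comp f2)]; exact: measurable_tnth.
Qed.

End power_measure_theory.

Section integral_monotone.
Context {R : realType} {d : measure_display} {T : measurableType d}.
Variable mu : {measure set T -> \bar R}.

(* No measurability: the integral of a nonnegative function is the supremum of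
   the integrals of the simple functions below it. *)
Lemma ge0_le_integral_nomeas (D : set T) (f g : T -> \bar R) :
  (forall x, D x -> 0 <= f x)%E -> (forall x, D x -> f x <= g x)%E ->
  (\int[mu]_(x in D) f x <= \int[mu]_(x in D) g x)%E.
Proof.
move=> f0 fg.
have g0 x : D x -> (0 <= g x)%E by move=> Dx; exact: le_trans (f0 x Dx) (fg x Dx).
rewrite !ge0_integralE//; apply: le_ereal_sup => _ [h /= hf <-].
exists h => //= x; apply: le_trans (hf x) _.
rewrite /patch; case: ifPn => //; rewrite inE; exact: fg.
Qed.

End integral_monotone.

Lemma represented_onS {R : realType} {d : measure_display} {X : borelMetricType R d}
    (mu : {measure set X -> \bar R}) eta (U V : set X) L g :
  U `<=` V -> represented_on mu eta V L g -> represented_on mu eta U L g.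
Proof. by move=> UV Lg phi Cphi sphi; apply: Lg => //; exact: subset_trans UV. Qed.

Section kernel_representation.
Context {R : realType} {d : measure_display} {X : borelMetricType R d}.
Variable mu : {sigma_finite_measure set X -> \bar R}.
Hypothesis mu_ball : forall (x : X) r, (mu (ball x r) < +oo)%E.
Hypothesis mu_infinite : mu setT = +oo%E.
Hypothesis mu_regular : regular_measure mu.
Variable eta : R.
Hypothesis eta01 : 0 < eta <= 1.
Context {m : nat}.
Variable T : ('I_m -> X -> R[i]) -> (X -> R[i]) -> R[i].
Variable K : m.+1.-tuple X -> R[i].
Hypothesis TK : has_kernel mu eta T K.
Variable x0 : X.
Variables (p : 'I_m -> R) (s : R) (S : ('I_m -> X -> R[i]) -> X -> R[i]).
Hypothesis s0 : 0 < s.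
Hypothesis p1 : forall i, 1 <= p i.
Hypothesis HS : weak_extension mu eta T p s S.

Let p0 i : 0 < p i. Proof. exact: lt_le_trans (p1 i). Qed.

Local Notation mum := (power_measure mu m).

Let supp_far (x1 : X) (b1 b2 : R) (phi : X -> R[i]) : b1 < b2 ->
  supp (fun y => ((1 - cutoff x1 b1 b2 y)%:C%C * phi y)) `<=` [set y | b1 <= mdist x1 y].
Proof.
move=> b12.
have E : [set y | b1 <= mdist x1 y] = ~` ball x1 b1.
  by apply/seteqP; split => y /=; rewrite in_ballE leNgt => /negP.
have cl : closed [set y | b1 <= mdist x1 y].
  by rewrite E; apply: open_closedC; exact: ball_openX.
rewrite /supp [X in _ `<=` X](closure_id _).1//; apply: closure_subset => y /= h.
rewrite leNgt; apply/negP => yb; move/eqP: h; apply.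
by rewrite cutoff1 ?subrr ?mul0r// ltW.
Qed.

(** [has_kernel] speaks of Hölder functions only. Here [f] is replaced by test functions [Phi k]
    whose slot [j] still vanishes near [ball x1 a]. The values [S (Phi k)] tend to [S f] in measure,
    the kernel integrals converge by dominated convergence, and the two limits are identified. *)
Lemma kernel_representation_far (f : 'I_m -> X -> R[i]) (j : 'I_m) (x1 : X) (a c : R) :
  a < c -> (forall i, bsf x0 (f i)) -> (forall y, mdist x1 y < c -> f j y = 0) ->
  {ae mu, forall x, ball x1 a x -> cintegrable mum setT (kernel_integrand K f x) /\
    S f x = cintegral mum setT (kernel_integrand K f x)}.
Proof.
move=> ac bf fj.
pose b1 := (a + c) / 2; have ab1 : a < b1 by rewrite midf_lt.
have b1c : b1 < c by rewrite midf_lt.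
have /choice[Z HZ] : forall i, exists Z : (nat -> X -> R[i]) * R * R,
  [/\ forall k, clipb x0 (Z.1.1 k), forall k x, cabs (Z.1.1 k x) <= Z.1.2,
    forall x, cabs (f i x) <= Z.1.2,
    forall k x, Z.2 <= mdist x0 x -> Z.1.1 k x = 0 /\ f i x = 0 &
    {ae mu, forall x, ccvg (Z.1.1 ^~ x) (f i x)}].
  by move=> i; have [F [M [N H]]] := approx_test mu_ball mu_infinite mu_regular (bf i); exists (F, M, N).
pose c0 i := cutoff x0 (Z i).2 ((Z i).2 + 1).
have c0l i : lipb x0 (c0 i) by apply: lipb_cutoff; rewrite ltrDl.
pose c1 := cutoff x1 b1 c.
have c1l : lipb x0 c1 by exact: lipb_cutoff.
(* In slot [j] the cutoff also vanishes on [ball x1 b1], which keeps [ball x1 a] off its support. In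
   all slots [chi i * f i = f i]. *)
pose chi (i : 'I_m) (y : X) : R := if i == j then (1 - c1 y) * c0 i y else c0 i y.
have chil i : lipb x0 (chi i).
  rewrite /chi; case: eqP => _ //.
  rewrite (_ : (fun y => _) = (c0 i \+ (fun y => -1 * (c1 \* c0 i) y))).
    by apply: lipbD => //; apply: lipbZ; exact: lipbM.
  by apply/funext => y /=; ring.
have chi1 i y : 0 <= chi i y <= 1.
  have h0 : 0 <= c0 i y <= 1 by rewrite cutoff_ge0 cutoff_le1.
  have h1 : 0 <= c1 y <= 1 by rewrite cutoff_ge0 cutoff_le1.
  rewrite /chi; case: eqP => _ //; case/andP: h0 => ? ?; case/andP: h1 => ? ?.
  by apply/andP; split; nra.
have chif i y : (chi i y)%:C%C * f i y = f i y.
  have h : (c0 i y)%:C%C * f i y = f i y.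
    have [yN|yN] := leP (mdist x0 y) (Z i).2; first by rewrite /c0 cutoff1 ?mul1r// ltrDl.
    have [_ _ _ /(_ 0%N y (ltW yN)) [_ ->] _] := HZ i; by rewrite mulr0.
  rewrite /chi; case: eqP => [ij|_] //; rewrite rmorphM /= -mulrA h.
  have [yc|yc] := ltP (mdist x1 y) c; first by rewrite ij fj// mulr0.
  by rewrite /c1 cutoff0// subr0 mul1r.
pose Chi i (y : X) : R[i] := (chi i y)%:C%C.
pose F k i := (Z i).1.1 k.
pose Phi k i := fun y => Chi i y * F k i y.
have Fl k i : clipb x0 (F k i) by case: (HZ i) => + _ _ _ _; exact.
have Phil k i : clipb x0 (Phi k i) by exact: clipbM.
have CChi i : Cb eta (Chi i) by apply: (clipb_Cb eta01); exact: clipb_real (chil i).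
have CPhi k i : Cb eta (Phi k i) by exact: (clipb_Cb eta01).
have bPhi k i : bsf x0 (Phi k i) by exact: clipb_bsf.
have FM k i y : cabs (F k i y) <= (Z i).1.2 by case: (HZ i) => _ + _ _ _; exact.
have Phi_cvg i : {ae mu, forall y, ccvg (fun k => Phi k i y) (f i y)}.
  have [_ _ _ _] := HZ i; apply: filterS => y /(ccvgZ (Chi i y)).
  by rewrite /Chi chif.
have far (h : 'I_m -> X -> R[i]) (u : X -> R[i]) : h j = (fun y => (1 - c1 y)%:C%C * u y) ->
    ball x1 b1 `<=` ~` \bigcap_(i in [set: 'I_m]) supp (h i).
  move=> hj x; rewrite in_ballE => xb /(_ j I); rewrite hj => /(supp_far b1c) /=.
  by rewrite leNgt xb.
have farChi : ball x1 b1 `<=` ~` \bigcap_(i in [set: 'I_m]) supp (Chi i).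
  apply: (far _ (fun y => (c0 j y)%:C%C)); apply/funext => y.
  by rewrite /Chi /chi eqxx rmorphM.
have farPhi k : ball x1 b1 `<=` ~` \bigcap_(i in [set: 'I_m]) supp (Phi k i).
  apply: (far _ (fun y => (c0 j y)%:C%C * F k j y)); apply/funext => y.
  by rewrite /Phi /Chi /chi eqxx rmorphM mulrA.
(* The cutoffs are test functions themselves; up to the factor [M], their integrable kernel
   integrand dominates those of all [Phi k]. *)
have intChi : {ae mu, forall x, ball x1 a x -> cintegrable mum setT (kernel_integrand K Chi x)}.
  have [h _] := TK CChi; apply: filterS h => x h xa; apply: h; apply: farChi.
  by move: xa; rewrite !in_ballE => /lt_trans; apply.
have repPhi : {ae mu, forall x, forall k, ball x1 a x ->
    S (Phi k) x = cintegral mum setT (kernel_integrand K (Phi k) x)}.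
  apply: ae_foralln => k; have [_ h] := TK (CPhi k).
  apply: (representation_unique mu_ball mu_infinite mu_regular eta01 ab1 (farPhi k) _ h).
  by apply: represented_onS (subsetT _) _; case: HS => _ _ _; apply.
have mF k : cmeasurable setT (fun y : m.-tuple X => \prod_(i < m) F k i (tnth y i)).
  by apply: cmeasurable_prod => i; apply: cmeasurable_tnth; exact: clipb_cmeasurable (Fl k i).
have mf : cmeasurable setT (fun y : m.-tuple X => \prod_(i < m) f i (tnth y i)).
  by apply: cmeasurable_prod => i; apply: cmeasurable_tnth; case: (bf i).
have F_cvg : {ae mum, forall y : m.-tuple X, forall i, ccvg (fun k => Phi k i (tnth y i)) (f i (tnth y i))}.
  exact: power_measure_ae Phi_cvg.
pose M := \prod_(i < m) (Z i).1.2.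
have kPhi k x y : kernel_integrand K (Phi k) x y =
    kernel_integrand K Chi x y * \prod_(i < m) F k i (tnth y i).
  by rewrite /kernel_integrand -mulrA -big_split.
have kf x y : kernel_integrand K f x y =
    kernel_integrand K Chi x y * \prod_(i < m) f i (tnth y i).
  rewrite /kernel_integrand -mulrA -big_split/=; congr (_ * _).
  by apply: eq_bigr => i _; rewrite /Chi chif.
have lim : {ae mu, forall x, ball x1 a x -> cintegrable mum setT (kernel_integrand K f x) /\
    ccvg (fun k => S (Phi k) x) (cintegral mum setT (kernel_integrand K f x))}.
  apply: filterS2 intChi repPhi => x ix rx xa; have {}ix := ix xa.
  have mChi := cintegrable_cmeasurable ix.
  have iu : mum.-integrable setT (EFin \o (fun y => M * cabs (kernel_integrand K Chi x y))).
    exact: (integrableZl measurableT M (integrable_cabs measurableT ix)).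
  have [||||i1 c1'] := @complex_dominated_convergence _ _ _ mum
    (fun k => kernel_integrand K (Phi k) x) (kernel_integrand K f x)
    (fun y => M * cabs (kernel_integrand K Chi x y)) _ _ iu.
  - move=> k; rewrite (_ : kernel_integrand K (Phi k) x = fun y => kernel_integrand K Chi x y * \prod_(i < m) F k i (tnth y i)).
      exact: cmeasurableM.
    by apply/funext => y; exact: kPhi.
  - rewrite (_ : kernel_integrand K f x = fun y => kernel_integrand K Chi x y * \prod_(i < m) f i (tnth y i)).
      exact: cmeasurableM.
    by apply/funext => y; exact: kf.
  - move=> k y; rewrite kPhi cabsM mulrC ler_wpM2r ?cabs_ge0// cabs_prod ler_prod// => i _.
    by rewrite cabs_ge0 FM.
  - apply: filterS F_cvg => y yc; apply: ccvgZ.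
    exact: ccvg_prod.
  split => //; move: c1'; congr ccvg; apply/funext => k.
  by rewrite rx.
have Sc : cvg_in_measure mu (fun k => S (Phi k)) (S f).
  apply: (weak_extension_cvg s0 p1 HS) => [i|k i|i].
  - exact: bsf_Lp.
  - exact: (bsf_Lp mu_ball).
  - have [_ H2 H3 H4 _] := HZ i.
    apply: (@bsf_Lp_cvg _ _ _ mu mu_ball x0 (p i) (fun k => Phi k i) (f i) (Z i).1.2 (Z i).2) => //.
    + by move=> k; exact: clipb_cmeasurable (Phil k i).
    + by case: (bf i).
    + move=> k y; rewrite /Phi cabsM (le_trans _ (FM k i y))// ler_piMl ?cabs_ge0//.
      by rewrite /Chi cabs_real; case/andP: (chi1 i y) => h0 h1; rewrite ger0_norm.
    + by move=> k y /(H4 k) [h _]; rewrite /Phi /F h mulr0.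
    + by move=> y /(H4 0%N) [].
have mS (h : 'I_m -> X -> R[i]) : (forall i, bsf x0 (h i)) -> cmeasurable setT (S h).
  by move=> bh; case: HS => + _ _ _; apply => i; exact: bsf_Lp.
have lim2 : {ae mu, forall x, ball x1 a x ->
    ccvg (fun k => S (Phi k) x) (cintegral mum setT (kernel_integrand K f x))}.
  by apply: filterS lim => x h /h [].
have U := in_measure_ae_unique (mS f bf) (fun k => mS _ (bPhi k)) Sc lim2.
by apply: filterS2 U lim => x h1 h2 xa; split; [case: (h2 xa)|exact: h1].
Qed.

Lemma bsfM f g (M : R) : bsf x0 f -> cmeasurable setT g -> (forall x, cabs (g x) <= M) ->
  bsf x0 (fun x : X => f x * g x).
Proof.
move=> [mf [M' [N [H1 H2]]]] mg gM; split; first exact: cmeasurableM.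
exists (M' * M), N; split => x; last by move/H2 => ->; rewrite mul0r.
by rewrite cabsM ler_pM ?cabs_ge0.
Qed.

Definition crestrict (Q : set X) (f : X -> R[i]) (x : X) : R[i] := f x * (\1_Q x : R)%:C%C.

Lemma crestrict_in Q f x : Q x -> crestrict Q f x = f x.
Proof. by move=> Qx; rewrite /crestrict indicE mem_set// mulr1. Qed.

Lemma crestrict_out Q f x : ~ Q x -> crestrict Q f x = 0.
Proof. by move=> Qx; rewrite /crestrict indicE memNset// mulr0. Qed.

Lemma cabs_crestrict_le Q f x : cabs (crestrict Q f x) <= cabs (f x).
Proof.
have [Qx|Qx] := pselect (Q x); first by rewrite crestrict_in.
by rewrite crestrict_out// cabs0 cabs_ge0.
Qed.

Lemma bsf_crestrict Q f : measurable Q -> bsf x0 f -> bsf x0 (crestrict Q f).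
Proof.
move=> mQ bf; apply: (@bsfM _ _ 1) => //; first exact: cmeasurable_indic.
by move=> x; rewrite cabs_real indicE; case: (_ \in _); rewrite ?normr1 ?normr0.
Qed.

(** Passing from [g] to [gQ] one slot at a time, each difference has a slot [gC j] that vanishes on
    [ball x1 c], so [kernel_representation_far] applies to it. Only the sum of these terms is a
    kernel integral; [S g] and [S gQ] separately need not be. *)
Lemma kernel_representation (g : 'I_m -> X -> R[i]) (x1 : X) (a c : R) : a < c ->
  (forall i, bsf x0 (g i)) ->
  let gQ i := crestrict (ball x1 c) (g i) in
  let G (y : m.-tuple X) := \prod_(i < m) g i (tnth y i) - \prod_(i < m) gQ i (tnth y i) in
  {ae mu, forall x, ball x1 a x ->
    cintegrable mum setT (fun y => K [tuple of x :: y] * G y) /\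
    S g x - S gQ x = cintegral mum setT (fun y => K [tuple of x :: y] * G y)}.
Proof.
move=> ac bg gQ G.
have mQ : measurable (ball x1 c) by exact: measurable_ballX.
have bgQ i : bsf x0 (gQ i) by exact: bsf_crestrict.
pose gC i := crestrict (~` ball x1 c) (g i).
have bgC i : bsf x0 (gC i) by apply: bsf_crestrict => //; exact: measurableC.
have gE i x : gQ i x + gC i x = g i x.
  have [Qx|Qx] := pselect (ball x1 c x).
    by rewrite /gQ /gC crestrict_in// crestrict_out ?addr0//; exact.
  by rewrite /gQ /gC crestrict_out// crestrict_in ?add0r.
pose h k := hybrid k g gQ.
have bh k i : bsf x0 (h k i) by exact: (@hybrid_all _ _ (fun i => bsf x0)).
suff main k : (k <= m)%N -> {ae mu, forall x, ball x1 a x ->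
    cintegrable mum setT (fun y => K [tuple of x :: y] *
      (\prod_(i < m) g i (tnth y i) - \prod_(i < m) h k i (tnth y i))) /\
    S g x - S (h k) x = cintegral mum setT (fun y => K [tuple of x :: y] *
      (\prod_(i < m) g i (tnth y i) - \prod_(i < m) h k i (tnth y i)))}.
  by have := main m (leqnn m); rewrite /h hybridm.
elim: k => [_|k IH km].
  apply: aeW => x _; rewrite subrr.
  rewrite (_ : (fun y => _) = cst 0); last by apply/funext => y; rewrite subrr mulr0.
  split; first by split; exact: integrable0.
  by apply: complex_eq => /=; rewrite Rintegral_cst// mul0r.
pose j := Ordinal km; pose w := h k.+1.
pose u := dfwith w j (gC j).
have wj : w j = gQ j by rewrite /w /h /hybrid ltnSn.
have hkE : h k = dfwith w j (fun x => w j x + gC j x).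
  rewrite wj /w /h (hybridS j); apply/funext => i.
  have [<-|ij] := eqVneq j i; last by rewrite !dfwithout.
  by rewrite dfwithin /hybrid ltnn; apply/funext => x; rewrite gE.
have bu i : bsf x0 (u i) by apply: (@dfwith_all _ _ (fun i => bsf x0)) => // i'; exact: bh.
have lin := weak_extensionD HS (f := w) (i := j) (g := gC j)
  (fun i => bsf_Lp mu_ball (p0 i) (bh _ _)) (bsf_Lp mu_ball (p0 j) (bgC j)).
rewrite -hkE in lin.
have uj y : mdist x1 y < c -> u j y = 0.
  by move=> yc; rewrite /u dfwithin /gC crestrict_out//; apply; rewrite in_ballE.
have far := kernel_representation_far ac bu uj.
apply: filterS3 lin far (IH (ltnW km)) => x Slin h2 h3 xa.
have [i1 e1] := h2 xa; have [i2 e2] := h3 xa.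
have E (y : m.-tuple X) : K [tuple of x :: y] * (\prod_(i < m) g i (tnth y i) - \prod_(i < m) h k.+1 i (tnth y i)) =
    K [tuple of x :: y] * (\prod_(i < m) g i (tnth y i) - \prod_(i < m) h k i (tnth y i)) +
    kernel_integrand K u x y.
  rewrite /kernel_integrand -mulrDr; congr (_ * _); rewrite hkE -/w.
  have -> : \prod_(i < m) dfwith w j (fun x => w j x + gC j x) i (tnth y i) =
      \prod_(i < m) w i (tnth y i) + \prod_(i < m) u i (tnth y i).
    rewrite (bigD1 j)//= [X in _ = X + _](bigD1 j)//= [X in _ = _ + X](bigD1 j)//=.
    rewrite /u !dfwithin mulrDl; congr (_ * _ + _ * _).
      by apply: eq_bigr => i ij; rewrite dfwithout// eq_sym.
    by apply: eq_bigr => i ij; rewrite !dfwithout// eq_sym.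
  by ring.
under [X in cintegrable _ _ X]eq_fun do rewrite E.
under [X in _ = cintegral _ _ X]eq_fun do rewrite E.
split; first exact: cintegrableD.
rewrite cintegralD// -e2 -e1 Slin; ring.
Qed.

End kernel_representation.

(** * Volumes and annuli *)

Section RD_volume.
Context {R : realType} {d : measure_display} {X : borelMetricType R d}.
Variable mu : {measure set X -> \bar R}.
Variables C1 C2 C3 kappa n : R.
Hypothesis HRD : RD_space mu C1 C2 C3 kappa n.

Definition vol (x : X) (r : R) : R := fine (mu (ball x r)).

Lemma RD_ball_lty (x : X) r : (mu (ball x r) < +oo)%E.
Proof.
have [r0|r0] := leP r 0; last by have /andP[] := RD_ball HRD x r0.
rewrite (_ : ball x r = set0) ?measure0//.
rewrite -subset0 => y; rewrite in_ballE => xy.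
by move: (le_lt_trans (mdist_ge0 x y) xy); rewrite ltNge r0.
Qed.

Lemma muE (x : X) r : mu (ball x r) = (vol x r)%:E.
Proof. by rewrite /vol fineK// ge0_fin_numE// RD_ball_lty. Qed.

Lemma vol_gt0 (x : X) r : 0 < r -> 0 < vol x r.
Proof. by move=> r0; have /andP[] := RD_ball HRD x r0; rewrite muE lte_fin. Qed.

Lemma vol_ge0 (x : X) r : 0 <= vol x r.
Proof. by rewrite /vol fine_ge0. Qed.

Lemma vol_le (x x' : X) r r' : ball x r `<=` ball x' r' -> vol x r <= vol x' r'.
Proof.
by move=> h; rewrite -lee_fin -!muE le_measure ?inE//; exact: measurable_ballX.
Qed.

Lemma ball_sub (x x' : X) (r r' : R) : mdist x' x + r <= r' -> ball x r `<=` ball x' r'.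
Proof.
by move=> h y; rewrite !in_ballE => xy; have := metric_triangle x' x y; lra.
Qed.

Lemma vol_mono (x : X) r r' : r <= r' -> vol x r <= vol x r'.
Proof. by move=> h; apply: vol_le; apply: ball_sub; rewrite mdistxx add0r. Qed.

Lemma vol_doubling (x : X) r : 0 < r -> vol x (2 * r) <= C1 * vol x r.
Proof. by move=> r0; have := RD_doubling HRD x r0; rewrite !muE -EFinM lee_fin. Qed.

Lemma vol_up (x : X) r lam : 0 < r -> 1 <= lam -> vol x (lam * r) <= C3 * lam `^ n * vol x r.
Proof.
by move=> r0 l1; have [_] := RD_growth HRD x r0 l1; rewrite !muE -EFinM lee_fin.
Qed.

Lemma vol_down (x : X) r lam : 0 < r -> 1 <= lam -> C2 * lam `^ kappa * vol x r <= vol x (lam * r).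
Proof.
by move=> r0 l1; have [+ _] := RD_growth HRD x r0 l1; rewrite !muE -EFinM lee_fin.
Qed.

Lemma doubling_gt0 (x : X) : 0 < C1.
Proof.
have h := vol_doubling x ltr01; have v1 := vol_gt0 x ltr01.
have v20 : 0 < vol x (2 * 1) by apply: vol_gt0; rewrite mulr1.
by rewrite -(pmulr_lgt0 _ v1) (lt_le_trans v20).
Qed.

Lemma RD_n_gt0 : 0 < n.
Proof. exact: lt_le_trans (RD_kappa HRD) (RD_n HRD). Qed.
Lemma RD_C2_gt0 : 0 < C2. Proof. by have /andP[] := RD_C2 HRD. Qed.
Lemma RD_C3_gt0 : 0 < C3. Proof. exact: lt_le_trans (RD_C3 HRD). Qed.

(* The comparability of all the unit balls is all that is used of [psi]. *)
Lemma vol1_bounds : exists v w : R, [/\ 0 < v, 0 < w & forall x : X, v <= vol x 1 <= w].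
Proof.
have [psi [_ _ psi0 [c c0 H]]] := RD_psi HRD.
exists (c^-1 * psi 1), (c * psi 1); split.
- by rewrite mulr_gt0 ?invr_gt0// psi0.
- by rewrite mulr_gt0// psi0.
- by move=> x; have [] := H x 1 ltr01; rewrite muE !lee_fin => -> ->.
Qed.

Lemma vol_bounds : exists v w : R, [/\ 0 < v, 0 < w &
  [/\ forall (x : X) D, 1 <= D -> vol x D <= w * D `^ n,
      forall (x : X) D, 0 < D -> D <= 1 -> vol x D <= w * D `^ kappa &
      forall (x : X) D, 0 < D -> D <= 1 -> v * D `^ n <= vol x D]].
Proof.
have [v [w [v0 w0 vw]]] := vol1_bounds.
have C20 := RD_C2_gt0; have C30 := RD_C3_gt0.
pose W := Num.max C3 C2^-1.
have W3 : C3 <= W by rewrite le_max lexx.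
have W2 : C2^-1 <= W by rewrite le_max lexx orbT.
have W0 : 0 < W by exact: lt_le_trans W3.
have inv_pow (D q : R) : 0 < D -> (D^-1) `^ q = (D `^ q)^-1.
  by move=> D0; rewrite -[D^-1]powR_inv1 ?ltW// -powRrM mulN1r powRN.
exists (v / C3), (w * W); split; [by rewrite divr_gt0|by rewrite mulr_gt0|].
split => x D.
- move=> D1; have := vol_up x ltr01 D1; rewrite mulr1 => /le_trans; apply.
  have /andP[_ h] := vw x.
  rewrite (_ : w * W * D `^ n = (W * D `^ n) * w); last by ring.
  by rewrite ler_pM ?vol_ge0 ?mulr_ge0 ?powR_ge0 ?(ltW C30)// ler_wpM2r ?powR_ge0.
- move=> D0 D1; have iD1 : 1 <= D^-1 by rewrite invf_ge1.
  have := vol_down x D0 iD1; rewrite mulVf ?gt_eqF// => h.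
  have /andP[_ h1] := vw x; have {}h := le_trans h h1.
  have Dk : 0 < D `^ kappa by rewrite powR_gt0.
  rewrite inv_pow// in h.
  have -> : vol x D = (C2 * (D `^ kappa)^-1 * vol x D) * (C2^-1 * D `^ kappa).
    by field; rewrite !gt_eqF.
  rewrite -(mulrA w) ler_pM ?mulr_ge0 ?vol_ge0 ?invr_ge0 ?(ltW Dk) ?(ltW C20)//.
  by rewrite ler_wpM2r// ltW.
- move=> D0 D1; have iD1 : 1 <= D^-1 by rewrite invf_ge1.
  have := vol_up x D0 iD1; rewrite mulVf ?gt_eqF// inv_pow// => h.
  have /andP[h1 _] := vw x; have {}h := le_trans h1 h.
  have Dn : 0 < D `^ n by rewrite powR_gt0.
  by rewrite mulrAC ler_pdivrMr// -ler_pdivlMr// (le_trans h)// mulrC mulrA.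
Qed.

End RD_volume.

Section rho_theory.
Context {R : realType} {d : measure_display} {X : borelMetricType R d} {m : nat}.
Implicit Types (y : m.-tuple X) (x : X).

Lemma mdist_le_rho y x (i : 'I_m) : mdist (tnth y i) x <= rho y x.
Proof. by rewrite /rho; exact: (@le_bigmax _ _ _ 0 (fun i => mdist (tnth y i) x)). Qed.

Lemma rho_le y x (c : R) : 0 <= c -> (forall i, mdist (tnth y i) x <= c) -> rho y x <= c.
Proof. by move=> c0 h; rewrite /rho; apply: bigmax_le. Qed.

Lemma measurable_mdist x : measurable_fun setT (fun z : X => mdist z x).
Proof.
apply: (@lipschitz_measurable _ _ _ _ 1) => y z; rewrite mul1r.
by rewrite (metric_sym y x) (metric_sym z x) mdist_lip.
Qed.

Lemma measurable_rho x : measurable_fun setT (fun y : m.-tuple X => rho y x).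
Proof.
rewrite /rho; elim: (index_enum _) => [|i s IH].
  by under [X in measurable_fun _ X]eq_fun do rewrite big_nil; exact: measurable_cst.
under [X in measurable_fun _ X]eq_fun do rewrite big_cons.
apply: measurable_maxr => //.
by apply: (measurableT_comp (measurable_mdist x)); exact: measurable_tnth.
Qed.

Lemma measurable_annulus x (a b : R) : measurable [set y : m.-tuple X | a <= rho y x <= b].
Proof.
have := measurable_rho x measurableT (measurable_itv `[a, b]).
by rewrite setTI; congr measurable; apply/seteqP; split => y /=; rewrite in_itv.
Qed.

End rho_theory.

Section integral_union.
Context {R : realType} {d : measure_display} {T : measurableType d}.
Variable mu : {measure set T -> \bar R}.

Lemma ge0_integral_setU_le (A B : set T) (f : T -> \bar R) :
  measurable A -> measurable B -> measurable_fun setT f -> (forall x, 0 <= f x)%E ->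
  (\int[mu]_(x in A `|` B) f x <= \int[mu]_(x in A) f x + \int[mu]_(x in B) f x)%E.
Proof.
move=> mA mB mf f0; have mBA : measurable (B `\` A) by exact: measurableD.
have mfS D : measurable_fun D f by apply: measurable_funS mf.
have -> : A `|` B = A `|` (B `\` A).
  by apply/seteqP; split => x; have [Ax|Ax] := pselect (A x); move=> [] //; (try by left) => h; [right|case: h => ? _; right].
rewrite ge0_integral_setU//; last first.
  by apply/disj_set2P; rewrite setDE setICA setICr setI0.
by rewrite leeD2l// ge0_subset_integral// => x [].
Qed.

End integral_union.

Section kernel_tail.
Context {R : realType} {d : measure_display} {X : borelMetricType R d}.
Variable mu : {sigma_finite_measure set X -> \bar R}.
Variables C1 C2 C3 kappa n : R.
Hypothesis HRD : RD_space mu C1 C2 C3 kappa n.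
Context {m : nat}.
Variable K : m.+1.-tuple X -> R[i].
Variables eps alpha p0 p0' : R.
Hypothesis HK : strongly_singular_kernel mu kappa n K eps alpha p0 p0'.

Local Notation mum := (power_measure mu m).
Local Notation tD D := (if 1 <= D then 1 else alpha).

Let p0_gt0 : 0 < p0. Proof. exact: lt_trans ltr01 (ssk_p0 HK). Qed.

Let p0'_gt0 : 0 < p0'.
Proof.
have h := ssk_p0' HK; have p01 := ssk_p0 HK.
rewrite -invr_gt0 -(addKr p0^-1 p0'^-1) h addrC subr_gt0 invf_lt1//.
Qed.

Let alpha_gt0 : 0 < alpha. Proof. by have /andP[] := ssk_alpha HK. Qed.
Let alpha_le1 : alpha <= 1. Proof. by have /andP[] := ssk_alpha HK. Qed.

(** The exponent [k.+2] instead of [k.+1] lets the open ball contain the closed annulus. The power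
    of [D] is the [t * beta] of the kernel condition. *)
Lemma vol_annulus : exists2 W : R, 0 < W & forall (x : X) (D : R) (k : nat), 0 < D ->
  vol mu x (2 ^+ k.+2 * D `^ tD D) <=
    W * 2 `^ (k%:R * n) * D `^ (tD D * (if 1 <= D then n else kappa)).
Proof.
have [v [w [v0 w0 [H1 H2 _]]]] := vol_bounds HRD.
have C30 := RD_C3_gt0 HRD.
exists (C3 * (2 ^+ 2) `^ n * w); first by rewrite !mulr_gt0// powR_gt0.
move=> x D k D0.
have r0 : 0 < D `^ tD D by rewrite powR_gt0.
have h1 : 1 <= 2 ^+ k.+2 :> R by rewrite exprn_ege1// ler1n.
apply: (le_trans (vol_up HRD x r0 h1)).
have -> : (2 ^+ k.+2 : R) `^ n = (2 ^+ 2) `^ n * 2 `^ (k%:R * n).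
  have -> : (2 ^+ k.+2 : R) = 2 ^+ 2 * 2 `^ k%:R by rewrite powR_mulrn// -exprD.
  by rewrite powRM ?powR_ge0// -powRrM.
have hv : vol mu x (D `^ tD D) <= w * D `^ (tD D * (if 1 <= D then n else kappa)).
  have [D1|D1] := leP 1 D.
    by rewrite powRr1 ?mul1r ?H1// ltW.
  rewrite powRrM; apply: H2; first by rewrite powR_gt0.
  by rewrite -(powRr0 D) ger_powR// ?D0 ?(ltW D1)// ltW.
rewrite (_ : C3 * _ * w * _ * _ = C3 * ((2 ^+ 2) `^ n * 2 `^ (k%:R * n)) *
  (w * D `^ (tD D * (if 1 <= D then n else kappa)))); last by ring.
by rewrite ler_wpM2l// !mulr_ge0 ?powR_ge0// ltW.
Qed.

(** By Hölder's inequality the integral is at most the [L^p0] norm given by the kernel condition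
    times the measure of the annulus to the power [p0'^-1]. The volume factors of the condition are
    made to cancel this power, and [2 ^ (- k * eps / alpha)] remains. *)
Lemma annulus_bound : exists2 C : R, 0 <= C & forall (x x' : X) (k : nat)
    (h : m.-tuple X -> R[i]), x <> x' -> (0 < k)%N -> cmeasurable setT h ->
  let D := mdist x x' in
  let A := [set y : m.-tuple X | 2 ^+ k * D `^ tD D <= rho y x <= 2 ^+ k.+1 * D `^ tD D] in
  (forall y : m.-tuple X, A y -> cabs (h y) <= cabs (K [tuple of x :: y] - K [tuple of x' :: y])) ->
  (\int[mum]_(y in A) (cabs (h y))%:E <= (C * 2 `^ (- (k%:R * (eps / alpha))))%:E)%E.
Proof.
have [W W0 HW] := vol_annulus; have [C HC] := ssk_bound HK.
pose q := m%:R / p0'.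
exists (`|C| * W `^ q); first by rewrite mulr_ge0 ?powR_ge0.
move=> x x' k h xx' k0 mh D A hA.
have D0 : 0 < D by rewrite mdist_gt0; exact/eqP.
set t := tD D; pose beta := if 1 <= D then n else kappa.
have r0 : 0 < D `^ t by rewrite powR_gt0.
have mA : measurable A by exact: measurable_annulus.
have mcA : measurable_fun setT (\1_A : m.-tuple X -> R) by exact: measurable_indic.
have mch : measurable_fun setT (fun y : m.-tuple X => cabs (h y)) by exact: measurable_cabs.
have mf1 : measurable_fun setT (fun y : m.-tuple X => cabs (h y) * \1_A y).
  exact: measurable_funM.
have := hoelder mum mf1 mcA p0_gt0 p0'_gt0 (ssk_p0' HK).
rewrite Lnorm1; set lhs := (X in (X <= _)%E).
have -> : lhs = (\int[mum]_(y in A) (cabs (h y))%:E)%E.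
  rewrite [RHS]integral_mkcond; apply: eq_integral => y _.
  rewrite /= /patch indicE; case: ifPn => _; rewrite ?mulr1 ?mulr0 ?normr0//.
  by rewrite ger0_norm ?cabs_ge0.
move=> /le_trans; apply.
have N1 : ('N[mum]_p0%:E[EFin \o (fun y => (cabs (h y) * \1_A y)%R)] <=
   (`|C| * D `^ (eps - t * (beta * m%:R / p0' + eps / alpha)) *
      2 `^ (- (k%:R * (n * m%:R / p0' + eps / alpha))))%:E)%E.
  apply: (@le_trans _ _ (C * D `^ (eps - t * (beta * m%:R / p0' + eps / alpha)) *
      2 `^ (- (k%:R * (n * m%:R / p0' + eps / alpha))))%:E); last first.
    by rewrite lee_fin ler_wpM2r ?powR_ge0// ler_wpM2r ?powR_ge0// ler_norm.
  apply: le_trans (HC x x' k xx' k0).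
  rewrite Lnorm.unlock; apply: gt0_ler_poweR.
  - by rewrite invr_ge0 ltW.
  - by rewrite in_itv/= leey andbT; apply: integral_ge0 => y _; rewrite ?lee_fin ?powR_ge0.
  - by rewrite in_itv/= leey andbT; apply: integral_ge0 => y _; rewrite lee_fin powR_ge0.
  (* Measurability is assumed of [h], not of the difference of the kernels. *)
  - rewrite [leRHS]integral_mkcond; apply: ge0_le_integral_nomeas => y _.
      exact: poweR_ge0.
    rewrite /patch /= indicE; case: ifPn => [|_].
      rewrite inE => Ay; rewrite mulr1 lee_fin ger0_norm ?cabs_ge0//.
      by rewrite ge0_ler_powR ?nnegrE ?cabs_ge0 ?(ltW p0_gt0)// hA.
    by rewrite mulr0 normr0 powR0// gt_eqF.
have N2 : ('N[mum]_p0'%:E[EFin \o \1_A] <=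
    (W `^ q * 2 `^ (k%:R * (n * m%:R / p0')) * D `^ (t * (beta * m%:R / p0')))%:E)%E.
  set r := 2 ^+ k.+2 * D `^ t.
  have muA : (mum A <= (vol mu x r ^+ m)%:E)%E.
    rewrite -(@power_measure_cube _ _ _ mu m (ball x r)) ?(muE HRD)//; last exact: measurable_ballX.
    rewrite le_measure ?inE//.
      by apply: (@measurable_cube _ _ m (fun=> ball x r)) => _; exact: measurable_ballX.
    move=> y /= /andP[_ yA] i; rewrite in_ballE metric_sym (le_lt_trans (mdist_le_rho y x i))//.
    by rewrite (le_lt_trans yA)// ltr_pM2r// ltr_eXn2l ?ltr1n.
  have -> : ('N[mum]_p0'%:E[EFin \o \1_A] = mum A `^ p0'^-1)%E.
    rewrite Lnorm.unlock; congr (_ `^ _)%E.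
    rewrite -[in RHS](setIT A) -integral_indic//; apply: eq_integral => y _ /=.
    by rewrite indicE; case: (_ \in _); rewrite ?normr1 ?normr0 ?powR1 ?powR0 ?gt_eqF.
  apply: (@le_trans _ _ ((vol mu x r ^+ m)%:E `^ p0'^-1)%E).
    apply: gt0_ler_poweR; rewrite ?in_itv/= ?leey ?andbT ?measure_ge0 ?lee_fin ?exprn_ge0 ?vol_ge0//.
    by rewrite invr_ge0 ltW.
  rewrite poweR_EFin lee_fin -powR_mulrn ?vol_ge0// -powRrM -/q.
  have e1 : k%:R * (n * m%:R / p0') = k%:R * n * q by rewrite /q !mulrA.
  have e2 : t * (beta * m%:R / p0') = t * beta * q by rewrite /q !mulrA.
  rewrite e1 e2 !(powRrM _ _ q) -!powRM ?mulr_ge0 ?powR_ge0 ?(ltW W0)//.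
  rewrite ge0_ler_powR ?nnegrE ?vol_ge0 ?mulr_ge0 ?powR_ge0 ?(ltW W0)//.
    by rewrite invr_ge0 ltW.
  exact: HW.
apply: (le_trans (lee_pmul (Lnorm_ge0 _ _ _) (Lnorm_ge0 _ _ _) N1 N2)).
rewrite -EFinM lee_fin.
set a := `|C|; set b := W `^ q.
set u1 := D `^ _; set u2 := 2 `^ _; set u3 := 2 `^ _; set u4 := D `^ _.
have -> : a * u1 * u2 * (b * u3 * u4) = (a * b) * ((u2 * u3) * (u1 * u4)) by ring.
rewrite ler_wpM2l ?mulr_ge0 ?powR_ge0 ?normr_ge0//.
have -> : u2 * u3 = 2 `^ (- (k%:R * (eps / alpha))).
  rewrite -powRD; last by rewrite pnatr_eq0 implybT.
  by congr (_ `^ _); ring.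
rewrite ler_piMr ?powR_ge0// -powRD; last by rewrite (gt_eqF D0)/= implybT.
(* The exponent left on [D] is [eps - t * eps / alpha]: it is 0 for [t = alpha], and nonpositive for
   [t = 1], where [D >= 1]. *)
have -> : eps - t * (beta * m%:R / p0' + eps / alpha) + t * (beta * m%:R / p0') =
    eps - t * (eps / alpha) by ring.
rewrite /t; case: ifPn => D1.
  rewrite -[leRHS](powRr0 D) ler_powR// mul1r subr_le0 ler_pdivlMr//.
  by rewrite ler_piMr// ltW// (ssk_eps HK).
by rewrite mulrC divfK ?gt_eqF// subrr powRr0.
Qed.

End kernel_tail.

(** * The John-Stromberg argument *)

Section disjoint_sequences.
Context {R : realType} {d : measure_display} {T : measurableType d} {A : eqType}.
Variable mu : {measure set T -> \bar R}.
Implicit Types (F : A -> set T) (L : seq A).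

(** Disjointness by position in the list: an entry may occur twice only if its set is empty, so sums
    over the list count nothing twice. *)
Fixpoint disjoint_seq F L : Prop :=
  if L is x :: L' then (forall y, y \in L' -> F x `&` F y = set0) /\ disjoint_seq F L'
  else True.

Lemma disjoint_seq_sum F (Y : set T) L : (forall x, measurable (F x)) -> measurable Y ->
  (mu Y < +oo)%E -> (forall x, x \in L -> F x `<=` Y) -> disjoint_seq F L ->
  \sum_(x <- L) fine (mu (F x)) <= fine (mu Y).
Proof.
move=> mF; elim: L Y => [|x L IH] Y mY Yoo FY /=.
  by rewrite big_nil fine_ge0.
move=> [xL dL]; rewrite big_cons.
have Fxoo : (mu (F x) < +oo)%E.
  by apply: le_lt_trans Yoo; rewrite le_measure ?inE//; apply: FY; rewrite mem_head.
have mYx : measurable (Y `\` F x) by exact: measurableD.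
have Yxoo : (mu (Y `\` F x) < +oo)%E.
  by apply: le_lt_trans Yoo; rewrite le_measure ?inE// => y [].
have YE : Y = F x `|` (Y `\` F x).
  have xY : F x `<=` Y by apply: FY; rewrite mem_head.
  by apply/seteqP; split => y; have [h|h] := pselect (F x y);
    [left|right|case => [/xY|[]]|case => [/xY|[]]].
have -> : fine (mu Y) = fine (mu (F x)) + fine (mu (Y `\` F x)).
  rewrite -fineD ?ge0_fin_numE//; congr fine.
  by rewrite [in LHS]YE measureU// setDE setICA setICr setI0.
rewrite lerD2l; apply: IH => // y yL z Fyz; split.
  by apply: (FY y) => //; rewrite inE yL orbT.
by move=> Fxz; have : (F x `&` F y) z by []; rewrite xL.
Qed.

Lemma integral_cover_le (G : A -> set T) (D : set T) (f : T -> \bar R) (b : A -> R) L :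
  (forall x, measurable (G x)) -> measurable D -> measurable_fun setT f ->
  (forall x, 0 <= f x)%E ->
  (forall y, D y -> exists2 x, x \in L & G x y) ->
  (forall x, x \in L -> \int[mu]_(y in G x) f y <= (b x)%:E)%E ->
  (\int[mu]_(y in D) f y <= (\sum_(x <- L) b x)%:E)%E.
Proof.
move=> mG + mf f0; elim: L D => [|x L IH] D mD DL bL.
  rewrite big_nil (_ : D = set0) ?integral_set0//.
  by rewrite -subset0 => y /DL [].
rewrite big_cons EFinD.
have mDG : measurable (D `\` G x) by exact: measurableD.
apply: (@le_trans _ _ (\int[mu]_(y in G x `|` (D `\` G x)) f y)%E).
  apply: ge0_subset_integral => //.
  - exact: measurableU.
  - exact: measurable_funS mf.
  - by move=> y Dy; have [h|h] := pselect (G x y); [left|right].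
apply: (le_trans (ge0_integral_setU_le mu (mG x) mDG mf f0)).
apply: leeD; first by apply: bL; rewrite mem_head.
apply: IH => // [y [Dy nGy]|y yL]; last by apply: bL; rewrite inE yL orbT.
have [z] := DL y Dy; rewrite inE => /orP[/eqP ->|zL Gz] //.
by exists z.
Qed.

End disjoint_sequences.

(** Otherwise every list in [P] could be prolonged, and from the empty one lengths beyond [N] would
    be reached. *)
Lemma maximal_seq (A : Type) (P : seq A -> Prop) (N : nat) : P [::] ->
  (forall s, P s -> (size s <= N)%N) -> exists2 s, P s & forall x, ~ P (x :: s).
Proof.
move=> P0 PN; apply: contrapT => H.
have step s : P s -> exists2 t, P t & size t = (size s).+1.
  move=> Ps; apply: contrapT => H'; apply: H; exists s => // x Pxs.
  by apply: H'; exists (x :: s).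
have : forall k, exists2 s, P s & size s = k.
  by elim=> [|k [s Ps <-]]; [exists [::]|exact: step].
by move=> /(_ N.+1)[s /PN]; rewrite leqNgt => /negP + e; rewrite e; exact.
Qed.

Section mean_oscillation.
Context {R : realType} {d : measure_display} {T : measurableType d}.
Variable mu : {measure set T -> \bar R}.

Lemma chebyshev_mean (B : set T) (f : T -> R[i]) (c : R[i]) (M V : R) :
  measurable B -> cmeasurable setT f -> 0 <= M -> 0 <= V ->
  (\int[mu]_(y in B) (cabs (f y - c))%:E <= (M * V)%:E)%E ->
  (mu (B `&` [set y | 4 * M < cabs (f y - c)])%R <= (V / 4)%:E)%E.
Proof.
move=> mB mf M0 V0 H.
have mfc : cmeasurable setT (fun y => f y - c).
  exact: cmeasurableBc.
have mc : measurable_fun B (fun y => (cabs (f y - c))%:E).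
  apply/measurable_EFinP; apply: measurable_cabs.
  by apply: (@cmeasurableS _ _ _ _ setT).
have mS : measurable (B `&` [set y | 4 * M < cabs (f y - c)]).
  by apply: measurableI => //; exact: measurable_cabs_gt.
have absE : (\int[mu]_(y in B) `|(cabs (f y - c))%:E| = \int[mu]_(y in B) (cabs (f y - c))%:E)%E.
  by apply: eq_integral => y _; rewrite gee0_abs// lee_fin cabs_ge0.
(* For [M = 0] the level is 0 and cannot be divided by; then [f = c] almost everywhere on [B]. *)
have [M00|M00] := eqVneq M 0.
  have I0 : (\int[mu]_(y in B) `|(cabs (f y - c))%:E|)%E = 0%E.
    apply/eqP; rewrite eq_le integral_ge0 ?andbT// absE.
    by apply: le_trans H _; rewrite M00 mul0r.
  have h := (ae_eq_integral_abs mu mB mc).1 I0.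
  rewrite (@ae_measure_eq0 _ _ _ mu _ _ mS h) ?lee_fin ?divr_ge0//.
  by move=> y [By /=]; rewrite M00 mulr0 => + /(_ By) [] => + E; rewrite E ltxx.
have M1 : 0 < 4 * M by rewrite mulr_gt0// lt_neqAle eq_sym M00.
have h := le_integral_abse mu mB mc M1.
have mS2 : measurable (B `&` [set x | (4 * M)%:E <= `|(cabs (f x - c))%:E|]%E).
  rewrite (_ : [set x | _] = [set x | (4 * M)%:E <= (cabs (f x - c))%:E]%E); last first.
    by apply/seteqP; split => x /=; rewrite ger0_norm ?cabs_ge0.
  exact: emeasurable_fun_c_infty.
have : ((4 * M)%:E * mu (B `&` [set y | (4 * M < cabs (f y - c))%R]) <= (M * V)%:E)%E.
  apply: le_trans H; rewrite -absE; apply: le_trans h.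
  apply: lee_wpmul2l; first by rewrite lee_fin ltW.
  rewrite le_measure ?inE//.
  by move=> y [By /= hy]; split => //=; rewrite lee_fin ger0_norm ?cabs_ge0// ltW.
rewrite -lee_pdivlMl// => /le_trans; apply; rewrite -EFinM lee_fin.
by rewrite le_eqVlt; apply/orP; left; apply/eqP; field; rewrite M00.
Qed.

Lemma integral_cabs_perturb (B : set T) (u v : T -> R[i]) (e : R) : measurable B ->
  cmeasurable setT u -> cmeasurable setT v -> 0 <= e ->
  {ae mu, forall y, B y -> cabs (v y) <= cabs (u y) + e} ->
  (\int[mu]_(y in B) (cabs (v y))%:E <= \int[mu]_(y in B) (cabs (u y))%:E + e%:E * mu B)%E.
Proof.
move=> mB mu_ mv e0 H.
have mc w : cmeasurable setT w -> measurable_fun B (fun y => (cabs (w y))%:E).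
  by move=> mw; apply/measurable_EFinP; apply: measurable_funS (measurable_cabs mw).
have c0 (w : T -> R[i]) y : B y -> (0 <= (cabs (w y))%:E)%E by rewrite lee_fin cabs_ge0.
apply: (@le_trans _ _ (\int[mu]_(y in B) ((cabs (u y))%:E + e%:E))%E).
  apply: ae_ge0_le_integral => //.
  - exact: c0.
  - exact: mc.
  - by move=> y _; rewrite -EFinD lee_fin addr_ge0 ?cabs_ge0.
  - by apply: emeasurable_funD => //; exact: mc.
rewrite ge0_integralD//; [|exact: c0|exact: mc].
by rewrite integral_cst.
Qed.

Lemma integral_dist_le (B : set T) (f : T -> R[i]) (c c' : R[i]) (a V : R) :
  measurable B -> cmeasurable setT f -> mu B = V%:E ->
  (\int[mu]_(y in B) (cabs (f y - c))%:E <= (a * V)%:E)%E ->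
  (\int[mu]_(y in B) (cabs (f y - c'))%:E <= ((a + cabs (c - c')) * V)%:E)%E.
Proof.
move=> mB mf BV H.
have mfc z : cmeasurable setT (fun y => f y - z).
  exact: cmeasurableBc.
apply: (le_trans (integral_cabs_perturb mB (mfc c) (mfc c') (cabs_ge0 (c - c')) _)).
  by apply: aeW => y _; exact: ler_cabs_dist.
by rewrite BV mulrDl EFinD; exact: leeD.
Qed.

End mean_oscillation.

Section john_stromberg.
Context {R : realType} {d : measure_display} {X : borelMetricType R d}.
Variable mu : {measure set X -> \bar R}.
Variables C1 C2 C3 kappa n : R.
Hypothesis HRD : RD_space mu C1 C2 C3 kappa n.

Local Notation vol := (vol mu).

(** A free constant [c] in place of the mean presupposes no integrability of [f]; [mean_osc_mean]
    returns to the mean at the cost of a factor 3. *)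
Definition mean_osc_le (f : X -> R[i]) (x : X) (r M : R) :=
  exists c : R[i], (\int[mu]_(y in ball x r) (cabs (f y - c))%:E <= (M * vol x r)%:E)%E.

(* Vitali selection, for the finitely many radii [sg 0 >= sg 1 >= ..]: the radius
   attached to [x] is [sg (st x)]. *)
Lemma vitali_select (D : set X) (sg : nat -> R) (st : X -> nat) (J : nat) (x1 : X) (r v0 : R) :
  (forall i j, (i <= j)%N -> sg j <= sg i) ->
  (forall x, D x -> (st x <= J)%N) -> 0 < v0 ->
  (forall x, D x -> ball x (sg (st x)) `<=` ball x1 r) ->
  (forall x, D x -> v0 <= vol x (sg (st x))) ->
  exists L : seq X, [/\ forall x, x \in L -> D x,
    disjoint_seq (fun x => ball x (sg (st x))) L &
    forall x, D x -> exists2 y, y \in L & ball y (2 * sg (st y)) x].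
Proof.
move=> sg_anti stJ v00 DB Dv.
pose F x := ball x (sg (st x)).
(* Selection from large to small radii: [st y <= st x] says that the selected ball met by [F x] is
   at least as large. Only the centre [x] has to be covered, so doubling the radius is enough. *)
suff H j : exists L : seq X, [/\ forall x, x \in L -> D x /\ (st x < j)%N,
    disjoint_seq F L &
    forall x, D x -> (st x < j)%N -> exists2 y, y \in L &
      (st y <= st x)%N /\ F x `&` F y !=set0].
  have [L [L1 L2 L3]] := H J.+1; exists L; split => //; first by move=> x /L1 [].
  move=> x Dx; have [y yL [yx [z [Fxz Fyz]]]] := L3 x Dx (stJ x Dx).
  exists y => //; rewrite in_ballE; move: Fxz Fyz; rewrite /F !in_ballE => h1 h2.
  have := metric_triangle y z x; rewrite (metric_sym z x).
  by have := sg_anti _ _ yx; lra.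
elim: j => [|j [L [L1 L2 L3]]]; first by exists [::]; split.
pose P s := (forall x, x \in s -> D x /\ st x = j) /\ disjoint_seq F (s ++ L).
(* Disjoint balls of volume at least [v0] inside [ball x1 r] number at most [vol x1 r / v0], so a
   maximal list exists. *)
have [|s Ps|s [s1 s2] smax] := @maximal_seq X P (Num.truncn (vol x1 r / v0)).
- by split.
- have [s1 s2] := Ps.
  have h : \sum_(x <- s ++ L) fine (mu (F x)) <= fine (mu (ball x1 r)).
    apply: disjoint_seq_sum => //.
    - by move=> x; exact: measurable_ballX.
    - exact: measurable_ballX.
    - exact: (RD_ball_lty HRD).
    - by move=> x; rewrite mem_cat => /orP[/s1 [Dx _]|/L1 [Dx _]]; exact: DB.
  rewrite big_cat/= in h.
  have h2 : v0 * (size s)%:R <= \sum_(x <- s) fine (mu (F x)).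
    have : forall x, x \in s -> v0 <= fine (mu (F x)).
      by move=> x /s1 [Dx _]; exact: Dv.
    elim: (s) => [|x t IH] Hs; first by rewrite big_nil mulr0.
    rewrite big_cons /= -natr1 mulrDr mulr1 addrC lerD//; first by apply: Hs; rewrite mem_head.
    by apply: IH => y yt; apply: Hs; rewrite inE yt orbT.
  have h3 : 0 <= \sum_(x <- L) fine (mu (F x)) by apply: sumr_ge0 => x _; rewrite fine_ge0.
  have h4 : v0 * (size s)%:R <= vol x1 r by move: h; rewrite -/(vol x1 r); lra.
  rewrite -(ler_nat R); rewrite mulrC -ler_pdivlMr// in h4.
  rewrite leNgt ltr_nat; apply/negP => h5.
  have := truncnS_gt (vol x1 r / v0); rewrite ltNge => /negP; apply.
  by rewrite (le_trans _ h4)// ler_nat.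
- exists (s ++ L); split => //.
    by move=> x; rewrite mem_cat => /orP[/s1 [Dx ->]|/L1 [Dx xj]]; split => //; exact: ltnW.
  move=> x Dx; rewrite ltnS leq_eqVlt => /orP[/eqP xj|xj]; last first.
    by have [y yL h] := L3 x Dx xj; exists y => //; rewrite mem_cat yL orbT.
  apply: contrapT => H; apply: (smax x); split.
    by move=> y; rewrite inE => /orP[/eqP ->|/s1].
  split => // y ysL; apply: contrapT => /eqP/set0P ne; apply: H; exists y => //.
  split => //; move: ysL; rewrite mem_cat xj => /orP[/s1 [_ ->]|/L1 [_ /ltnW]] //.
Qed.

Lemma C1_ge1 (x : X) : 1 <= C1.
Proof.
have h := vol_doubling HRD x ltr01; have v := vol_gt0 HRD x ltr01.
have := @vol_mono _ _ _ mu _ _ _ _ _ HRD x 1 (2 * 1).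
rewrite mulr1 in h *; move=> /(_ (ler1n _ 2)) h2.
by rewrite -(ler_pM2r v) mul1r (le_trans h2).
Qed.

Section step.
Variables (f : X -> R[i]) (A A' : R).
Hypothesis mf : cmeasurable setT f.
Hypotheses (A0 : 0 <= A) (A'0 : 0 <= A').
Hypothesis weak_osc : forall x r, 2 <= r -> exists c : R[i],
  (mu (ball x r `&` [set y | A < cabs (f y - c)])%R <= ((40 * C1 ^+ 2)^-1 * vol x r)%:E)%E.
Hypothesis small_osc : forall x r, 1 / 2 < r -> r <= 1 -> mean_osc_le f x r A'.

(** Outside [E] the function is within [A] of [c']. Each point of [E] in the ball receives a
    stopping ball. In its double [G x] the set [E] is not dense, so [c'] is a good constant for [f]
    there as well. Either [E] is dense in the stopping ball, and the volumes of such disjoint balls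
    add up to [O(mu E)], so that [M] enters with a small factor; or the double has reached the scale
    of [small_osc], which brings in [A']. *)
Lemma john_stromberg_step (Rad M : R) : 0 <= M ->
  (forall x r, 1 <= r -> r <= Rad -> mean_osc_le f x r M) ->
  forall x r, 1 <= r -> r <= Rad -> mean_osc_le f x r ((2 + 5 * C1 ^+ 2) * (A + A') + M / 2).
Proof.
move=> M0 H x1 r r1 rRad.
have C11 := C1_ge1 x1; have C10 : 0 < C1 by exact: lt_le_trans C11.
have r0 : 0 < r by exact: lt_le_trans r1.
have r2 : 2 <= 2 * r by rewrite ler_peMr.
have [c' Hc'] := weak_osc x1 r2.
(* The 40 makes the coefficient of [M] at the end equal to [4 * 5 / 40 = 1 / 2]: 4 is the inverse of
   the density, 5 comes from [compare], and [C1 ^+ 2] pays for two doublings. *)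
pose s := (40 * C1 ^+ 2)^-1.
have s0 : 0 < s by rewrite invr_gt0 mulr_gt0// exprn_gt0.
have sC : s * C1 ^+ 2 = 1 / 40 by rewrite /s; field; exact: lt0r_neq0.
pose E := ball x1 (2 * r) `&` [set y | A < cabs (f y - c')].
have mB (x : X) (t : R) : measurable (ball x t) by exact: measurable_ballX.
have mE : measurable E.
  apply: measurableI => //; apply: measurable_cabs_gt; exact: cmeasurableBc.
have Eoo : (mu E < +oo)%E by apply: le_lt_trans Hc' _; exact: ltry.
pose eE Y := fine (mu (E `&` Y)).
have muEY Y : measurable Y -> mu (E `&` Y) = (eE Y)%:E.
  move=> mY; rewrite /eE fineK// ge0_fin_numE// (le_lt_trans _ Eoo)// le_measure ?inE//.
  exact: measurableI.
have eE_le Y : measurable Y -> eE Y <= s * vol x1 (2 * r).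
  move=> mY; rewrite -lee_fin -muEY// (le_trans _ Hc')// le_measure ?inE//.
  exact: measurableI.
(* The last scale: [r / 2 ^+ J] falls in the range of radii of [small_osc]. *)
have [J J1 J2] : exists2 J : nat, r / 2 ^+ J <= 1 & 1 / 2 < r / 2 ^+ J.
  have ex : exists J : nat, r / 2 ^+ J <= 1.
    exists (Num.truncn r).+1; rewrite ler_pdivrMr ?exprn_gt0// mul1r ltW//.
    apply: (lt_trans (truncnS_gt _)); rewrite -natrX ltr_nat.
    by apply: ltn_expl.
  exists (ex_minn ex); case: ex_minnP => J HJ Jmin //.
  case: J HJ Jmin => [|J] HJ Jmin; first by rewrite expr0 divr1; lra.
  rewrite ltNge; apply/negP => h; suff : (J.+1 <= J)%N by rewrite ltnn.
  apply: Jmin; move: h; rewrite exprS invfM mulrCA.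
  by set q := r / 2 ^+ J; lra.
(* Half of [r / 2 ^+ j]: the double ball then has radius [r / 2 ^+ st x], which is at most [r] and
   is the preceding scale when [st x] is positive. *)
pose sg (j : nat) := r / 2 ^+ j.+1.
have sg2 j : 2 * sg j = r / 2 ^+ j by rewrite /sg exprS; field; rewrite expf_neq0.
have sg_gt0 j : 0 < sg j by rewrite divr_gt0// exprn_gt0.
have sg_anti i j : (i <= j)%N -> sg j <= sg i.
  by move=> ij; rewrite ler_wpM2l ?(ltW r0)// lef_pV2 ?posrE ?exprn_gt0// ler_weXn2l// ler1n.
have sg_le j : sg j <= r / 2.
  by have := sg_anti 0%N j (leq0n j); rewrite {2}/sg expr1.
(* The radius attached to [x] is the largest [sg j] at which [E] is dense around
   [x], or [sg J <= 1] if there is none. *)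
pose dense (x : X) (j : nat) := 1 / 4 * vol x (sg j) < eE (ball x (sg j)).
have exst x : exists j, (dense x j || (j == J)) by exists J; rewrite eqxx orbT.
pose st x := ex_minn (exst x).
have stJ x : (st x <= J)%N by rewrite /st; case: ex_minnP => j _; apply; rewrite eqxx orbT.
have st_dense x : (st x < J)%N -> dense x (st x).
  by rewrite /st; case: ex_minnP => j /orP[//|/eqP ->]; rewrite ltnn.
have st_ndense x j : (j < st x)%N -> eE (ball x (sg j)) <= 1 / 4 * vol x (sg j).
  move=> jst; rewrite leNgt; apply/negP => dj; move: jst; rewrite /st.
  by case: ex_minnP => i _ /(_ j); rewrite /dense dj => /(_ isT); rewrite leqNgt => /negP.
pose D := E `&` ball x1 r.
have Dx1 x : D x -> mdist x1 x < r by move=> [_]; rewrite in_ballE.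
have F2B x t : D x -> t <= r -> ball x t `<=` ball x1 (2 * r).
  by move=> /Dx1 xr tr; apply: ball_sub; lra.
have [v [w [v0 w0 [_ _ vlow]]]] := vol_bounds HRD.
have [L [LD dL cL]] : exists L : seq X, [/\ forall x, x \in L -> D x,
    disjoint_seq (fun x => ball x (sg (st x))) L &
    forall x, D x -> exists2 y, y \in L & ball y (2 * sg (st y)) x].
  apply: (@vitali_select D sg st J x1 (2 * r) (v * (sg J) `^ n)) => //.
  - by rewrite mulr_gt0// powR_gt0.
  - by move=> x Dx; apply: F2B => //; have := sg_le (st x); lra.
  - move=> x Dx; apply: (@le_trans _ _ (vol x (sg J))).
      by apply: vlow => //; have := sg2 J; move: J1; lra.
    by apply: (vol_mono HRD); apply: sg_anti.
pose G x := ball x (2 * sg (st x)).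
have G2B x : D x -> G x `<=` ball x1 (2 * r).
  by move=> Dx; apply: F2B => //; have := sg_le (st x); lra.
have volG x : vol x (2 * sg (st x)) <= C1 * vol x (sg (st x)) by exact: (vol_doubling HRD).
(* If [st x] is positive, [G x] lives at the preceding scale, where [E] is not dense by minimality.
   Otherwise its radius is [r], and two doublings compare it with [ball x1 (2 * r)], in which the
   whole of [E] is small. *)
have ndG x : D x -> eE (G x) <= 1 / 4 * vol x (2 * sg (st x)).
  move=> Dx; rewrite /G; case E1 : (st x) => [|j]; last first.
    have -> : 2 * sg j.+1 = sg j by rewrite sg2.
    by apply: st_ndense; rewrite E1.
  rewrite sg2 expr0 divr1; apply: (le_trans (eE_le _ _)) => //.
  have h1 : vol x1 (2 * r) <= vol x (2 * (2 * r)).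
    apply: (vol_le HRD); apply: ball_sub; have := Dx1 x Dx; rewrite metric_sym; lra.
  have h2 : vol x (2 * (2 * r)) <= C1 * vol x (2 * r).
    by apply: (vol_doubling HRD); rewrite mulr_gt0.
  have h3 : vol x (2 * r) <= C1 * vol x r by exact: (vol_doubling HRD).
  have h4 : vol x1 (2 * r) <= C1 ^+ 2 * vol x r.
    by rewrite (le_trans h1)// (le_trans h2)// expr2 -mulrA ler_wpM2l// ltW.
  apply: (@le_trans _ _ (s * (C1 ^+ 2 * vol x r))); first by rewrite ler_wpM2l// ltW.
  rewrite mulrA sC ler_wpM2r ?(vol_ge0 mu)//; lra.
(* [c] and [c'] differ by at most [A + 4 a]: otherwise [G x], of which [E] fills at
   most a quarter, would be covered by [E] and a Chebyshev set of [f - c] which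
   fills at most another quarter. *)
have compare x a : D x -> 0 <= a -> mean_osc_le f x (2 * sg (st x)) a ->
    (\int[mu]_(y in G x) (cabs (f y - c'))%:E <= ((5 * a + A) * vol x (2 * sg (st x)))%:E)%E.
  move=> Dx a0 [c Hc]; set t := 2 * sg (st x) in Hc *.
  have t0 : 0 < t by rewrite mulr_gt0.
  have vt := vol_gt0 HRD x t0.
  have cc : cabs (c - c') <= A + 4 * a.
    rewrite leNgt; apply/negP => hh.
    have ch := chebyshev_mean (mB x t) mf a0 (ltW vt) Hc.
    have mch : measurable (ball x t `&` [set y | 4 * a < cabs (f y - c)]).
      apply: measurableI => //; apply: measurable_cabs_gt; exact: cmeasurableBc.
    have mEG : measurable (E `&` G x) by apply: measurableI => //; exact: mB.
    have : (mu (ball x t) <= (1 / 4 * vol x t)%:E + (vol x t / 4)%:E)%E.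
      apply: (@le_trans _ _ (mu ((E `&` G x) `|` (ball x t `&` [set y | (4 * a < cabs (f y - c))%R])))).
        rewrite le_measure ?inE//; first exact: measurableU.
        move=> y ty; have [h1|h1] := leP (cabs (f y - c)) (4 * a); last by right.
        left; split => //; split; first exact: (G2B x Dx).
        rewrite /= ltNge; apply/negP => h2.
        by have := ler_cabs_dist (f y) c c'; rewrite (cabsB c (f y)); lra.
      apply: (le_trans (measureU2 _ mEG mch)).
      apply: leeD => //; rewrite [X in (X <= _)%E](muEY (G x) (mB _ _)) lee_fin.
      exact: ndG.
    by rewrite (muE HRD) -EFinD lee_fin; lra.
  apply: le_trans (integral_dist_le c' (mB x t) mf (muE HRD x t) Hc) _.
  by rewrite lee_fin ler_wpM2r ?(ltW vt)//; lra.
(* A dense ball has volume below [4 * eE], and these quantities add up to at most [mu E]; a ball of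
   the last scale is charged to its own volume. Having both terms for every [x] avoids splitting
   [L]. *)
pose b x := C1 * (4 * (5 * M + A) * eE (ball x (sg (st x))) + (5 * A' + A) * vol x (sg (st x))).
have bG x : D x -> (\int[mu]_(y in G x) (cabs (f y - c'))%:E <= (b x)%:E)%E.
  move=> Dx; have e0 : 0 <= eE (ball x (sg (st x))) by rewrite /eE fine_ge0.
  have v0' : 0 <= vol x (sg (st x)) by exact: (vol_ge0 mu).
  have gv := volG x; have [stl|stl] := ltnP (st x) J.
    (* As [st x < J], this radius is at least [2 * (r / 2 ^+ J)], which exceeds 1. *)
    have hh : mean_osc_le f x (2 * sg (st x)) M.
      apply: H; last by have := sg_le (st x); lra.
      have : sg J <= sg (st x).+1 by exact: sg_anti.
      have -> : sg (st x).+1 = sg (st x) / 2 by rewrite /sg exprS; field; rewrite expf_neq0.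
      by have := sg2 J; move: J2; lra.
    apply: (le_trans (compare x M Dx M0 hh)); rewrite lee_fin /b.
    have ds := st_dense x stl; rewrite /dense in ds.
    apply: (@le_trans _ _ ((5 * M + A) * (C1 * (4 * eE (ball x (sg (st x))))))).
      rewrite ler_wpM2l ?addr_ge0 ?mulr_ge0// (le_trans gv)// ler_wpM2l ?(ltW C10)//; lra.
    rewrite mulrDr (_ : C1 * (4 * _ * _) = (5 * M + A) * (C1 * (4 * eE (ball x (sg (st x)))))); last by ring.
    by rewrite lerDl !mulr_ge0 ?(ltW C10)// addr_ge0 ?mulr_ge0.
  have stE : st x = J by apply/eqP; rewrite eqn_leq stJ stl.
  have hh : mean_osc_le f x (2 * sg (st x)) A'.
    by apply: small_osc; rewrite stE sg2.
  apply: (le_trans (compare x A' Dx A'0 hh)); rewrite lee_fin /b.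
  apply: (@le_trans _ _ ((5 * A' + A) * (C1 * vol x (sg (st x))))).
    by rewrite ler_wpM2l ?addr_ge0 ?mulr_ge0.
  rewrite mulrDr (_ : C1 * ((5 * A' + A) * _) = (5 * A' + A) * (C1 * vol x (sg (st x)))); last by ring.
  by rewrite lerDr !mulr_ge0 ?(ltW C10)// addr_ge0 ?mulr_ge0.
have mfc : measurable_fun setT (fun y => (cabs (f y - c'))%:E).
  apply/measurable_EFinP/measurable_cabs/cmeasurableB => //; exact: cmeasurable_cst.
have f0 y : (0 <= (cabs (f y - c'))%:E)%E by rewrite lee_fin cabs_ge0.
have mD : measurable D by exact: measurableI.
have ID : (\int[mu]_(y in D) (cabs (f y - c'))%:E <= (\sum_(x <- L) b x)%:E)%E.
  apply: (@integral_cover_le _ _ _ _ mu G) => //; first by move=> x; exact: mB.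
  by move=> x /LD; exact: bG.
have v2B : vol x1 (2 * r) <= C1 * vol x1 r by exact: (vol_doubling HRD).
have S1 : \sum_(x <- L) eE (ball x (sg (st x))) <= s * vol x1 (2 * r).
  have mF x : measurable (E `&` ball x (sg (st x))) by apply: measurableI => //; exact: mB.
  have FE x : x \in L -> E `&` ball x (sg (st x)) `<=` E by move=> _ y [].
  have dE : disjoint_seq (fun x => E `&` ball x (sg (st x))) L.
    have : forall F (L' : seq X), disjoint_seq F L' -> disjoint_seq (fun x => E `&` F x) L'.
      move=> F; elim=> //= x L' IH [h1 h2]; split; last exact: IH.
      move=> y /h1 hh; rewrite -subset0 => z [[_ h3] [_ h4]].
      by have : (F x `&` F y) z by []; rewrite hh.
    by apply.
  apply: (le_trans (disjoint_seq_sum mF mE Eoo FE dE)).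
  rewrite -lee_fin fineK// ge0_fin_numE//.
have S2 : \sum_(x <- L) vol x (sg (st x)) <= vol x1 (2 * r).
  apply: (@disjoint_seq_sum _ _ _ _ mu (fun x => ball x (sg (st x)))) => //.
    exact: (RD_ball_lty HRD).
  by move=> x /LD Dx; apply: F2B => //; have := sg_le (st x); lra.
have Sb : \sum_(x <- L) b x <= (1 / 10 * (5 * M + A) + C1 ^+ 2 * (5 * A' + A)) * vol x1 r.
  rewrite /b -mulr_sumr big_split/= -!mulr_sumr.
  set u := \sum_(x <- L) eE _ in S1 *; set u' := \sum_(x <- L) vol _ _ in S2 *.
  have V0 : 0 <= vol x1 r by exact: (vol_ge0 mu).
  have h1 : C1 * (4 * (5 * M + A) * u) <= 1 / 10 * (5 * M + A) * vol x1 r.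
    have : C1 * u <= 1 / 40 * vol x1 r.
      apply: (@le_trans _ _ (C1 * (s * (C1 * vol x1 r)))).
        by rewrite ler_wpM2l ?(ltW C10)// (le_trans S1)// ler_wpM2l// ltW.
      by rewrite -sC expr2 le_eqVlt; apply/orP; left; apply/eqP; ring.
    have q0 : 0 <= 5 * M + A by rewrite addr_ge0 ?mulr_ge0.
    move=> /(ler_wpM2l q0); set q := 5 * M + A; set V := vol x1 r; nra.
  have h2 : C1 * ((5 * A' + A) * u') <= C1 ^+ 2 * (5 * A' + A) * vol x1 r.
    have q0 : 0 <= 5 * A' + A by rewrite addr_ge0 ?mulr_ge0.
    rewrite (_ : C1 ^+ 2 * _ * _ = C1 * ((5 * A' + A) * (C1 * vol x1 r))); last by ring.
    by rewrite ler_wpM2l ?(ltW C10)// ler_wpM2l// (le_trans S2).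
  by rewrite [leLHS]mulrDr [leRHS]mulrDl; exact: lerD.
exists c'; apply: (@le_trans _ _ (\int[mu]_(y in (ball x1 r `\` E) `|` D) (cabs (f y - c'))%:E)%E).
  apply: ge0_subset_integral => //.
  - by apply: measurableU => //; exact: measurableD.
  - exact: measurable_funS mfc.
  - by move=> y By; have [hh|hh] := pselect (E y); [right|left].
apply: (le_trans (ge0_integral_setU_le mu (measurableD (mB _ _) mE) mD mfc f0)).
have IE : (\int[mu]_(y in ball x1 r `\` E) (cabs (f y - c'))%:E <= (A * vol x1 r)%:E)%E.
  have mBE : measurable (ball x1 r `\` E) by exact: measurableD.
  apply: (@le_trans _ _ (\int[mu]_(y in ball x1 r `\` E) (cst A%:E) y)%E).
    apply: ge0_le_integral => //.
    - exact: measurable_funS mfc.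
    - move=> y [By nE] /=; rewrite lee_fin leNgt; apply/negP => hh; apply: nE; split => //.
      by move: By; rewrite !in_ballE; lra.
  rewrite integral_cst// EFinM lee_wpmul2l ?lee_fin// -(muE HRD) le_measure ?inE//.
apply: (le_trans (leeD IE ID)); rewrite -EFinD lee_fin.
apply: (le_trans (lerD (lexx _) Sb)); rewrite -mulrDl ler_wpM2r ?(vol_ge0 mu)//.
have : 1 <= C1 ^+ 2 by rewrite exprn_ege1.
set q := C1 ^+ 2; have := A0; have := A'0; have := M0; nra.
Qed.

(** The step turns a bound [2 * B + t] into [2 * B + t / 2], so iteration lets the a priori bound
    [M0] vanish into [e]. Thus [M0] may depend on [Rad] while the final bound does not. *)
Lemma john_stromberg (Rad M0 e : R) : 0 <= M0 -> 0 < e ->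
  (forall x r, 1 <= r -> r <= Rad -> mean_osc_le f x r M0) ->
  forall x r, 1 <= r -> r <= Rad ->
  mean_osc_le f x r (2 * ((2 + 5 * C1 ^+ 2) * (A + A')) + e).
Proof.
move=> M00 e0 H; set B := (2 + 5 * C1 ^+ 2) * (A + A').
have B0 : 0 <= B by rewrite mulr_ge0 ?addr_ge0// mulr_ge0// exprn_even_ge0.
have iter k x r : 1 <= r -> r <= Rad -> mean_osc_le f x r (2 * B + M0 / 2 ^+ k).
  elim: k x r => [|k IH] x r r1 rRad.
    rewrite expr0 divr1; have [c Hc] := H x r r1 rRad; exists c.
    apply: (le_trans Hc); rewrite lee_fin ler_wpM2r ?(vol_ge0 mu)//.
    by rewrite lerDr mulr_ge0.
  have M1 : 0 <= 2 * B + M0 / 2 ^+ k.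
    by apply: addr_ge0; [rewrite mulr_ge0|rewrite divr_ge0// exprn_ge0].
  have := john_stromberg_step M1 IH x r1 rRad; congr mean_osc_le.
  by rewrite -/B exprS; field; rewrite expf_neq0.
move=> x r r1 rRad.
have [k Hk] : exists k : nat, M0 / 2 ^+ k <= e.
  exists (Num.truncn (M0 / e)); rewrite ler_pdivrMr ?exprn_gt0// mulrC -ler_pdivrMr// ltW//.
  apply: (lt_le_trans (truncnS_gt _)).
  by rewrite -natrX ler_nat; exact: ltn_expl.
have [c Hc] := iter k x r r1 rRad; exists c; apply: (le_trans Hc).
by rewrite lee_fin ler_wpM2r ?(vol_ge0 mu)// lerD2l.
Qed.

End step.
End john_stromberg.

(** * Kolmogorov's inequality *)

Section weak_integrability.
Context {R : realType} {d : measure_display} {T : measurableType d}.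
Variable mu : {measure set T -> \bar R}.

(** The term 1 accounts for the heights below [tau], the geometric series of ratio [2 ^ (1 - q)] for
    the dyadic heights above. *)
Definition kolmogorov_cst (q : R) : R := 1 + (1 - 2 `^ (1 - q))^-1.

Lemma two_powR_lt1 (q : R) : 1 < q -> 2 `^ (1 - q) < 1 :> R.
Proof.
move=> q1; rewrite -opprB powRN invf_lt1 ?powR_gt0//.
have : 1 `^ (q - 1) < (2 : R) `^ (q - 1).
  by rewrite gt0_ltr_powR ?nnegrE ?subr_gt0// ltr1n.
by rewrite powR1.
Qed.

Lemma kolmogorov_cst_ge0 (q : R) : 1 < q -> 0 <= kolmogorov_cst q.
Proof.
by move=> /two_powR_lt1 h; rewrite addr_ge0// invr_ge0 subr_ge0 ltW.
Qed.

(** For [q > 1] a weak [L^q] function is integrable on a set of finite measure: its integral is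
    summed over dyadic heights, which contribute a convergent geometric series. *)
Lemma kolmogorov (h : T -> R[i]) (B : set T) (V W q : R) : 1 < q ->
  measurable B -> mu B = V%:E -> 0 < V -> cmeasurable setT h -> 0 <= W ->
  (forall t : R, 0 < t -> (mu [set x | t < cabs (h x)]%R <= ((W / t) `^ q)%:E)%E) ->
  (\int[mu]_(x in B) (cabs (h x))%:E <= (kolmogorov_cst q * W * V `^ (1 - q^-1))%:E)%E.
Proof.
move=> q1 mB BV V0 mh W0 weak; have q0 : 0 < q by exact: lt_trans q1.
have mc : measurable_fun setT (fun x => cabs (h x)) by exact: measurable_cabs.
have [W00|W00] := eqVneq W 0.
  have h0 : {ae mu, forall x, h x = 0}.
    apply: level0_ae => // t t0; apply/eqP; rewrite eq_le measure_ge0 andbT.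
    by apply: (le_trans (weak t t0)); rewrite W00 mul0r powR0// gt_eqF.
  rewrite W00 mulr0 mul0r (@ge0_ae_eq_integral _ _ _ mu B _ (cst 0%E)) ?integral_cst ?mul0e//.
  - by apply/measurable_EFinP; apply: measurable_funS mc.
  - by move=> x _; rewrite lee_fin cabs_ge0.
  - by apply: filterS h0 => x -> _; rewrite cabs0.
have {W0 W00} W0 : 0 < W by rewrite lt_neqAle eq_sym W00.
(* The height at which the weak bound equals [V]; below it, [mu B] is the better bound. *)
pose tau := W * V `^ (- q^-1); have tau0 : 0 < tau by rewrite mulr_gt0// powR_gt0.
pose u (K : nat) x := Num.min (cabs (h x)) (2 ^+ K * tau).
have u0 K x : 0 <= u K x by rewrite /u le_min cabs_ge0 mulr_ge0 ?exprn_ge0// ltW.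
have mu_ K : measurable_fun B (fun x => (u K x)%:E).
  apply/measurable_EFinP; apply: measurable_minr => //.
  by apply: measurable_funS mc.
pose z := 2 `^ (1 - q); have z0 : 0 < z by rewrite powR_gt0.
have z1 : z < 1 by exact: two_powR_lt1.
have z1' : 0 < 1 - z by rewrite subr_gt0.
have E1 : tau * V = W * V `^ (1 - q^-1).
  rewrite /tau -mulrA -{2}[V]powRr1 ?(ltW V0)// -powRD ?(gt_eqF V0) ?implybT//.
  by rewrite addrC.
have E2 k : (2 ^+ k * tau) * (W / (2 ^+ k * tau)) `^ q = z ^+ k * (W * V `^ (1 - q^-1)).
  have -> : W / (2 ^+ k * tau) = (2 ^+ k)^-1 * V `^ (q^-1).
    rewrite /tau powRN; field.
    by rewrite !gt_eqF ?exprn_gt0 ?powR_gt0.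
  rewrite powRM ?invr_ge0 ?exprn_ge0 ?powR_ge0// -powRrM mulVf ?gt_eqF// powRr1 ?(ltW V0)//.
  have -> : z ^+ k = 2 ^+ k * ((2 ^+ k)^-1) `^ q.
    rewrite -[RHS](_ : 2 ^+ k * 2 `^ (- (k%:R * q)) = _); last first.
      congr (_ * _); rewrite -powR_mulrn// -powRN -powRrM; congr (_ `^ _); ring.
    rewrite /z -powR_mulrn ?powR_ge0// -powRrM -[2 ^+ k]powR_mulrn// -powRD ?pnatr_eq0 ?implybT//.
    by congr (_ `^ _); ring.
  rewrite -E1; ring.
(* Raising the cap from [2 ^+ K * tau] to [2 ^+ K.+1 * tau] adds at most [2 ^+ K * tau], and only on
   the set [A], whose measure the weak bound controls. *)
have claim K : (\int[mu]_(x in B) (u K x)%:E <=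
    ((1 + (1 - z ^+ K) / (1 - z)) * (W * V `^ (1 - q^-1)))%:E)%E.
  elim: K => [|K IH].
    rewrite expr0 subrr mul0r addr0 mul1r -E1.
    apply: (@le_trans _ _ (\int[mu]_(x in B) (cst tau%:E) x)%E).
      apply: ge0_le_integral => //.
      - by move=> x _; rewrite lee_fin.
      - by move=> x _; rewrite lee_fin /u expr0 mul1r ge_min lexx orbT.
    by rewrite integral_cst// BV.
  pose A := [set x | 2 ^+ K * tau < cabs (h x)].
  have mA : measurable A by exact: measurable_cabs_gt.
  have c0 : 0 <= 2 ^+ K * tau by rewrite mulr_ge0 ?exprn_ge0// ltW.
  apply: (@le_trans _ _ (\int[mu]_(x in B) ((u K x)%:E + ((2 ^+ K * tau) * \1_A x)%:E))%E).
    apply: ge0_le_integral => //.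
    - by move=> x _; rewrite lee_fin.
    - by apply: emeasurable_funD => //; apply/measurable_EFinP; apply: measurable_funM => //; exact: measurable_indic.
    - move=> x _; rewrite -EFinD lee_fin indicE /u exprS.
      have [xA|xA] := boolP (x \in A).
        move: xA; rewrite inE /A/= => xA; rewrite mulr1 [X in _ <= X + _]min_r ?(ltW xA)//.
        by rewrite ge_min -mulrA mulr_natl mulr2n lexx orbT.
      have xA' : cabs (h x) <= 2 ^+ K * tau.
        by rewrite leNgt; apply/negP => hx; move/negP : xA; apply; rewrite inE.
      by rewrite mulr0 addr0 [leRHS]min_l// ge_min lexx.
  rewrite ge0_integralD//; first last.
  - by apply/measurable_EFinP; apply: measurable_funM => //; exact: measurable_indic.
  - by move=> x _; rewrite lee_fin mulr_ge0// indicE.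
  - by move=> x _; rewrite lee_fin.
  have I2 : (\int[mu]_(x in B) ((2 ^+ K * tau) * \1_A x)%:E <= (z ^+ K * (W * V `^ (1 - q^-1)))%:E)%E.
    under eq_integral do rewrite EFinM.
    rewrite ge0_integralZl_EFin//; last first.
      by apply/measurable_EFinP; exact: measurable_indic.
    rewrite integral_indic// -E2 [X in (_ <= X)%E]EFinM lee_wpmul2l ?lee_fin//.
    apply: le_trans (weak (2 ^+ K * tau) _); last by rewrite mulr_gt0// exprn_gt0.
    by rewrite le_measure ?inE//; exact: measurableI.
  apply: (le_trans (leeD IH I2)); rewrite -EFinD lee_fin -mulrDl.
  rewrite le_eqVlt; apply/orP; left; apply/eqP; congr (_ * _).
  by rewrite exprS; field; exact: lt0r_neq0.
have lim x : limn (fun K => (u K x)%:E) = (cabs (h x))%:E.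
  apply: lim_near_cst => //; exists (Num.truncn (cabs (h x) / tau)) => // K /= HK.
  congr EFin; rewrite /u min_l// -ler_pdivrMr// ltW//.
  apply: (lt_le_trans (truncnS_gt _)); rewrite -natrX ler_nat.
  by apply: (@leq_ltn_trans K) => //; exact: ltn_expl.
have cv := @cvg_monotone_convergence _ _ _ mu B mB (fun K x => (u K x)%:E) mu_
  (fun K x _ => u0 K x : (0 <= (u K x)%:E)%E).
have {cv} cv : (\int[mu]_(x in B) (u K x)%:E)%E @[K --> \oo] --> (\int[mu]_(x in B) (cabs (h x))%:E)%E.
  rewrite (eq_integral (fun x => limn (fun K => (u K x)%:E))); last by move=> x _; rewrite lim.
  apply: cv => x _ K L KL; rewrite lee_fin /u le_min ge_min lexx/= ge_min; apply/orP; right.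
  by rewrite ler_wpM2r ?(ltW tau0)// ler_weXn2l// ler1n.
rewrite -(cvg_lim _ cv)//; apply: lime_le; first by apply/cvg_ex; eexists; exact: cv.
apply: nearW => K; apply: (le_trans (claim K)); rewrite lee_fin -mulrA ler_wpM2r//.
  by rewrite mulr_ge0 ?powR_ge0// ltW.
rewrite /kolmogorov_cst -/z lerD2l ler_piMl ?invr_ge0 ?(ltW z1')//.
by rewrite gerBl exprn_ge0// ltW.
Qed.

End weak_integrability.

(** * Bounded functions and limits *)

Section ae_invariance.
Context {R : realType} {d : measure_display} {T : measurableType d}.
Variable mu : {measure set T -> \bar R}.

Lemma Lpnorm_ae_eq (p : R) (f g : T -> R[i]) : cmeasurable setT f -> cmeasurable setT g ->
  ae_equal mu f g -> Lpnorm mu p%:E f = Lpnorm mu p%:E g.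
Proof.
move=> mf mg fg; rewrite !LpnormE; congr (_ `^ _)%E.
apply: ge0_ae_eq_integral => //.
- exact: measurable_cabs_powR.
- exact: measurable_cabs_powR.
- by move=> x _; rewrite lee_fin powR_ge0.
- by move=> x _; rewrite lee_fin powR_ge0.
- by apply: filterS fg => x -> _.
Qed.

Lemma Lp_ae_eq (p : R) (f g : T -> R[i]) : cmeasurable setT f ->
  ae_equal mu f g -> Lp mu p%:E g -> Lp mu p%:E f.
Proof. by move=> mf fg [mg gp]; split => //; rewrite (Lpnorm_ae_eq p mf mg fg). Qed.

(** The norm of exponent [+oo] unfolds to [ess_sup] on a space of positive measure, which
    [mu setT = +oo] ensures. *)
Lemma Linf_ae_le (f : T -> R[i]) : mu setT = +oo%E -> Lp mu +oo%E f ->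
  {ae mu, forall x, cabs (f x) <= fine (Lpnorm mu +oo%E f)}.
Proof.
move=> muT Lf; have fE := Lpnorm_fine Lf.
have : Lpnorm mu +oo%E f = ess_sup mu (abse \o (EFin \o (fun x => cabs (f x)))).
  by rewrite /Lpnorm Lnorm.unlock muT ltry.
rewrite {1}fE => E; have := ess_sup_ge mu (abse \o (EFin \o (fun x => cabs (f x)))).
rewrite -E; apply: filterS => x /=; rewrite lee_fin.
by rewrite ger0_norm ?cabs_ge0.
Qed.

End ae_invariance.

Section weak_extension_ae.
Context {R : realType} {d : measure_display} {X : borelMetricType R d}.
Variable mu : {sigma_finite_measure set X -> \bar R}.
Context {m : nat}.
Variables (eta : R) (T : ('I_m -> X -> R[i]) -> (X -> R[i]) -> R[i]).
Variables (p : 'I_m -> R) (s : R) (S : ('I_m -> X -> R[i]) -> X -> R[i]).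
Hypotheses (s0 : 0 < s) (p1 : forall i, 1 <= p i).
Hypothesis HS : weak_extension mu eta T p s S.

(** Multilinearity alone does not make [S] compatible with equality almost everywhere. Continuity in
    measure does: the constant sequence [g] has distance 0 from [f]. *)
Lemma weak_extension_ae_eq f g : (forall i, Lp mu (p i)%:E (f i)) ->
  (forall i, Lp mu (p i)%:E (g i)) -> (forall i, ae_equal mu (f i) (g i)) ->
  ae_equal mu (S f) (S g).
Proof.
move=> Lf Lg fg.
have cv : cvg_in_measure mu (fun=> S g) (S f).
  apply: (weak_extension_cvg s0 p1 HS) => // i.
  rewrite (_ : (fun k : nat => _) = cst 0); first exact: cvg_cst.
  apply/funext => k; rewrite (@Lpnorm_ae_eq _ _ _ mu (p i) _ (cst 0)).
  - by rewrite /Lpnorm /= (_ : EFin \o _ = cst 0%E) ?Lnorm0//; [rewrite gt_eqF// lte_fin (lt_le_trans _ (p1 i))|apply/funext => x /=; rewrite cabs0].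
  - by apply: cmeasurableB; [case: (Lg i)|case: (Lf i)].
  - exact: cmeasurable_cst.
  - by apply: filterS (fg i) => x ->; rewrite subrr.
have mS h : (forall i, Lp mu (p i)%:E (h i)) -> cmeasurable setT (S h).
  by case: HS => + _ _ _; exact.
have : {ae mu, forall x, S g x - S f x = 0}.
  apply: level0_ae; first by apply: cmeasurableB; exact: mS.
  by move=> t /cv /cvg_lim <- //; rewrite lim_cst.
by apply: filterS => x /subr0_eq.
Qed.

End weak_extension_ae.

Section Cb_integrability.
Context {R : realType} {d : measure_display} {X : borelMetricType R d}.
Variable mu : {measure set X -> \bar R}.
Hypothesis mu_ball : forall (x : X) r, (mu (ball x r) < +oo)%E.
Hypothesis mu_infinite : mu setT = +oo%E.

Lemma Cb_bsf (x0 : X) eta (f : X -> R[i]) : 0 < eta -> Cb eta f -> bsf x0 f.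
Proof.
move=> eta0 [[x1 [r fr]] fh].
have h0 : (0 <= holder_seminorm eta f)%E.
  have [y hy] := unbounded_space mu_ball mu_infinite x0 1.
  have xy : x0 <> y by move=> E; move: hy; rewrite E mdistxx ler10.
  apply: (@le_trans _ _ (cabs (f x0 - f y) / mdist x0 y `^ eta)%:E).
    by rewrite lee_fin divr_ge0 ?cabs_ge0 ?powR_ge0.
  by apply: ereal_sup_ubound; exists x0, y.
pose C := fine (holder_seminorm eta f).
have CE : holder_seminorm eta f = C%:E by rewrite /C fineK// ge0_fin_numE.
have C0 : 0 <= C by rewrite -lee_fin -CE.
have H x y : cabs (f x - f y) <= C * mdist x y `^ eta.
  have [->|/eqP xy] := eqVneq x y; first by rewrite subrr cabs0 mulr_ge0 ?powR_ge0.
  have D0 : 0 < mdist x y by rewrite mdist_gt0; exact/eqP.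
  rewrite -ler_pdivrMr ?powR_gt0// -lee_fin -CE; apply: ereal_sup_ubound.
  by exists x, y.
split.
  split; apply: (@holder_measurable _ _ _ _ C eta) => // x y; apply: le_trans (H x y).
    by rewrite -cReN -cReD ler_Re_cabs.
  by rewrite -cImN -cImD ler_Im_cabs.
have f0 y : r <= mdist x1 y -> f y = 0.
  move=> ry; apply/eqP; apply/negPn/negP => fy.
  by have := fr y fy; rewrite in_ballE ltNge ry.
(* A point where [f] vanishes; the Hölder condition against it bounds [f]. *)
have [y ry] := unbounded_space mu_ball mu_infinite x1 r.
exists (C * (r + mdist x1 y) `^ eta), (mdist x0 x1 + r); split => x.
  have [rx|rx] := leP r (mdist x1 x).
    by rewrite f0// cabs0 mulr_ge0 ?powR_ge0.
  rewrite -[f x]subr0 -(f0 y ry) (le_trans (H x y))// ler_wpM2l//.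
  have := metric_triangle x x1 y; rewrite (metric_sym x x1) => t.
  have := mdist_ge0 x1 x => t'; have t2 := mdist_ge0 x1 y.
  by rewrite ge0_ler_powR ?nnegrE ?mdist_ge0 ?(ltW eta0)//; lra.
by move=> hx; apply: f0; have := metric_triangle x0 x1 x; move: hx; lra.
Qed.

End Cb_integrability.

Lemma real_cauchy_cvg {R : realType} (w : nat -> R) :
  (forall e, 0 < e -> exists N, forall i j, (N <= i)%N -> (i <= j)%N -> `|w j - w i| <= e) ->
  cvg (w @ \oo).
Proof.
move=> H; apply/cauchy_cvgP/cauchy_exP => e e0.
have [N HN] := H (e / 2) (divr_gt0 e0 (ltr0n _ 2)).
exists (w N); exists N => // j /= Nj; rewrite /ball/= distrC (le_lt_trans (HN _ _ _ Nj))//.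
by rewrite gtr_pMr// invf_lt1 ?ltr1n.
Qed.

Lemma ccauchy_cvg {R : realType} (v : nat -> R[i]) :
  (forall e, 0 < e -> exists N, forall i j, (N <= i)%N -> (i <= j)%N -> cabs (v j - v i) <= e) ->
  exists a, ccvg v a.
Proof.
move=> H.
have /cvg_ex[/= a Ha] : cvg ((@complex.Re R \o v) @ \oo).
  apply: real_cauchy_cvg => e /H[N HN]; exists N => i j Ni ij.
  by rewrite /= -cReN -cReD (le_trans (ler_Re_cabs _))// HN.
have /cvg_ex[/= b Hb] : cvg ((@complex.Im R \o v) @ \oo).
  apply: real_cauchy_cvg => e /H[N HN]; exists N => i j Ni ij.
  by rewrite /= -cImN -cImD (le_trans (ler_Im_cabs _))// HN.
by exists (Complex a b); exact: ccvg_ReIm.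
Qed.

Section measurable_limits.
Context {R : realType} {d : measure_display} {T : measurableType d}.
Variable mu : {measure set T -> \bar R}.

(** The upper limit is measurable and is the limit wherever there is one. *)
Lemma measurable_limit (w : nat -> T -> R) : (forall k, measurable_fun setT (w k)) ->
  exists2 h : T -> R, measurable_fun setT h &
  forall x a, w k x @[k --> \oo] --> a -> h x = a.
Proof.
move=> mw; exists (fun x => fine (limn_esup (fun k => (w k x)%:E))).
  apply: (measurableT_comp (@fine_measurable _ _ measurableT)).
  by apply: measurable_fun_limn_esup => k; apply/measurable_EFinP.
move=> x a wa; have cv : (w k x)%:E @[k --> \oo] --> a%:E by apply: cvg_EFin; [exact: nearW|exact: wa].
by rewrite is_cvg_limn_esupE ?(cvg_lim _ cv)//; apply/cvg_ex; exists a%:E.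
Qed.

Lemma cmeasurable_limit (v : nat -> T -> R[i]) : (forall k, cmeasurable setT (v k)) ->
  exists2 h : T -> R[i], cmeasurable setT h & forall x a, ccvg (v ^~ x) a -> h x = a.
Proof.
move=> mv.
have [h1 m1 H1] := measurable_limit (fun k => (mv k).1).
have [h2 m2 H2] := measurable_limit (fun k => (mv k).2).
exists (fun x => Complex (h1 x) (h2 x)) => // x a va; apply: complex_eq => /=.
  by apply: H1; exact: ccvg_Re.
by apply: H2; exact: ccvg_Im.
Qed.

(* The exceptional null set is allowed to depend on the indices. *)
Definition locally_uniform_limit (B : nat -> set T) (v : nat -> T -> R[i]) h :=
  forall j e, 0 < e -> exists N0 : nat, forall N, (N0 <= N)%N ->
    {ae mu, forall x, B j x -> cabs (v N x - h x) <= e}.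

Lemma locally_uniform_limit_ae B v h : (forall x, exists j, B j x) ->
  locally_uniform_limit B v h -> {ae mu, forall x, ccvg (v ^~ x) (h x)}.
Proof.
move=> Bcov H.
have /choice[N0 HN0] : forall jk : nat * nat, exists N0 : nat, forall N, (N0 <= N)%N ->
    {ae mu, forall x, B jk.1 x -> cabs (v N x - h x) <= jk.2.+1%:R^-1}.
  by move=> [j k]; apply: H; rewrite invr_gt0.
have : {ae mu, forall x (j k N : nat), (N0 (j, k) <= N)%N -> B j x ->
    cabs (v N x - h x) <= k.+1%:R^-1}.
  apply: ae_foralln => j; apply: ae_foralln => k; apply: ae_foralln => N.
  have [NN|NN] := leqP (N0 (j, k)) N; last exact: aeW.
  by apply: filterS (HN0 (j, k) N NN) => x + _; exact.
apply: filterS => x Hx; have [j Bj] := Bcov x.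
apply/cvgrPdist_le => e e0.
have [k ke] := small_invn e0.
exists (N0 (j, k)) => // N /= NN; rewrite sub0r normrN ger0_norm ?cabs_ge0//.
exact: le_trans (Hx j k N NN Bj) ke.
Qed.

(** Countably many null sets are discarded, one for each choice of [j], [k], [N], [N']. At the other
    points the sequence is Cauchy, and letting [N'] tend to infinity keeps the bound. *)
Lemma locally_uniform_cauchy B v : (forall x, exists j, B j x) ->
  (forall k, cmeasurable setT (v k)) ->
  (forall j e, 0 < e -> exists N0 : nat, forall N N', (N0 <= N)%N -> (N <= N')%N ->
    {ae mu, forall x, B j x -> cabs (v N' x - v N x) <= e}) ->
  exists2 h, cmeasurable setT h & locally_uniform_limit B v h.
Proof.
move=> Bcov mv H.
have /choice[N0 HN0] : forall jk : nat * nat, exists N0 : nat,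
    forall N N', (N0 <= N)%N -> (N <= N')%N ->
    {ae mu, forall x, B jk.1 x -> cabs (v N' x - v N x) <= jk.2.+1%:R^-1}.
  by move=> [j k]; apply: H; rewrite invr_gt0.
have Ha : {ae mu, forall x (j k N N' : nat), (N0 (j, k) <= N)%N -> (N <= N')%N -> B j x ->
    cabs (v N' x - v N x) <= k.+1%:R^-1}.
  apply: ae_foralln => j; apply: ae_foralln => k.
  apply: ae_foralln => N; apply: ae_foralln => N'.
  have [NN|NN] := leqP (N0 (j, k)) N; last exact: aeW.
  have [NN'|NN'] := leqP N N'; last exact: aeW.
  by apply: filterS (HN0 (j, k) _ _ NN NN') => y + _ _; exact.
have [h mh hE] := cmeasurable_limit mv; exists h => //.
have cv : {ae mu, forall x, ccvg (v ^~ x) (h x)}.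
  apply: filterS Ha => x Hx; have [j Bj] := Bcov x.
  have [a Ha] : exists a, ccvg (v ^~ x) a.
    apply: ccauchy_cvg => e /small_invn[k ke]; exists (N0 (j, k)) => N N' NN NN'.
    exact: le_trans (Hx j k N N' NN NN' Bj) ke.
  by rewrite (hE _ _ Ha).
move=> j e /small_invn[k ke]; exists (N0 (j, k)) => N NN.
apply: filterS2 Ha cv => x Hx cx Bj; rewrite cabsB.
apply: (@ccvg_le_bound _ (fun i => v (N + i)%N x - v N x)).
  apply: (@ccvg_sub _ (fun i => v i x - v N x) _ (fun i => (N + i)%N)).
    by move=> i; exact: leq_addl.
  rewrite /ccvg (_ : (fun i => _) = fun i => cabs (v i x - h x)) //.
  by apply/funext => i; congr cabs; ring.
by move=> i; apply: le_trans (Hx j k N (N + i)%N NN (leq_addr _ _) Bj) ke.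
Qed.

End measurable_limits.

(** * Oscillation of the truncations *)

Lemma prod_powR {R : realType} (I : Type) (s : seq I) (V : R) (a : I -> R) : 0 < V ->
  \prod_(i <- s) V `^ a i = V `^ (\sum_(i <- s) a i).
Proof.
move=> V0; elim: s => [|i s IH]; first by rewrite !big_nil powRr0.
by rewrite !big_cons powRD ?IH// (gt_eqF V0) implybT.
Qed.

Section oscillation.
Context {R : realType} {d : measure_display} {X : borelMetricType R d}.
Variable mu : {sigma_finite_measure set X -> \bar R}.
Variables C1 C2 C3 kappa n : R.
Hypothesis HRD : RD_space mu C1 C2 C3 kappa n.
Context {m : nat}.
Variable K : m.+1.-tuple X -> R[i].
Variables eps alpha p0 p0' : R.
Hypothesis HK : strongly_singular_kernel mu kappa n K eps alpha p0 p0'.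
Variables (eta : R) (T : ('I_m -> X -> R[i]) -> (X -> R[i]) -> R[i]).
Hypothesis eta01 : 0 < eta <= 1.
Hypothesis TK : has_kernel mu eta T K.
Variable x0 : X.

Let mu_ball := RD_ball_lty HRD.
Let mu_infinite := RD_infinite HRD.
Let alpha_gt0 : 0 < alpha. Proof. by have /andP[] := ssk_alpha HK. Qed.
Let alpha_le1 : alpha <= 1. Proof. by have /andP[] := ssk_alpha HK. Qed.

Local Notation mum := (power_measure mu m).
Local Notation tD D := (if 1 <= D then 1 else alpha).

(** The ratio of the bounds of [annulus_bound] on consecutive annuli. *)
Definition decay : R := 2 `^ (- (eps / alpha)).

Lemma decay_gt0 : 0 < decay. Proof. by rewrite powR_gt0. Qed.

Lemma decay_lt1 : decay < 1.
Proof.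
have e0 : 0 < eps / alpha by rewrite divr_gt0// (ssk_eps HK).
rewrite /decay powRN invf_lt1 ?powR_gt0//.
have : 1 `^ (eps / alpha) < (2 : R) `^ (eps / alpha).
  by rewrite gt0_ltr_powR ?nnegrE// ltr1n.
by rewrite powR1.
Qed.

Lemma decayE k : 2 `^ (- (k%:R * (eps / alpha))) = decay ^+ k.
Proof. by rewrite /decay -powR_mulrn ?powR_ge0// -powRrM mulNr [_ * k%:R]mulrC. Qed.

(** Geometric series over the annuli from [k0] to [k0 + N]. The bound does not depend on [N], hence
    not on the size of the support of [h]. *)
Lemma kernel_tail : exists2 C : R, 0 <= C & forall (x x' : X) (k0 N : nat)
    (h : m.-tuple X -> R[i]), x <> x' -> (0 < k0)%N -> cmeasurable setT h ->
  (forall y : m.-tuple X, cabs (h y) <= cabs (K [tuple of x :: y] - K [tuple of x' :: y])) ->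
  let r := mdist x x' `^ tD (mdist x x') in
  (forall y : m.-tuple X, h y <> 0 -> 2 ^+ k0 * r <= rho y x <= 2 ^+ (k0 + N).+1 * r) ->
  (\int[mum]_y (cabs (h y))%:E <= (C * decay ^+ k0)%:E)%E.
Proof.
have [C C0 HC] := annulus_bound HRD HK.
have z0 := decay_gt0; have z1 := decay_lt1; have z1' : 0 < 1 - decay by rewrite subr_gt0.
exists (C / (1 - decay)); first by rewrite divr_ge0// ltW.
move=> x x' k0 N h xx' k00 mh hK r hr.
have D0 : 0 < mdist x x' by rewrite mdist_gt0; exact/eqP.
have r0 : 0 < r by rewrite powR_gt0.
pose E M := [set y : m.-tuple X | 2 ^+ k0 * r <= rho y x <= 2 ^+ (k0 + M).+1 * r].
have mE M : measurable (E M) by exact: measurable_annulus.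
have mch : measurable_fun setT (fun y : m.-tuple X => (cabs (h y))%:E).
  exact/measurable_EFinP/measurable_cabs.
have claim M : (\int[mum]_(y in E M) (cabs (h y))%:E <=
    (C * decay ^+ k0 * ((1 - decay ^+ M.+1) / (1 - decay)))%:E)%E.
  elim: M => [|M IH].
    rewrite expr1 divff ?gt_eqF// mulr1 -decayE /E addn0.
    by apply: HC.
  pose A := [set y : m.-tuple X | 2 ^+ (k0 + M).+1 * r <= rho y x <= 2 ^+ (k0 + M).+2 * r].
  have mA : measurable A by exact: measurable_annulus.
  apply: (@le_trans _ _ (\int[mum]_(y in E M `|` A) (cabs (h y))%:E)%E).
    apply: ge0_subset_integral => //.
    - exact: measurableU.
    - by apply: measurable_funS mch.
    - by move=> y _; rewrite lee_fin cabs_ge0.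
    - move=> y; rewrite /E/= addnS => /andP[h1 h2].
      have [h3|h3] := leP (rho y x) (2 ^+ (k0 + M).+1 * r); first by left; apply/andP.
      by right; apply/andP; split => //; exact: ltW.
  have h0 (y : m.-tuple X) : (0 <= (cabs (h y))%:E)%E by rewrite lee_fin cabs_ge0.
  apply: (le_trans (ge0_integral_setU_le mum (mE M) mA mch h0)).
  apply: (@le_trans _ _ ((C * decay ^+ k0 * ((1 - decay ^+ M.+1) / (1 - decay)))%:E +
    (C * decay ^+ (k0 + M).+1)%:E)%E).
    by apply: leeD => //; rewrite -decayE; apply: HC.
  rewrite -EFinD lee_fin le_eqVlt; apply/orP; left; apply/eqP.
  rewrite -addnS exprD [decay ^+ M.+2]exprS; field; exact: lt0r_neq0.
have -> : (\int[mum]_y (cabs (h y))%:E = \int[mum]_(y in E N) (cabs (h y))%:E)%E.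
  rewrite [RHS]integral_mkcond; apply: eq_integral => y _; rewrite /patch; case: ifPn => // yE.
  have [->|/eqP hy] := eqVneq (h y) 0; first by rewrite cabs0.
  by exfalso; move/negP: yE; apply; rewrite inE; exact: hr.
apply: (le_trans (claim N)); rewrite lee_fin [leRHS]mulrAC.
rewrite ler_wpM2l ?mulr_ge0 ?exprn_ge0 ?(ltW z0)//.
by rewrite ler_piMl ?invr_ge0 ?(ltW z1')// gerBl exprn_ge0// ltW.
Qed.

Lemma ae_ball_witness (x1 : X) (a : R) (P : X -> Prop) : 0 < a ->
  {ae mu, forall x, P x} -> exists2 x, ball x1 a x & P x.
Proof.
move=> a0 aeP; apply: contrapT => H.
have mB0 : mu (ball x1 a) = 0%E.
  apply: ae_measure_eq0 aeP _; first exact: measurable_ballX.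
  by move=> x xa Px; apply: H; exists x.
by have := vol_gt0 HRD x1 a0; rewrite /vol [X in fine X]mB0 ltxx.
Qed.

Definition bounded_by (M : 'I_m -> R) (g : 'I_m -> X -> R[i]) :=
  (forall i, bsf x0 (g i)) /\ (forall i x, cabs (g i x) <= M i).

Lemma bounded_by_ge0 M g i : bounded_by M g -> 0 <= M i.
Proof. by move=> [_ gM]; rewrite (le_trans _ (gM i x0))// cabs_ge0. Qed.

Lemma prod_bound_ge0 M g : bounded_by M g -> 0 <= \prod_(i < m) M i.
Proof. by move=> gM; apply: prodr_ge0 => i _; exact: bounded_by_ge0 gM. Qed.

(** Origin of the 5: two points of a ball of radius [a] have distance [D < 2 * a], whence [2 * D^t]
    is at most 4 times the power of [a] chosen here; passing from a point of the ball to its centre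
    costs another [a]. *)
Definition outer_radius (a : R) := 5 * (if a <= 1 then a `^ alpha else a).

Lemma outer_radius_gt a : 0 < a -> a < outer_radius a.
Proof.
move=> a0; rewrite /outer_radius; case: ifPn => a1.
  have : a <= a `^ alpha by rewrite ger1_powR// a0.
  by have := powR_gt0 alpha a0; lra.
lra.
Qed.

Section one_extension.
Variables (p : 'I_m -> R) (s : R) (S : ('I_m -> X -> R[i]) -> X -> R[i]).
Hypothesis s0 : 0 < s.
Hypothesis p1 : forall i, 1 <= p i.
Hypothesis HS : weak_extension mu eta T p s S.

Let p_gt0 i : 0 < p i. Proof. exact: lt_le_trans (p1 i). Qed.

(** On [ball x1 a] the difference [S g - S gQ] is the kernel integral of [G], and [G y] vanishes
    unless some entry of [y] lies outside [ball x1 c]. The values at two points thus differ by an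
    integral of the difference of the kernels over [rho y x >= c - a], to which [kernel_tail]
    applies. The index [k0] is free: 1 serves the oscillation on a fixed ball, large values the
    convergence of the truncations. *)
Lemma kernel_oscillation : exists2 C : R, 0 <= C &
  forall (g : 'I_m -> X -> R[i]) (M : 'I_m -> R) (x1 : X) (a c : R) (k0 : nat),
  (forall i, bsf x0 (g i)) -> (forall i x, cabs (g i x) <= M i) ->
  0 < a -> a < c -> (0 < k0)%N ->
  (forall D : R, 0 < D -> D < 2 * a -> 2 ^+ k0 * D `^ tD D <= c - a) ->
  exists z : R[i], {ae mu, forall x, ball x1 a x ->
    cabs (S g x - S (fun i => crestrict (ball x1 c) (g i)) x - z) <=
      C * decay ^+ k0 * \prod_(i < m) M i}.
Proof.
have [C C0 HC] := kernel_tail; exists (2 * C); first by rewrite mulr_ge0.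
move=> g M x1 a c k0 bg gM a0 ac k00 hD.
pose gQ i := crestrict (ball x1 c) (g i).
pose G (y : m.-tuple X) := \prod_(i < m) g i (tnth y i) - \prod_(i < m) gQ i (tnth y i).
have rep : {ae mu, forall x, ball x1 a x ->
    cintegrable mum setT (fun y : m.-tuple X => K [tuple of x :: y] * G y) /\
    S g x - S gQ x = cintegral mum setT (fun y : m.-tuple X => K [tuple of x :: y] * G y)}.
  exact: (@kernel_representation _ _ _ mu (RD_ball_lty HRD) (RD_infinite HRD) (RD_regular HRD)
    eta eta01 m T K TK x0 p s S s0 p1 HS g x1 a c ac bg).
have M0 i : 0 <= M i by rewrite (le_trans _ (gM i x0))// cabs_ge0.
set P := \prod_(i < m) M i; have P0 : 0 <= P by apply: prodr_ge0.
have Gfar (y : m.-tuple X) : G y <> 0 -> exists2 i, ~ ball x1 c (tnth y i) &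
    G y = \prod_(i < m) g i (tnth y i).
  move=> Gy; have [[i yi]|H] := pselect (exists i, ~ ball x1 c (tnth y i)).
    exists i => //; rewrite /G [X in _ - X](bigD1 i)//= [X in _ - X * _]crestrict_out//.
    by rewrite mul0r subr0.
  exfalso; apply: Gy; rewrite /G [X in _ - X](_ : _ = \prod_(i < m) g i (tnth y i)) ?subrr//.
  apply: eq_bigr => i _; rewrite /gQ crestrict_in//.
  by apply: contrapT => h; apply: H; exists i.
have GP (y : m.-tuple X) : cabs (G y) <= P.
  have [->|/eqP Gy] := eqVneq (G y) 0; first by rewrite cabs0.
  have [_ _ ->] := Gfar y Gy; rewrite cabs_prod; apply: ler_prod => i _.
  by rewrite cabs_ge0 gM.
(* The constant [z] is the value of the difference at this point. *)
have [x' x'a Hx'] := ae_ball_witness x1 a0 rep.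
have [i2 e2] := Hx' x'a.
exists (S g x' - S gQ x'); apply: filterS rep => x Hx xa; have [i1 e1] := Hx xa.
have [->|/eqP xx'] := eqVneq x x'.
  by rewrite subrr cabs0 !mulr_ge0// exprn_ge0// ltW// decay_gt0.
rewrite e1 e2 -cintegralB//.
have mh0 := cintegrable_cmeasurable (cintegrableB measurableT i1 i2).
have [P00|/eqP P00] := eqVneq P 0.
  rewrite (_ : (fun y => _) = cst 0); last first.
    apply/funext => y; rewrite (_ : G y = 0) ?mulr0 ?subrr//.
    by apply: cabs0_eq0; apply/eqP; rewrite eq_le cabs_ge0 andbT -P00.
  rewrite P00 mulr0; have := @cabs_cintegral_le _ _ _ mum setT (cst 0) 0 measurableT
    (cmeasurable_cst _ _); rewrite mulr0; apply.
  by rewrite integral0_eq// => y _; rewrite cabs0.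
have Pgt0 : 0 < P by rewrite lt_neqAle P0 andbT eq_sym; exact/eqP.
(* Division by [P] produces the bound by the difference of the kernels that [kernel_tail] expects;
   the case [P = 0] is settled above. *)
pose h (y : m.-tuple X) : R[i] := (P^-1)%:C%C * (K [tuple of x :: y] * G y - K [tuple of x' :: y] * G y).
have mh : cmeasurable setT h by apply: cmeasurableM => //; exact: cmeasurable_cst.
have hK (y : m.-tuple X) : cabs (h y) <= cabs (K [tuple of x :: y] - K [tuple of x' :: y]).
  rewrite /h -mulrBl cabsM cabs_real ger0_norm ?invr_ge0// cabsM mulrCA ler_piMr ?cabs_ge0//.
  by rewrite mulrC ler_pdivrMr// mul1r.
have xD : mdist x x' < 2 * a.
  move: xa x'a; rewrite !in_ballE => h1 h2.
  by have := metric_triangle x x1 x'; rewrite (metric_sym x x1); lra.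
have D0 : 0 < mdist x x' by rewrite mdist_gt0; exact/eqP.
set r := mdist x x' `^ tD (mdist x x').
have r0 : 0 < r by rewrite powR_gt0.
have /choice[Z HZ] : forall i, exists N : R, forall y, N <= mdist x0 y -> g i y = 0.
  by move=> i; have [_ [_ [N [_ H]]]] := bg i; exists N.
pose B := \big[Num.max/0]_(i < m) Z i + mdist x0 x.
(* The [g i] have bounded supports, so finitely many annuli cover the support of [h]. *)
have [N HN] : exists N : nat, B <= 2 ^+ (k0 + N).+1 * r.
  exists (Num.truncn (B / r)); rewrite -ler_pdivrMr// ltW//.
  apply: (lt_trans (truncnS_gt _)).
  rewrite -natrX ltr_nat; apply: (@leq_trans (2 ^ (Num.truncn (B / r)).+1)); first exact: ltn_expl.
  by rewrite leq_exp2l// ltnS leq_addl.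
have supp_h (y : m.-tuple X) : h y <> 0 -> 2 ^+ k0 * r <= rho y x <= 2 ^+ (k0 + N).+1 * r.
  move=> hy; have Gy : G y <> 0 by move=> Gy; apply: hy; rewrite /h Gy !mulr0 subrr mulr0.
  have [i yi GE] := Gfar y Gy; apply/andP; split.
    apply: (le_trans (hD _ D0 xD)); apply: le_trans (mdist_le_rho y x i).
    move: yi; rewrite in_ballE => /negP; rewrite -leNgt => yi.
    move: xa; rewrite in_ballE => xa; have := metric_triangle x1 x (tnth y i).
    by rewrite (metric_sym x (tnth y i)); lra.
  apply: le_trans HN; apply: rho_le; first by rewrite addr_ge0 ?mdist_ge0// bigmax_idl le_max lexx.
  move=> j; have gj : mdist x0 (tnth y j) < Z j.
    rewrite ltNge; apply/negP => /HZ gj; apply: Gy; rewrite GE (bigD1 j)//= gj mul0r//.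
  rewrite (le_trans (metric_triangle _ x0 _))// /B lerD// metric_sym (le_trans (ltW gj))//.
  exact: (@le_bigmax _ _ _ 0 Z).
have := HC x x' k0 N h xx' k00 mh hK supp_h => bound.
rewrite -mulrA -[leRHS]mulrA; apply: cabs_cintegral_le => //.
have -> : (\int[mum]_y (cabs (K [tuple of x :: y] * G y - K [tuple of x' :: y] * G y))%:E =
    \int[mum]_y (P%:E * (cabs (h y))%:E))%E.
  apply: eq_integral => y _; rewrite -EFinM /h cabsM cabs_real ger0_norm ?invr_ge0//.
  by rewrite mulrA divff ?gt_eqF// mul1r.
rewrite ge0_integralZl_EFin//; last 2 first.
- by move=> y _; rewrite lee_fin cabs_ge0.
- exact/measurable_EFinP/measurable_cabs.
rewrite (_ : C * (decay ^+ k0 * P) = P * (C * decay ^+ k0)); last by ring.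
by rewrite EFinM lee_wpmul2l// lee_fin.
Qed.

Section local_part.
Variable sigma : R.
Hypothesis sigmaE : sigma = \sum_(i < m) (p i)^-1.

Lemma local_weak : exists2 C : R, 0 <= C & forall M g x c, bounded_by M g -> 0 < c ->
  forall t, 0 < t ->
  (mu [set y | (t < cabs (S (fun i => crestrict (ball x c) (g i)) y))%R] <=
    ((C * \prod_(i < m) M i * vol mu x c `^ sigma / t) `^ s)%:E)%E.
Proof.
have [C C0 HC] := weak_level s0 HS; exists C => // M g x c [bg gM] c0 t t0.
have mQ : measurable (ball x c) by exact: measurable_ballX.
have V0 := vol_gt0 HRD x c0.
have M0 i : 0 <= M i by exact: (@bounded_by_ge0 M g).
have H i : Lp mu (p i)%:E (crestrict (ball x c) (g i)) /\
    fine (Lpnorm mu (p i)%:E (crestrict (ball x c) (g i))) <= M i * (vol mu x c) `^ (p i)^-1.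
  apply: Lpnorm_bounded => //.
  - by have [] := bsf_crestrict mQ (bg i).
  - by move=> y; rewrite (le_trans (cabs_crestrict_le _ _ _)).
  - by move=> y; exact: crestrict_out.
apply: (le_trans (HC _ (fun i => (H i).1) t t0)); rewrite lee_fin ge0_ler_powR ?(ltW s0)//.
- rewrite nnegrE divr_ge0 ?(ltW t0)// mulr_ge0// prodr_ge0// => i _; exact: fine_Lpnorm_ge0.
- by rewrite nnegrE divr_ge0 ?(ltW t0)// mulr_ge0 ?powR_ge0// mulr_ge0// prodr_ge0.
- rewrite ler_wpM2r ?invr_ge0 ?(ltW t0)// -mulrA ler_wpM2l//.
  rewrite sigmaE -prod_powR// -big_split/= ler_prod// => i _.
  by rewrite fine_Lpnorm_ge0 (H i).2.
Qed.

Lemma bsf_S_cmeasurable f : (forall i, bsf x0 (f i)) -> cmeasurable setT (S f).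
Proof. by move=> bf; case: HS => + _ _ _; apply => i; exact: bsf_Lp. Qed.

Lemma bounded_by_crestrict M g Q : measurable Q -> bounded_by M g ->
  bounded_by M (fun i => crestrict Q (g i)).
Proof.
move=> mQ [bg gM]; split; first by move=> i; exact: bsf_crestrict.
by move=> i x; rewrite (le_trans (cabs_crestrict_le _ _ _)).
Qed.

(** [kolmogorov] bounds the integral by the outer volume to the power [sigma] times the inner volume
    to the power [1 - s^-1]. The comparison of the two volumes is left to [Lam], since it is made
    differently for small and for intermediate radii. *)
Lemma local_integral : 1 < s -> exists2 C : R, 0 <= C & forall M g x a c Lam,
  bounded_by M g -> 0 < a -> 0 < c -> 0 <= Lam ->
  vol mu x c `^ sigma <= Lam * vol mu x a `^ (s^-1) ->
  (\int[mu]_(y in ball x a) (cabs (S (fun i => crestrict (ball x c) (g i)) y))%:E <=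
    (C * Lam * \prod_(i < m) M i * vol mu x a)%:E)%E.
Proof.
move=> s1; have [C C0 HC] := local_weak; have k0 := kolmogorov_cst_ge0 s1.
exists (kolmogorov_cst s * C); first by rewrite mulr_ge0.
move=> M g x a c Lam gM a0 c0 Lam0 HLam.
have mQ : measurable (ball x c) by exact: measurable_ballX.
have P0 := prod_bound_ge0 gM; have V0 := vol_gt0 HRD x a0.
have W0 : 0 <= C * \prod_(i < m) M i * vol mu x c `^ sigma by rewrite !mulr_ge0 ?powR_ge0.
have := kolmogorov s1 (measurable_ballX x a) (muE HRD x a) V0
  (bsf_S_cmeasurable (bounded_by_crestrict mQ gM).1) W0 (HC M g x c gM c0).
move=> /le_trans; apply; rewrite lee_fin.
set P := \prod_(i < m) M i.
have E : vol mu x a `^ (s^-1) * vol mu x a `^ (1 - s^-1) = vol mu x a.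
  by rewrite -powRD ?(gt_eqF V0) ?implybT// addrC subrK powRr1// ltW.
rewrite -[in leRHS]E.
rewrite (_ : kolmogorov_cst s * (C * P * _) * _ =
  (kolmogorov_cst s * C * P * vol mu x a `^ (1 - s^-1)) * vol mu x c `^ sigma); last by ring.
rewrite (_ : kolmogorov_cst s * C * Lam * P * _ =
  (kolmogorov_cst s * C * P * vol mu x a `^ (1 - s^-1)) * (Lam * vol mu x a `^ s^-1)); last by ring.
by rewrite ler_wpM2l// !mulr_ge0 ?powR_ge0.
Qed.

End local_part.

Lemma kernel_osc : exists2 C : R, 0 <= C & forall M g x a, bounded_by M g -> 0 < a ->
  exists z : R[i], {ae mu, forall y, ball x a y ->
    cabs (S g y - S (fun i => crestrict (ball x (outer_radius a)) (g i)) y - z) <=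
      C * \prod_(i < m) M i}.
Proof.
have [C C0 HC] := kernel_oscillation.
exists (C * decay ^+ 1); first by rewrite mulr_ge0// exprn_ge0// powR_ge0.
move=> M g x a [bg gM] a0.
apply: (HC g M x a (outer_radius a) 1%N) => //; first exact: outer_radius_gt.
move=> D D0 Da; rewrite expr1 /outer_radius; have [a1|a1'] := leP a 1.
- have aa : a <= a `^ alpha by apply: ger1_powR => //; rewrite a0 a1.
  suff : 2 * D `^ (if 1 <= D then 1 else alpha) <= 4 * a `^ alpha by lra.
  case: ifPn => D1; first by rewrite powRr1 ?(ltW D0)//; lra.
  apply: (@le_trans _ _ (2 * (2 * a) `^ alpha)).
    by rewrite ler_wpM2l// ge0_ler_powR ?nnegrE ?(ltW D0) ?(ltW Da)// ?mulr_ge0 ?(ltW a0) ?(ltW alpha_gt0).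
  rewrite powRM ?(ltW a0)// mulrA ler_wpM2r ?powR_ge0//.
  have : (2 : R) `^ alpha <= 2 `^ 1 by rewrite ler_powR// ler1n.
  by rewrite powRr1//; lra.
- case: ifPn => D1; first by rewrite powRr1 ?(ltW D0)//; lra.
  have : D `^ alpha <= D `^ 0 by rewrite ger_powR// ?D0 ?ltW// ltNge.
  by rewrite powRr0; lra.
Qed.

(** The radii start at 1, so that a base point in the unit ball belongs to every member. *)
Definition exhaustion (j : nat) : set X := ball x0 j.+1%:R.

Local Notation B := exhaustion.
Lemma exhaustion_cover x : exists j, B j x.
Proof. by exists (Num.truncn (mdist x0 x)); rewrite /exhaustion in_ballE truncnS_gt. Qed.

Lemma crestrict_bsf (Q : set X) (N M : R) (f : X -> R[i]) : measurable Q -> Q `<=` ball x0 N ->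
  cmeasurable setT f -> (forall x, cabs (f x) <= M) -> bsf x0 (crestrict Q f).
Proof.
move=> mQ QN mf fM; split.
  by apply: cmeasurableM => //; exact: cmeasurable_indic.
exists M, N; split => x; first by rewrite (le_trans (cabs_crestrict_le _ _ _)).
by move=> Nx; rewrite crestrict_out// => /QN; rewrite in_ballE ltNge Nx.
Qed.

Definition partial (f : 'I_m -> X -> R[i]) (N : nat) : X -> R[i] :=
  S (fun i => crestrict (ball x0 N%:R) (f i)).

(** [kernel_oscillation] with [N] as the radius [c] and with [k0] so large that the tail is below
    [e]: enlarging the truncation beyond [N] changes the value on [B j] by a constant, up to [e]. *)
Lemma partial_osc (f : 'I_m -> X -> R[i]) (M : 'I_m -> R) :
  (forall i, cmeasurable setT (f i)) -> (forall i x, cabs (f i x) <= M i) ->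
  forall j e, 0 < e -> exists N0 : nat, forall N N', (N0 <= N)%N -> (N <= N')%N ->
  exists z : R[i], {ae mu, forall x, B j x -> cabs (partial f N' x - partial f N x - z) <= e}.
Proof.
move=> mf fM j e e0.
have [C C0 HC] := kernel_oscillation.
have [k0 k00 Hk] : exists2 k0 : nat, (0 < k0)%N &
    C * decay ^+ k0 * \prod_(i < m) M i <= e.
  have cv : C * decay ^+ k * \prod_(i < m) M i @[k --> \oo] --> (0 : R).
    rewrite -(mul0r (\prod_(i < m) M i)) -(mulr0 C); apply: cvgMl; apply: cvgMr.
    by apply: cvg_expr; rewrite ger0_norm; [exact: decay_lt1|exact: powR_ge0].
  have [k1 _ Hk1] := @cvgr0_norm_le _ _ _ _ _ _ cv e e0.
  exists k1.+1 => //; by apply: (le_trans (ler_norm _)); apply: (Hk1 k1.+1) => /=.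
pose a : R := j.+1%:R; have a1 : 1 <= a by rewrite ler1n.
(* Chosen for [2 ^+ k0 * D^t <= N - a] to hold whenever [D < 2 * a]; there [D^t <= 2 * a] because
   [a >= 1]. *)
exists (j.+1 + 2 ^ k0 * (2 * j.+1))%N => N N' NN NN'.
have aN : a + 2 ^+ k0 * (2 * a) <= N%:R by rewrite -(ler_nat R) natrD natrM natrX natrM in NN.
have mB (N1 : nat) : measurable (ball x0 (N1%:R : R)) by exact: measurable_ballX.
have k2 : 0 < 2 ^+ k0 :> R by rewrite exprn_gt0.
have aN' : a < N%:R.
  by apply: lt_le_trans aN; rewrite ltrDl !mulr_gt0//; exact: lt_le_trans a1.
have hD D : 0 < D -> D < 2 * a -> 2 ^+ k0 * D `^ (if 1 <= D then 1 else alpha) <= N%:R - a.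
  move=> D0 D2; rewrite lerBrDl (le_trans _ aN)// lerD2l ler_wpM2l ?(ltW k2)//.
  case: ifPn => D1; first by rewrite powRr1 ltW.
  apply: (@le_trans _ _ 1); last by move: a1; lra.
  rewrite -(powRr0 D) ger_powR ?(ltW alpha_gt0)// D0/= ltW// ltNge//.
have [z Hz] := HC (fun i => crestrict (ball x0 N'%:R) (f i)) M x0 a N%:R k0
  (fun i => crestrict_bsf (mB N') (@subset_refl _ _) (mf i) (fM i))
  (fun i x => le_trans (cabs_crestrict_le _ _ _) (fM i x))
  (lt_le_trans ltr01 a1) aN' k00 hD.
exists z; apply: filterS Hz => x Hx /Hx /le_trans; move=> /(_ _ Hk).
rewrite /partial (_ : (fun i => crestrict _ (crestrict _ _)) = fun i => crestrict (ball x0 N%:R) (f i))//.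
apply/funext => i; apply/funext => y.
have [By|By] := pselect (ball x0 (N%:R : R) y); last by rewrite !crestrict_out.
rewrite !crestrict_in//; by apply: ball_sub By; rewrite mdistxx add0r ler_nat.
Qed.

(** The constants of [partial_osc] depend on [N] and [N']. They cancel when the value at one point
    [xs], at which all the estimates hold, is subtracted; the truncations so normalised are Cauchy
    uniformly on each [B j], off null sets. *)
Lemma partial_limit_bounded (f : 'I_m -> X -> R[i]) (M : 'I_m -> R) :
  (forall i, cmeasurable setT (f i)) -> (forall i x, cabs (f i x) <= M i) ->
  exists (c : nat -> R[i]) h, cmeasurable setT h /\
    locally_uniform_limit mu B (fun N x => partial f N x - c N) h.
Proof.
move=> mf fM.
have mP N : cmeasurable setT (partial f N).
  apply: (bsf_S_cmeasurable) => i.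
  exact: (crestrict_bsf (measurable_ballX _ _) (@subset_refl _ _) (mf i) (fM i)).
have /choice[N0 HN0] : forall jk : nat * nat, exists N0 : nat, forall N N', (N0 <= N)%N -> (N <= N')%N ->
    exists z : R[i], {ae mu, forall x, B jk.1 x ->
      cabs (partial f N' x - partial f N x - z) <= jk.2.+1%:R^-1}.
  by move=> [j k]; apply: (partial_osc mf fM); rewrite invr_gt0.
(* The constants are fixed before the null sets are united; the value 0 is a default for indices out
   of range. *)
have /choice[z Hz] : forall q : (nat * nat) * (nat * nat), exists z : R[i],
    (N0 q.1 <= q.2.1)%N -> (q.2.1 <= q.2.2)%N -> {ae mu, forall x, B q.1.1 x ->
      cabs (partial f q.2.2 x - partial f q.2.1 x - z) <= q.1.2.+1%:R^-1}.
  move=> [jk [N N']] /=; have [h|h] := pselect ((N0 jk <= N)%N /\ (N <= N')%N).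
    by have [z Hz] := HN0 jk N N' h.1 h.2; exists z.
  by exists 0 => h1 h2; exfalso; apply: h.
have Ha : {ae mu, forall x (j k N N' : nat), (N0 (j, k) <= N)%N -> (N <= N')%N -> B j x ->
    cabs (partial f N' x - partial f N x - z ((j, k), (N, N'))) <= k.+1%:R^-1}.
  apply: ae_foralln => j; apply: ae_foralln => k.
  apply: ae_foralln => N; apply: ae_foralln => N'.
  have [NN|NN] := leqP (N0 (j, k)) N; last exact: aeW.
  have [NN'|NN'] := leqP N N'; last exact: aeW.
  by apply: filterS (Hz ((j, k), (N, N')) NN NN') => y + _ _; exact.
have [xs xs1 Hxs] := ae_ball_witness x0 ltr01 Ha.
exists (fun N => partial f N xs).
suff [h mh Hh] : exists2 h, cmeasurable setT h &
    locally_uniform_limit mu B (fun N x => partial f N x - partial f N xs) h by exists h.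
apply: (locally_uniform_cauchy exhaustion_cover).
  by move=> N; exact: cmeasurableBc.
move=> j e e0.
have [k ke] := small_invn (divr_gt0 e0 (ltr0n _ 2)).
exists (N0 (j, k)) => N N' NN NN'; apply: filterS Ha => x Hx Bj.
have Bxs : B j xs by apply: ball_sub xs1; rewrite mdistxx add0r ler1n.
have h1 := Hx j k N N' NN NN' Bj; have h2 := Hxs j k N N' NN NN' Bxs.
rewrite (_ : _ - _ - _ = (partial f N' x - partial f N x - z (j, k, (N, N'))) -
  (partial f N' xs - partial f N xs - z (j, k, (N, N')))); last by ring.
by rewrite (le_trans (ler_cabsB _ _))// [leRHS]splitr lerD// ?(le_trans h1)// (le_trans h2).
Qed.

(** The kernel estimates ask for bounds at every point, which a suitable representative of [f]
    satisfies. *)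
Lemma Linf_clamp (f : X -> R[i]) : Lp mu +oo%E f -> exists g,
  [/\ cmeasurable setT g, forall x, cabs (g x) <= fine (Lpnorm mu +oo%E f) &
    ae_equal mu f g].
Proof.
move=> Lf; have [mf _] := Lf; set M := fine _.
have M0 : 0 <= M by exact: fine_Lpnorm_ge0.
exists (crestrict [set y | cabs (f y) <= M] f); split.
- apply: cmeasurableM => //; apply: cmeasurable_indic.
  rewrite (_ : [set y | _] = ~` [set y | M < cabs (f y)]).
    by apply: measurableC; exact: measurable_cabs_gt.
  by apply/seteqP; split => y /=; rewrite leNgt => /negP.
- move=> x; have [h|h] := pselect (cabs (f x) <= M).
    by rewrite crestrict_in.
  by rewrite crestrict_out// cabs0.
- by apply: filterS (Linf_ae_le mu_infinite Lf) => x h; rewrite crestrict_in.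
Qed.

Lemma Linf_crestrict_Lp (p' : R) (f : X -> R[i]) (N : R) : 0 < p' -> Lp mu +oo%E f ->
  Lp mu p'%:E (crestrict (ball x0 N) f).
Proof.
move=> p'0 Lf; have [mf _] := Lf; have [g [mg gM fg]] := Linf_clamp Lf.
have mB : measurable (ball x0 N) by exact: measurable_ballX.
apply: (@Lp_ae_eq _ _ _ mu p' _ (crestrict (ball x0 N) g)).
- by apply: cmeasurableM => //; exact: cmeasurable_indic.
- by apply: filterS fg => x E; rewrite /crestrict E.
- apply: (bsf_Lp mu_ball (x0 := x0)) => //.
  exact: (crestrict_bsf mB (@subset_refl _ _) mg gM).
Qed.

Lemma partial_ae_eq (f g : 'I_m -> X -> R[i]) N : (forall i, Lp mu +oo%E (f i)) ->
  (forall i, Lp mu +oo%E (g i)) -> (forall i, ae_equal mu (f i) (g i)) ->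
  ae_equal mu (partial f N) (partial g N).
Proof.
move=> Lf Lg fg.
apply: (weak_extension_ae_eq s0 p1 HS) => i; [exact: Linf_crestrict_Lp..|].
by apply: filterS (fg i) => x E; rewrite /crestrict E.
Qed.

(** A limit modulo constants, hence itself determined only up to a constant and a null set. The
    normalisation [c] stays existential because [BMOnorm] does not see it. *)
Definition limit_mod (f : 'I_m -> X -> R[i]) (h : X -> R[i]) :=
  cmeasurable setT h /\ exists c : nat -> R[i],
    locally_uniform_limit mu B (fun N x => partial f N x - c N) h.

Lemma limit_mod_ae f h : limit_mod f h ->
  exists c : nat -> R[i], {ae mu, forall x, ccvg (fun N => partial f N x - c N) (h x)}.
Proof.
move=> [_ [c Hc]]; exists c.
exact: (locally_uniform_limit_ae (exhaustion_cover) Hc).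
Qed.

Lemma limit_mod_cst f h h' (c : R[i]) : limit_mod f h -> cmeasurable setT h' ->
  {ae mu, forall x, h' x = h x + c} -> limit_mod f h'.
Proof.
move=> [_ [c' Hc']] mh' hh'; split=> //; exists (fun N => c' N - c) => j e e0.
have [N0 HN0] := Hc' j e e0; exists N0 => N NN.
apply: filterS2 (HN0 N NN) hh' => x Hx -> Bj.
by rewrite (_ : _ - _ - _ = partial f N x - c' N - h x) ?Hx//; ring.
Qed.

Lemma limit_mod_ae_eq f g h : (forall i, Lp mu +oo%E (f i)) ->
  (forall i, Lp mu +oo%E (g i)) -> (forall i, ae_equal mu (f i) (g i)) ->
  limit_mod f h -> limit_mod g h.
Proof.
move=> Lf Lg fg [mh [c Hc]]; split => //; exists c => j e e0.
have [N0 HN0] := Hc j e e0; exists N0 => N NN.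
by apply: filterS2 (HN0 N NN) (partial_ae_eq N Lf Lg fg) => x Hx <-.
Qed.

Lemma Linf_bounded (g : X -> R[i]) (M : R) : cmeasurable setT g ->
  {ae mu, forall x, cabs (g x) <= M} -> Lp mu +oo%E g.
Proof.
move=> mg gM; split => //.
rewrite /Lpnorm Lnorm.unlock mu_infinite ltry; apply: (@le_lt_trans _ _ M%:E); last exact: ltry.
apply/ess_supP; apply: filterS gM => x gM /=; rewrite lee_fin.
by rewrite ger0_norm ?cabs_ge0.
Qed.

Lemma LinfZD (a : R[i]) (f g : X -> R[i]) : Lp mu +oo%E f -> Lp mu +oo%E g ->
  Lp mu +oo%E (fun x => a * f x + g x).
Proof.
move=> Lf Lg; have [[mf _] [mg _]] := (Lf, Lg).
apply: (@Linf_bounded _ (cabs a * fine (Lpnorm mu +oo%E f) + fine (Lpnorm mu +oo%E g))).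
  by apply: cmeasurableD => //; apply: cmeasurableM => //; exact: cmeasurable_cst.
apply: filterS2 (Linf_ae_le mu_infinite Lf) (Linf_ae_le mu_infinite Lg) => x fx gx.
by rewrite (le_trans (ler_cabsD _ _))// lerD// cabsM ler_wpM2l ?cabs_ge0.
Qed.

Lemma Linf_clamp_all (f : 'I_m -> X -> R[i]) : (forall i, Lp mu +oo%E (f i)) ->
  exists g : 'I_m -> X -> R[i], [/\ forall i, cmeasurable setT (g i),
    forall i x, cabs (g i x) <= fine (Lpnorm mu +oo%E (f i)),
    forall i, Lp mu +oo%E (g i) & forall i, ae_equal mu (f i) (g i)].
Proof.
move=> Lf; have /choice[g Hg] := fun i => Linf_clamp (Lf i).
exists g; split => i; try by have [] := Hg i.
by have [mg gM _] := Hg i; exact: Linf_bounded mg (aeW _ gM).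
Qed.

Lemma limit_mod_exists f : (forall i, Lp mu +oo%E (f i)) -> exists h, limit_mod f h.
Proof.
move=> Lf; have [g [mg gM Lg fg]] := Linf_clamp_all Lf.
have [c [h [mh Hh]]] := partial_limit_bounded mg gM.
exists h; apply: (limit_mod_ae_eq Lg Lf); last by split => //; exists c.
by move=> i; apply: filterS (fg i) => x ->.
Qed.

Lemma ae_cst_of_ccvg (u : nat -> R[i]) (k : X -> R[i]) :
  {ae mu, forall x, ccvg u (k x)} -> exists c, {ae mu, forall x, k x = c}.
Proof.
move=> H; have [y _ Hy] := ae_ball_witness x0 ltr01 H.
by exists (k y); apply: filterS H => x Hx; exact: ccvg_unique Hx Hy.
Qed.

Lemma limit_mod_linear f i a g h1 h2 h3 :
  (forall j, Lp mu +oo%E (f j)) -> Lp mu +oo%E g ->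
  limit_mod (dfwith f i (fun x => a * f i x + g x)) h1 -> limit_mod f h2 ->
  limit_mod (dfwith f i g) h3 ->
  exists c, {ae mu, forall x, h1 x - (a * h2 x + h3 x) = c}.
Proof.
move=> Lf Lg /limit_mod_ae[c1 H1] /limit_mod_ae[c2 H2] /limit_mod_ae[c3 H3].
have lin : {ae mu, forall x (N : nat), partial (dfwith f i (fun x => a * f i x + g x)) N x =
    a * partial f N x + partial (dfwith f i g) N x}.
  apply: ae_foralln => N; case: HS => _ + _ _.
  move=> /(_ (fun j => crestrict (ball x0 N%:R) (f j)) i a (crestrict (ball x0 N%:R) g)).
  move=> /(_ (fun j => Linf_crestrict_Lp N%:R (p_gt0 j) (Lf j)) (Linf_crestrict_Lp N%:R (p_gt0 i) Lg)).
  apply: filterS => x; rewrite /partial.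
  rewrite (_ : dfwith _ i _ = fun j => crestrict (ball x0 N%:R) (dfwith f i (fun x => a * f i x + g x) j)); last first.
    apply/funext => j; have [->|ij] := eqVneq i j; last by rewrite !dfwithout.
    by rewrite !dfwithin; apply/funext => y; rewrite /crestrict; ring.
  rewrite [X in _ + S X _](_ : _ = fun j => crestrict (ball x0 N%:R) (dfwith f i g j)) //.
  by apply/funext => j; have [->|ij] := eqVneq i j; rewrite ?dfwithin ?dfwithout.
apply: (@ae_cst_of_ccvg (fun N => a * c2 N + c3 N - c1 N)).
apply: filterS2 (filterI H1 H2) (filterI H3 lin) => x [q1 q2] [q3 lx].
have := ccvgD q1 (ccvgN (ccvgD (ccvgZ a q2) q3)).
rewrite (_ : (fun _ => _) = (fun N => a * c2 N + c3 N - c1 N)) //.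
by apply/funext => N; rewrite lx; ring.
Qed.

(** On the truncations [S'] tends to [S' f] in measure, hence almost everywhere along a subsequence,
    while the limit [h] is reached after subtracting [c N]. So [S' f - h] is almost everywhere a
    limit of numbers that do not depend on the point, that is, a constant. *)
Lemma limit_mod_weak_extension (p' : 'I_m -> R) (s' : R) S' f : 0 < s' ->
  (forall i, 1 <= p' i) -> weak_extension mu eta T p' s' S' ->
  (forall i, Lp mu +oo%E (f i)) -> (forall i, Lp mu (p' i)%:E (f i)) -> limit_mod f (S' f).
Proof.
move=> s'0 p'1 HS' Lf Lf'.
have p'_gt0 j : 0 < p' j by exact: lt_le_trans (p'1 j).
have [h hh] := limit_mod_exists Lf; have [c Hc] := limit_mod_ae hh.
have mS' g : (forall i, Lp mu (p' i)%:E (g i)) -> cmeasurable setT (S' g).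
  by case: HS' => + _ _ _; exact.
pose F (N : nat) i := crestrict (ball x0 N%:R) (f i).
have LF N i : Lp mu (p' i)%:E (F N i) by exact: Linf_crestrict_Lp.
have cv : cvg_in_measure mu (fun N => S' (F N)) (S' f).
  apply: (weak_extension_cvg s'0 p'1 HS') => // i.
  apply: (@Lp_dominated _ _ _ mu (p' i) (fun N => F N i) (f i) (fun x => cabs (f i x))) => //.
  - by move=> N; case: (LF N i).
  - by case: (Lf i).
  - exact: Lp_integrable.
  - by move=> N x; exact: cabs_crestrict_le.
  - apply: aeW => x; apply: ccvg_eventually_cst.
    exists (Num.truncn (mdist x0 x)).+1 => // N /= NN; rewrite /F crestrict_in// in_ballE.
    by apply: (lt_le_trans (truncnS_gt _)); rewrite ler_nat.
have [sq sqk Hsq] := in_measure_subseq (mS' f Lf') (fun N => mS' _ (LF N)) cv.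
have agree : {ae mu, forall x (N : nat), partial f N x = S' (F N) x}.
  apply: ae_foralln => N.
  apply: (extensions_agree mu_ball mu_infinite (RD_regular HRD) eta01 x0 s0 s'0 p1 p'1 HS HS') => i;
    exact: Linf_crestrict_Lp.
have [k Hk] : exists k, {ae mu, forall x, S' f x - h x = k}.
  apply: (@ae_cst_of_ccvg (c \o sq)).
  apply: filterS2 (filterI Hc Hsq) agree => x [q1 q2] ax.
  have := ccvgD q2 (ccvgN (ccvg_sub sqk q1)).
  rewrite (_ : (fun _ => _) = c \o sq) //.
  by apply/funext => N; rewrite /= -ax; ring.
apply: (limit_mod_cst (c := k) hh (mS' f Lf')).
by apply: filterS Hk => x <-; ring.
Qed.

(** One truncation suffices: some [partial f N - c N] is within [e / 2] of [h] on the ball, and the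
    assumed oscillation bound is uniform in [N]. *)
Lemma limit_mod_osc f h M (x : X) (a A : R) : (forall i, cmeasurable setT (f i)) ->
  (forall i x, cabs (f i x) <= M i) -> limit_mod f h ->
  (forall g e, bounded_by M g -> 0 < e -> mean_osc_le mu (S g) x a (A + e)) ->
  0 < a -> forall e, 0 < e -> mean_osc_le mu h x a (A + e).
Proof.
move=> mf fM [mh [c Hc]] HA a0 e e0.
have e20 : 0 < e / 2 by rewrite divr_gt0.
have [j Hj] : exists j, ball x a `<=` B j.
  exists (Num.truncn (mdist x0 x + a)); apply: ball_sub; exact/ltW/truncnS_gt.
have [N HN] := Hc j _ e20; have {}HN := HN N (leqnn N).
have mB (r : R) (y : X) : measurable (ball y r) by exact: measurable_ballX.
have bP : bounded_by M (fun i => crestrict (ball x0 N%:R) (f i)).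
  split => i.
  exact: (crestrict_bsf (mB N%:R x0) (@subset_refl _ _) (mf i) (fM i)).
  by move=> y; rewrite (le_trans (cabs_crestrict_le _ _ _)).
have [z Hz] := HA _ _ bP e20; exists (z - c N).
have mP : cmeasurable setT (partial f N) by apply: (bsf_S_cmeasurable); case: bP.
have mPz : cmeasurable setT (fun y => partial f N y - z).
  exact: cmeasurableBc.
have mhz : cmeasurable setT (fun y => h y - (z - c N)).
  exact: cmeasurableBc.
have H2 : {ae mu, forall y, ball x a y ->
    cabs (h y - (z - c N)) <= cabs (partial f N y - z) + e / 2}.
  apply: filterS HN => y Hy By.
  have := ler_cabsB (partial f N y - z) (partial f N y - c N - h y).
  rewrite (_ : _ - _ - (_ - _ - _) = h y - (z - c N)); last by ring.
  by move/le_trans; apply; rewrite lerD2l; apply: Hy; exact: Hj.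
apply: (le_trans (integral_cabs_perturb (mB a x) mPz mhz (ltW e20) H2)).
rewrite (muE HRD) -EFinM; apply: (le_trans (leeD Hz (lexx _))).
by rewrite -EFinD lee_fin -mulrDl -addrA -splitr.
Qed.

End one_extension.

(** * Mean oscillation on small, intermediate and large balls *)

Section two_extensions.
Variables (rs : 'I_m -> R) (r : R) (Sr : ('I_m -> X -> R[i]) -> X -> R[i]).
Variables (ls : 'I_m -> R) (l q : R) (Sq : ('I_m -> X -> R[i]) -> X -> R[i]).
Hypotheses (r0 : 0 < r) (l0 : 0 < l) (q1 : 1 < q).
Hypotheses (rs1 : forall i, 1 <= rs i) (ls1 : forall i, 1 <= ls i).
Hypotheses (rE : r^-1 = \sum_(i < m) (rs i)^-1) (lE : l^-1 = \sum_(i < m) (ls i)^-1).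
Hypothesis lq : l / q <= alpha * kappa / n.
Hypothesis HSr : weak_extension mu eta T rs r Sr.
Hypothesis HSq : weak_extension mu eta T ls q Sq.

Let q0 : 0 < q. Proof. exact: lt_trans q1. Qed.
Let mS f := @bsf_S_cmeasurable ls q Sq ls1 HSq f.

Local Notation vol := (vol mu).
Local Notation outer := outer_radius.

Lemma osc_from_local : exists2 C : R, 0 <= C & forall M g x a Lam,
  bounded_by M g -> 0 < a -> 0 <= Lam ->
  vol x (outer a) `^ l^-1 <= Lam * vol x a `^ q^-1 ->
  mean_osc_le mu (Sq g) x a (C * (Lam + 1) * \prod_(i < m) M i).
Proof.
have [C C0 HC] := local_integral q0 ls1 HSq lE q1.
have [C' C'0 HC'] := kernel_osc q0 ls1 HSq.
exists (C + C'); first by rewrite addr_ge0.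
move=> M g x a Lam gM a0 Lam0 HLam.
have P0 := prod_bound_ge0 gM; set P := \prod_(i < m) M i in P0 *.
have oa : 0 < outer a by rewrite (lt_trans a0)// (outer_radius_gt a0).
have V0 := vol_gt0 HRD x a0.
have mB : measurable (ball x a) by exact: measurable_ballX.
have mQ : measurable (ball x (outer a)) by exact: measurable_ballX.
pose gQ i := crestrict (ball x (outer a)) (g i).
have mg : cmeasurable setT (Sq g) by apply: mS; case: gM.
have mgQ : cmeasurable setT (Sq gQ) by apply: mS => i; apply: bsf_crestrict => //; case: gM.
have [z Hz] := HC' M g x a gM a0.
have I1 := HC M g x a (outer a) Lam gM a0 oa Lam0 HLam.
have mgz : cmeasurable setT (fun y => Sq g y - z).
  exact: cmeasurableBc.
exists z.
have CP0 : 0 <= C' * P by rewrite mulr_ge0.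
have H2 : {ae mu, forall y, ball x a y -> cabs (Sq g y - z) <= cabs (Sq gQ y) + C' * P}.
  apply: filterS Hz => y Hy By.
  have := ler_cabsD (Sq gQ y) (Sq g y - Sq gQ y - z).
  rewrite (_ : _ + (_ - _ - _) = Sq g y - z); last by ring.
  by move/le_trans; apply; rewrite lerD2l; exact: Hy.
apply: (le_trans (integral_cabs_perturb mB mgQ mgz CP0 H2)).
rewrite (muE HRD) -EFinM; apply: (le_trans (leeD I1 (lexx _))).
rewrite -EFinD lee_fin -/P -mulrDl ler_wpM2r ?(ltW V0)//.
have h1 : 0 <= C' * Lam * P by rewrite !mulr_ge0.
have h2 : 0 <= C * P by rewrite mulr_ge0.
rewrite (_ : (C + C') * (Lam + 1) * P = C * Lam * P + C' * P + (C' * Lam * P + C * P)); last by ring.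
by rewrite lerDl addr_ge0.
Qed.

Lemma small_osc_bound : exists2 C : R, 0 <= C & forall M g x a,
  bounded_by M g -> 0 < a -> a <= 1 -> mean_osc_le mu (Sq g) x a (C * \prod_(i < m) M i).
Proof.
have [C C0 HC] := osc_from_local.
have [v [w [v0 w0 [_ vs vl]]]] := vol_bounds HRD.
have C30 := RD_C3_gt0 HRD; have n0 := RD_n_gt0 HRD.
pose W := C3 * 5 `^ n * w; have W0 : 0 < W by rewrite !mulr_gt0// powR_gt0.
pose Lam := W `^ l^-1 / v `^ q^-1.
have Lam0 : 0 <= Lam by rewrite divr_ge0 ?powR_ge0.
exists (C * (Lam + 1)); first by rewrite mulr_ge0// addr_ge0.
move=> M g x a gM a0 a1; apply: HC => //.
have aa0 : 0 < a `^ alpha by rewrite powR_gt0.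
have aa1 : a `^ alpha <= 1.
  by rewrite -(powRr0 a) ger_powR ?a0// ltW.
have h1 : vol x (outer a) <= W * a `^ (alpha * kappa).
  rewrite /outer_radius a1; apply: (le_trans (vol_up HRD x aa0 _)); first by rewrite ler1n.
  have CC : 0 <= C3 * 5 `^ n by rewrite mulr_ge0 ?powR_ge0// ltW.
  rewrite powRrM /W -[leRHS]mulrA; apply: ler_wpM2l => //.
  exact: vs.
have h2 : v * a `^ n <= vol x a by exact: vl.
apply: (@le_trans _ _ ((W * a `^ (alpha * kappa)) `^ l^-1)).
  have W1 : 0 <= W * a `^ (alpha * kappa) by apply: mulr_ge0; [exact: ltW|exact: powR_ge0].
  by rewrite ge0_ler_powR ?nnegrE ?(vol_ge0 mu)// invr_ge0 ltW.
apply: (@le_trans _ _ (Lam * (v * a `^ n) `^ q^-1)); last first.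
  have v1 : 0 <= v * a `^ n by apply: mulr_ge0; [exact: ltW|exact: powR_ge0].
  by rewrite ler_wpM2l// ge0_ler_powR ?nnegrE ?(vol_ge0 mu)// invr_ge0 ltW.
rewrite (@powRM _ W _ _ (ltW W0) (powR_ge0 _ _)) (@powRM _ v _ _ (ltW v0) (powR_ge0 _ _)).
rewrite /Lam -!powRrM.
rewrite mulrA divfK ?gt_eqF ?powR_gt0// ler_wpM2l ?powR_ge0// ger_powR ?a0//.
(* The inequality left between the exponents, [n / q <= alpha * kappa / l], is [lq] with the
   denominators cleared. *)
rewrite ler_pdivrMr// mulrAC ler_pdivlMr//.
by move: lq; rewrite ler_pdivrMr// mulrAC ler_pdivlMr// mulrC.
Qed.

(** On a bounded range of radii all volumes are comparable. The constant depends on [Rad]; it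
    provides the finite bound from which [john_stromberg] starts. *)
Lemma mid_osc_bound (Rad : R) : 1 <= Rad -> exists2 C : R, 0 <= C & forall M g x a,
  bounded_by M g -> 1 <= a -> a <= Rad -> mean_osc_le mu (Sq g) x a (C * \prod_(i < m) M i).
Proof.
move=> Rad1; have [C C0 HC] := osc_from_local.
have [v [w [v0 w0 [vb _ vl]]]] := vol_bounds HRD.
pose Lam := (w * (5 * Rad) `^ n) `^ l^-1 / v `^ q^-1.
have Lam0 : 0 <= Lam by rewrite divr_ge0 ?powR_ge0.
exists (C * (Lam + 1)); first by rewrite mulr_ge0// addr_ge0.
move=> M g x a gM a1 aR; have a0 : 0 < a by exact: lt_le_trans a1.
apply: HC => //.
have oa : outer a <= 5 * Rad.
  rewrite /outer_radius ler_wpM2l//; case: ifPn => // a1'.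
  apply: le_trans Rad1; rewrite -(powRr0 a) ger_powR ?a0// ltW//.
have h1 : vol x (outer a) <= w * (5 * Rad) `^ n.
  apply: (le_trans (vol_mono HRD x oa)); apply: vb.
  by move: Rad1; lra.
have h2 : v <= vol x a.
  have := vl x 1 ltr01 (lexx _); rewrite powR1 mulr1 => /le_trans; apply.
  exact: (vol_mono HRD).
have w5 : 0 <= w * (5 * Rad) `^ n by rewrite mulr_ge0 ?powR_ge0// ltW.
apply: (@le_trans _ _ ((w * (5 * Rad) `^ n) `^ l^-1)).
  rewrite ge0_ler_powR ?nnegrE ?(vol_ge0 mu)//.
  by rewrite invr_ge0 ltW.
rewrite /Lam -mulrA ler_peMr ?powR_ge0// mulrC ler_pdivlMr ?powR_gt0// mul1r.
by rewrite ge0_ler_powR ?nnegrE ?(vol_ge0 mu) ?(ltW v0)// invr_ge0 ltW.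
Qed.

(** As [r^-1] is the sum of the [(rs i)^-1], the weak bound of [Sr] is invariant under scaling once
    the outer radius is [5 * a], and the growth of volumes replaces the relation between [l] and
    [q]. It applies to [Sq] because both extensions agree on [gQ]. *)
Lemma weak_osc_bound (s : R) : 0 < s -> exists2 C : R, 0 <= C & forall M g x a,
  bounded_by M g -> 2 <= a -> exists c : R[i],
  (mu (ball x a `&` [set y | C * \prod_(i < m) M i < cabs (Sq g y - c)])%R <= (s * vol x a)%:E)%E.
Proof.
move=> s0.
have [C' C'0 HC'] := kernel_osc q0 ls1 HSq.
have [C C0 HC] := local_weak r0 rs1 HSr rE.
have C30 := RD_C3_gt0 HRD.
pose U := C3 * 5 `^ n; have U0 : 0 < U by rewrite mulr_gt0// powR_gt0.
(* Chosen so that [C / lam], raised to the power [r], is at most [s / U]; the added 1 keeps [lam]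
   positive when [C = 0]. *)
pose lam := C / (s / U) `^ r^-1 + 1.
have sU : 0 < (s / U) `^ r^-1 by rewrite powR_gt0// divr_gt0.
have lam0 : 0 < lam by rewrite ltr_wpDl// divr_ge0// ltW.
exists (C' + lam); first by rewrite addr_ge0// ltW.
move=> M g x a gM a2; have a0 : 0 < a by exact: lt_le_trans a2.
have P0 := prod_bound_ge0 gM; set P := \prod_(i < m) M i in P0 *.
have outerE : outer a = 5 * a.
  by rewrite /outer_radius; case: ifPn => // h; exfalso; move: h a2; lra.
have oa0 : 0 < outer a by rewrite outerE mulr_gt0.
have mQ : measurable (ball x (outer a)) by exact: measurable_ballX.
pose gQ i := crestrict (ball x (outer a)) (g i).
have bQ i : bsf x0 (gQ i) by apply: bsf_crestrict => //; case: gM.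
have mg : cmeasurable setT (Sq g) by apply: mS; case: gM.
have mgQ : cmeasurable setT (Sq gQ) by exact: mS.
have mgQr : cmeasurable setT (Sr gQ) by exact: (bsf_S_cmeasurable rs1 HSr).
have agree := extensions_agree_bsf mu_ball (RD_infinite HRD) (RD_regular HRD) eta01 q0 r0 ls1 rs1 HSq HSr bQ.
have [z Hz] := HC' M g x a gM a0; exists z.
have V0 := vol_gt0 HRD x a0.
have level : (mu [set y | lam * P < cabs (Sr gQ y)]%R <= (s * vol x a)%:E)%E.
  have H t := HC M g x (outer a) gM oa0 t; rewrite -/P -/gQ in H.
  have [P00|P00] := eqVneq P 0.
    rewrite P00 mulr0 ae_level_eq0// ?lee_fin ?mulr_ge0 ?(ltW s0) ?(ltW V0)// => t t0.
    apply/eqP; rewrite eq_le measure_ge0 andbT (le_trans (H t t0))//.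
    by rewrite P00 mulr0 !mul0r powR0// gt_eqF.
  have P1 : 0 < P by rewrite lt_neqAle eq_sym P00.
  apply: (le_trans (H _ (mulr_gt0 lam0 P1))); rewrite lee_fin.
  have VQ : vol x (outer a) <= U * vol x a.
    by rewrite outerE; apply: (vol_up HRD) => //; rewrite ler1n.
  rewrite (_ : C * P * _ / (lam * P) = (C / lam) * vol x (outer a) `^ r^-1); last first.
    by field; rewrite P00 gt_eqF.
  rewrite powRM ?powR_ge0 ?divr_ge0 ?(ltW lam0)// -powRrM mulVf ?gt_eqF// powRr1 ?(vol_ge0 mu)//.
  apply: (@le_trans _ _ ((s / U) * (U * vol x a))); last first.
    by rewrite mulrA divfK// gt_eqF.
  rewrite ler_pM ?powR_ge0 ?(vol_ge0 mu)//.
  rewrite -[leRHS]powRr1 ?divr_ge0 ?(ltW s0) ?(ltW U0)// -(@mulVf _ r) ?gt_eqF// powRrM.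
  rewrite ge0_ler_powR ?nnegrE ?powR_ge0 ?divr_ge0 ?(ltW r0) ?(ltW lam0)//.
  rewrite ler_pdivrMr// mulrC -ler_pdivrMr// /lam lerDl//.
apply: le_trans level.
have mA : measurable (ball x a `&` [set y | (C' + lam) * P < cabs (Sq g y - z)]).
  apply: measurableI; first exact: measurable_ballX.
  apply: measurable_cabs_gt; exact: cmeasurableBc.
apply: ae_le_measure => //; first exact: measurable_cabs_gt.
apply: filterS2 Hz agree => y Hy E [By /= h].
rewrite -E ltNge; apply/negP => h2.
have := ler_cabsD (Sq gQ y) (Sq g y - Sq gQ y - z).
rewrite (_ : _ + (_ - _ - _) = Sq g y - z); last by ring.
have := Hy By; rewrite -/P -/gQ; move: h h2; rewrite mulrDl; lra.
Qed.

Lemma uniform_osc_bound : exists2 C : R, 0 <= C & forall M g x a e,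
  bounded_by M g -> 0 < a -> 0 < e ->
  mean_osc_le mu (Sq g) x a (C * \prod_(i < m) M i + e).
Proof.
have [Cs Cs0 Hs] := small_osc_bound.
have C10 := doubling_gt0 HRD x0.
have s0 : 0 < (40 * C1 ^+ 2)^-1 by rewrite invr_gt0 mulr_gt0// exprn_gt0.
have [Cw Cw0 Hw] := weak_osc_bound s0.
pose D := 2 * ((2 + 5 * C1 ^+ 2) * (Cw + Cs)).
have D0 : 0 <= D by rewrite !mulr_ge0 ?addr_ge0// mulr_ge0// exprn_ge0// ltW.
exists (D + Cs); first by rewrite addr_ge0.
move=> M g x a e gM a0 e0; have P0 := prod_bound_ge0 gM.
set P := \prod_(i < m) M i in P0 *.
have mg : cmeasurable setT (Sq g) by apply: mS; case: gM.
have [a1|a1] := leP a 1.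
  have [c Hc] := Hs M g x a gM a0 a1; exists c; apply: (le_trans Hc).
  rewrite lee_fin ler_wpM2r ?(vol_ge0 mu)// -/P mulrDl.
  by rewrite -addrA addrCA lerDl; apply: addr_ge0; [exact: mulr_ge0|exact: ltW].
(* The radius [a] itself serves as [Rad]; [Cm] depends on it, the bound obtained from
   [john_stromberg] does not. *)
have [Cm Cm0 Hm] := mid_osc_bound (ltW a1).
have := @john_stromberg _ _ _ mu _ _ _ _ _ HRD (Sq g) (Cw * P) (Cs * P) mg
  (mulr_ge0 Cw0 P0) (mulr_ge0 Cs0 P0)
  (fun x' r' r2 => Hw M g x' r' gM r2)
  (fun x' r' r2 r1 => Hs M g x' r' gM (lt_trans (divr_gt0 ltr01 (ltr0n _ 2)) r2) r1)
  a (Cm * P) e (mulr_ge0 Cm0 P0) e0 (fun x' r' r1 r2 => Hm M g x' r' gM r1 r2)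
  x a (ltW a1) (lexx _).
move=> [c Hc]; exists c; apply: (le_trans Hc).
rewrite lee_fin ler_wpM2r ?(vol_ge0 mu)// lerD2r -mulrDl mulrA mulrA -/D.
by rewrite -[2 * _ * _]mulrA -/D ler_wpM2r// lerDl.
Qed.

End two_extensions.
End oscillation.

(** * The extension to BMO *)

Section BMO_criterion.
Context {R : realType} {d : measure_display} {X : borelMetricType R d}.
Variable mu : {sigma_finite_measure set X -> \bar R}.
Variables C1 C2 C3 kappa n : R.
Hypothesis HRD : RD_space mu C1 C2 C3 kappa n.
Implicit Types h : X -> R[i].

Let mu_ball := RD_ball_lty HRD.

Lemma mean_osc_cintegrable h (x : X) a A : cmeasurable setT h ->
  mean_osc_le mu h x a A -> cintegrable mu (ball x a) h.
Proof.
move=> mh [c Hc].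
have mB : measurable (ball x a) by exact: measurable_ballX.
have mhc : cmeasurable setT (fun y => h y - c).
  exact: cmeasurableBc.
have ic : cintegrable mu (ball x a) (fun=> c).
  apply: cintegrableP => //; first exact: cmeasurable_cst.
  by rewrite integral_cst// lte_mul_pinfty ?lee_fin ?cabs_ge0 ?mu_ball.
have ihc : cintegrable mu (ball x a) (fun y => h y - c).
  apply: cintegrableP => //; first exact: cmeasurableS mhc.
  exact: le_lt_trans Hc (ltry _).
rewrite (_ : h = fun y => (h y - c) + c); first exact: cintegrableD.
by apply/funext => y; rewrite subrK.
Qed.

(** The constant [c] is within [2 * A] of the mean, with the factor 2 of [cabs_cintegral_le];
    together with the oscillation [A] about [c] this makes 3. *)
Lemma mean_osc_mean h (x : X) a A : cmeasurable setT h -> 0 < a ->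
  mean_osc_le mu h x a A ->
  ((fine (mu (ball x a)))^-1%:E *
    \int[mu]_(y in ball x a) (cabs (h y - mean mu (ball x a) h))%:E <= (3 * A)%:E)%E.
Proof.
move=> mh a0 hA; have ih := mean_osc_cintegrable mh hA; have [c Hc] := hA.
have mB : measurable (ball x a) by exact: measurable_ballX.
have V0 := vol_gt0 HRD x a0.
have ic : cintegrable mu (ball x a) (fun=> c).
  apply: cintegrableP => //; first exact: cmeasurable_cst.
  by rewrite integral_cst// lte_mul_pinfty ?lee_fin ?cabs_ge0 ?mu_ball.
have E : c - mean mu (ball x a) h =
    - (((vol mu x a)^-1)%:C%C * cintegral mu (ball x a) (fun y => h y - c)).
  rewrite (cintegralB mB ih ic) mulrBr -/(mean mu (ball x a) h) opprB; congr (_ - _).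
  have -> : cintegral mu (ball x a) (fun=> c) = (vol mu x a)%:C%C * c.
    rewrite /cintegral /Rintegral !integral_cst// (muE HRD) -!EFinM/=.
    by apply: complex_eq; rewrite ?cReM ?cImM /= mul0r ?subr0 ?addr0 mulrC.
  by rewrite mulrA -rmorphM/= mulVf ?gt_eqF// mul1r.
have cm : cabs (c - mean mu (ball x a) h) <= 2 * A.
  rewrite E cabsN cabsM cabs_real ger0_norm ?invr_ge0 ?(vol_ge0 mu)//.
  rewrite mulrC ler_pdivrMr// -mulrA; apply: cabs_cintegral_le => //.
  apply: (@cmeasurableS _ _ _ _ setT) => //.
  exact: cmeasurableBc.
have := integral_dist_le (mean mu (ball x a) h) mB mh (muE HRD x a) Hc.
move=> I; rewrite -/(vol mu x a).
apply: (@le_trans _ _ ((vol mu x a)^-1%:E * ((A + cabs (c - mean mu (ball x a) h)) * vol mu x a)%:E)%E).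
  by apply: lee_wpmul2l => //; rewrite lee_fin invr_ge0 (vol_ge0 mu).
by rewrite -EFinM lee_fin mulrC mulfK ?gt_eqF//; lra.
Qed.

Lemma BMOnorm_le h (A : R) : cmeasurable setT h ->
  (forall x a e, 0 < a -> 0 < e -> mean_osc_le mu h x a (A + e)) ->
  L1loc mu h /\ (BMOnorm mu h <= (3 * A)%:E)%E.
Proof.
move=> mh H; split.
  by move=> x a a0; apply: (mean_osc_cintegrable mh); exact: (H x a 1 a0 ltr01).
apply/ge_ereal_sup => _ [x [a [a0 ->]]].
apply/lee_addgt0Pr => e e0; rewrite -EFinD.
have := mean_osc_mean mh a0 (H x a (e / 3) a0 (divr_gt0 e0 (ltr0n _ 3))).
by rewrite mulrDr mulrCA divff ?mulr1.
Qed.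

Lemma BMOnorm_ge0 h : X -> (0 <= BMOnorm mu h)%E.
Proof.
move=> x0; apply: (@le_trans _ _ (((fine (mu (ball x0 1)))^-1)%:E *
  \int[mu]_(y in ball x0 1) (cabs (h y - mean mu (ball x0 1) h))%:E)%E).
  apply: mule_ge0; first by rewrite lee_fin invr_ge0 fine_ge0.
  by apply: integral_ge0 => y _; rewrite lee_fin cabs_ge0.
by apply: ereal_sup_ubound; exists x0, 1.
Qed.

Lemma BMO_equal_ae_cst h h' (c : R[i]) : X -> cmeasurable setT h -> cmeasurable setT h' ->
  {ae mu, forall x, h x - h' x = c} -> BMO_equal mu h h'.
Proof.
move=> x0 mh mh' hc; have mhh : cmeasurable setT (fun x => h x - h' x) by exact: cmeasurableB.
apply/eqP; rewrite eq_le BMOnorm_ge0// andbT.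
have [|_] := @BMOnorm_le (fun x => h x - h' x) 0 mhh; last by rewrite mulr0.
move=> x a e a0 e0; exists c.
have mB : measurable (ball x a) by exact: measurable_ballX.
rewrite (_ : (\int[mu]_(_ in _) _ = 0)%E).
  by rewrite lee_fin add0r mulr_ge0 ?(ltW e0) ?(vol_ge0 mu).
rewrite -[RHS](integral0 mu (ball x a)); apply: ge0_ae_eq_integral => //.
- apply/measurable_EFinP; apply: (measurable_funS measurableT) => //; apply: measurable_cabs.
  exact: cmeasurableBc.
- by move=> y _; rewrite lee_fin cabs_ge0.
- by apply: filterS hc => y -> _; rewrite subrr cabs0.
Qed.

End BMO_criterion.

Lemma harmonic_exponent_gt0 {R : realType} (m : nat) (p : 'I_m -> R) (r : R) : (0 < m)%N ->
  (forall i, 1 <= p i) -> r^-1 = \sum_(i < m) (p i)^-1 -> 0 < r.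
Proof.
case: m p => // m p _ p1 rE; rewrite -invr_gt0 rE big_ord_recl ltr_pwDl//.
  by rewrite invr_gt0 (lt_le_trans ltr01).
by apply: sumr_ge0 => i _; rewrite invr_ge0 (le_trans ler01).
Qed.

Theorem theorem3p1 (R : realType) (d : measure_display)
    (X : borelMetricType R d) (mu : {sigma_finite_measure set X -> \bar R})
    (C1 C2 C3 kappa n : R) (m : nat) (eta : R)
    (T : ('I_m -> X -> R[i]) -> (X -> R[i]) -> R[i])
    (K : m.+1.-tuple X -> R[i]) (eps alpha p0 p0' : R)
    (rs : 'I_m -> R) (r : R) (ls : 'I_m -> R) (l q : R) :
  RD_space mu C1 C2 C3 kappa n ->
  (0 < m)%N ->
  GSSIO mu kappa n eta T K eps alpha p0 p0' rs r ls l q ->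
  1 < q ->
  \big[Num.max/0]_(i < m) Num.max (rs i) (ls i) <= p0' ->
  exists S : ('I_m -> X -> R[i]) -> X -> R[i],
    BMO_extension mu eta T rs r ls q S.
Proof.
move=> HRD m0 [eta01 _ _ TK HK rs1 rE [Sr HSr] ls1 lE /andP[_ lq] [Sq HSq]] q1 _.
(* Infinite measure provides the base point at which the truncations are centred. *)
have [x0] : inhabited X.
  apply: contrapT => X0; have := RD_infinite HRD.
  rewrite (_ : [set: X] = set0) ?measure0//; apply/seteqP; split => // x _.
  by apply: X0; exists.
have r0 := harmonic_exponent_gt0 m0 rs1 rE; have l0 := harmonic_exponent_gt0 m0 ls1 lE.
have q0 : 0 < q by exact: lt_trans q1.
have agree f : (forall i, Lp mu (ls i)%:E (f i)) -> (forall i, Lp mu (rs i)%:E (f i)) ->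
    ae_equal mu (Sq f) (Sr f).
  exact: (extensions_agree (RD_ball_lty HRD) (RD_infinite HRD) (RD_regular HRD) eta01 x0
    q0 r0 ls1 rs1 HSq HSr).
have lim_r := limit_mod_weak_extension HRD HK eta01 TK x0 q0 ls1 HSq r0 rs1 HSr.
have lim_l := limit_mod_weak_extension HRD HK eta01 TK x0 q0 ls1 HSq q0 ls1 HSq.
(* The limit of the truncations is fixed only up to a constant, while agreement with the weak
   extensions and with [T] on test functions is required almost everywhere. On the corresponding
   spaces the values of [Sq] or [Sr] are therefore taken; by [lim_l] and [lim_r] they are limits
   too. *)
have /choice[S HS] : forall f : 'I_m -> X -> R[i], exists h : X -> R[i],
  [/\ (forall i, Lp mu +oo%E (f i)) -> limit_mod mu x0 Sq f h,
    (forall i, Lp mu (ls i)%:E (f i)) -> h = Sq f &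
    (forall i, Lp mu (rs i)%:E (f i)) -> ae_equal mu h (Sr f)].
  move=> f; have [fl|fl] := pselect (forall i, Lp mu (ls i)%:E (f i)).
    by exists (Sq f); split => // H; [exact: lim_l|exact: agree].
  have [fr|fr] := pselect (forall i, Lp mu (rs i)%:E (f i)).
    by exists (Sr f); split => // [H|_]; [exact: lim_r|exact: aeW].
  have [fo|fo] := pselect (forall i, Lp mu +oo%E (f i)); last by exists (cst 0).
  have [h hh] := limit_mod_exists HRD HK eta01 TK x0 q0 ls1 HSq fo.
  by exists h.
have lim f : (forall i, Lp mu +oo%E (f i)) -> limit_mod mu x0 Sq f (S f).
  by have [] := HS f.
have mS f : (forall i, Lp mu +oo%E (f i)) -> cmeasurable setT (S f) by case/lim.
have [C C0 HC] := uniform_osc_bound HRD HK eta01 TK x0 r0 l0 q1 rs1 ls1 rE lE lq HSr HSq.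
have bound f : (forall i, Lp mu +oo%E (f i)) -> L1loc mu (S f) /\
    (BMOnorm mu (S f) <= (3 * C * \prod_(i < m) fine (Lpnorm mu +oo%E (f i)))%:E)%E.
  move=> Lf; have [g [mg gM Lg fg]] := Linf_clamp_all HRD Lf.
  rewrite -mulrA; apply: (BMOnorm_le HRD (mS f Lf)) => x a e a0 e0.
  have lg := limit_mod_ae_eq HRD q0 ls1 HSq Lf Lg fg (lim f Lf).
  apply: (limit_mod_osc HRD ls1 HSq mg gM lg) => // g' e' bg' e'0.
  exact: HC.
exists S; split.
- by move=> f /bound[L B]; split => //; exact: le_lt_trans B (ltry _).
- move=> f i a g Lf Lg.
  have Lfg : Lp mu +oo%E (fun x => a * f i x + g x).
    exact: (LinfZD HRD).
  have L1 := @dfwith_all _ _ (fun=> Lp mu +oo%E) _ i _ Lf Lfg.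
  have L2 := @dfwith_all _ _ (fun=> Lp mu +oo%E) _ i _ Lf Lg.
  have [c Hc] := limit_mod_linear HRD ls1 HSq Lf Lg (lim _ L1) (lim _ Lf) (lim _ L2).
  apply: (BMO_equal_ae_cst HRD x0 (mS _ L1) _ Hc).
  apply: cmeasurableD; last exact: mS.
  by apply: cmeasurableM; [exact: cmeasurable_cst|exact: mS].
- by exists (3 * C) => f /bound[].
- move=> f Cf; have -> : S f = Sq f.
    have [_ + _] := HS f; apply => i; apply: (bsf_Lp (RD_ball_lty HRD) (x0 := x0)).
      exact: lt_le_trans (ls1 i).
    apply: (Cb_bsf (RD_ball_lty HRD) (RD_infinite HRD)) (Cf i).
    by case/andP: eta01.
  by case: HSq => _ _ _; exact.
- split=> S' HS' f Lf Lf'.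
    have [_ _ Sf] := HS f; apply: filterS2 (Sf Lf') (extensions_agree (RD_ball_lty HRD)
      (RD_infinite HRD) (RD_regular HRD) eta01 x0 r0 r0 rs1 rs1 HSr HS' Lf' Lf') => x -> ->.
    by [].
  have [_ Sf _] := HS f; rewrite (Sf Lf').
  exact: (extensions_agree (RD_ball_lty HRD) (RD_infinite HRD) (RD_regular HRD) eta01 x0
    q0 q0 ls1 ls1 HSq HS' Lf' Lf').
Qed.
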